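(* Let $\Gamma$ be a planar trivalent graph equipped with a diagonal (abelian) holonomy $\psi$, i.e. there is a map $t:H\to\mathbb{R}^*$ with $\psi_h=\begin{pmatrix}t_h&0\\0&t_h^{-1}\end{pmatrix}$ for every half-edge $h$. Then $$Z(\Gamma,\psi)=\Big(\sum_{\gamma\in C(\Gamma)}(-1)^{\mathrm{cr}(\gamma)}\,\mathrm{Tr}(\gamma)\,X^\gamma\Big)^{-1}.$$
   Context: **Graphs.** $\Gamma$ is a finite connected trivalent graph with at least one vertex, loops and multiple edges allowed, with vertex set $V$, edge set $E$, and set $H$ of half-edges (each edge $e$ is divided into two half-edges; a half-edge $(e,v)$ is oriented so that it goes out of its vertex $v$). At each vertex the three half-edges carry a cyclic order. Planar means embedded in the plane with all cyclic orders induced by one orientation of the plane. An angle is an unordered pair of distinct half-edges at the same vertex; $A$ is the set of angles. **Curves.** $C(\Gamma)$ is the set of all oriented curves immersed in $\Gamma$ which pass over each edge of $\Gamma$ either $0$, $1$ or $2$ times, in the latter case with opposite orientations. Here a curve may be empty or have several components; combinatorially, an element of $C(\Gamma)$ is a finite collection of closed oriented non-backtracking edge-paths (each up to cyclic reparametrization; passing from a half-edge to a different half-edge at each vertex), traversing in total each edge at most once in each direction. $\mathrm{cr}(\gamma)$ is the number modulo 2 of crossings of the corresponding immersion (perturb $\gamma$ to a generic immersion in a thin planar neighborhood of $\Gamma$, following $\gamma$ smoothly without additional kinks). $X^\gamma=\prod_{\alpha\subset\gamma}X_\alpha$, each angle appearing as many times ($0$, $1$ or $2$) as $\gamma$ turns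 through it. $\mathrm{Tr}(\gamma)=\prod_{h\subset\gamma}t_h^{\epsilon(\gamma,h)}$, one factor for each passage of $\gamma$ over a half-edge $h$, with $\epsilon(\gamma,h)=1$ if $\gamma$ crosses $h$ in the positive direction (away from the vertex) and $-1$ otherwise. **Colorings.** An admissible coloring is a map $c:E\to\mathbb{N}=\{0,1,2,\dots\}$ such that at every vertex, with incident edges $i,j,k$, $c_i+c_j+c_k$ is even and $c_i\le c_j+c_k$, $c_j\le c_i+c_k$, $c_k\le c_i+c_j$. For the angle $\alpha$ between $i$ and $j$ at a vertex with third edge $k$, put $c_\alpha=(c_i+c_j-c_k)/2$. **Evaluation.** Fix a total order on $H$ for which the three half-edges at each vertex are consecutive and, listed increasingly as $v_1<v_2<v_3$, follow the cyclic order at $v$. For an edge $e$ let $e_1<e_2$ be its half-edges. Two edges $e,e'$ cross if $e_1<e'_1<e_2<e'_2$ or $e'_1<e_1<e'_2<e_2$. For $\psi:H\to\mathrm{SL}_2(\mathbb{C})$ and $c$ admissible, $$\langle\Gamma,c,\psi\rangle=(-1)^{\sum_{\{e,e'\}\text{ crossing}}c_ec_{e'}}\prod_{e\in E}\frac{1}{(c_e!)^2}\Big(\frac{\partial}{\partial z_{e_1}}\frac{\partial}{\partial w_{e_2}}-\frac{\partial}{\partial z_{e_2}}\frac{\partial}{\partial w_{e_1}}\Big)^{c_e}\ \prod_{v\in V}\epsilon_v,$$ where $(z_h,w_h)$, $h\in H$, are independent variables and $\epsilon_v$ is the polynomial $$(z_{v_2}w_{v_1}-z_{v_1}w_{v_2})^{\frac{c_{v_1}+c_{v_2}-c_{v_3}}2}(z_{v_3}w_{v_2}-z_{v_2}w_{v_3})^{\frac{c_{v_2}+c_{v_3}-c_{v_1}}2}(z_{v_3}w_{v_1}-z_{v_1}w_{v_3})^{\frac{c_{v_1}+c_{v_3}-c_{v_2}}2}$$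 in which each $(z_h,w_h)$ has been replaced by $\psi_h^{-1}(z_h,w_h)$; $c_{v_i}$ is the color of the edge containing $v_i$. (This is independent of the chosen order.) **Generating series.** $R_X=\mathbb{C}[[X_\alpha,\alpha\in A]]$, $X^c=\prod_{\alpha}X_\alpha^{c_\alpha}$, $$Z(\Gamma,\psi)=\sum_{c\text{ admissible}}\langle\Gamma,c,\psi\rangle\frac{\prod_{e}c_e!}{\prod_\alpha c_\alpha!}\,X^c\in R_X.$$ *)

(* Defs.v *)
From HB Require Import structures.
From mathcomp Require Import all_boot all_order all_algebra.
From mathcomp Require Import reals complex.
From mathcomp Require Import mpoly zify.

Set Implicit Arguments.
Unset Strict Implicit.
Unset Printing Implicit Defensive.

Import Order.TTheory GRing.Theory Num.Theory.
Local Open Scope ring_scope.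

(* [vnext] is the cyclic order: it acts on the three half-edges at a vertex as
   a permutation of order three without fixed point, that is, as a 3-cycle.
   Loops and multiple edges are allowed. *)
Record trivalent_graph := TrivalentGraph {
  vertex : finType;
  edge : finType;
  half_edge : finType;
  origin : half_edge -> vertex;
  edge_of : half_edge -> edge;
  vnext : half_edge -> half_edge;
  card_star : forall v, #|[set h | origin h == v]| = 3;
  card_ends : forall e, #|[set h | edge_of h == e]| = 2;
  origin_vnext : forall h, origin (vnext h) = origin h;
  vnext_neq : forall h, vnext h != h;
  vnextK3 : forall h, vnext (vnext (vnext h)) = h }.

Section Graph.
Variable G : trivalent_graph.
Local Notation V := (vertex G).
Local Notation E := (edge G).
Local Notation H := (half_edge G).

(* The other half of the same edge; the default value of [odflt] is never
   used, by [card_ends]. *)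
Definition mate (h : H) : H :=
  odflt h [pick k | (edge_of k == edge_of h) && (k != h)].

Definition graph_connected : Prop :=
  forall v w : V,
    connect [rel x y | [exists h : H, (origin h == x) && (origin (mate h) == y)]]
            v w.

Definition is_angle (a : {set H}) : bool :=
  (#|a| == 2)%N && [forall h in a, forall k in a, origin h == origin k].
Definition angle := {a : {set H} | is_angle a}.

Section Planarity.
Variable R : realType.
Local Notation point := 'rV[R]_2.

(* The point at parameter u in [0, 1] of the i-th segment of a polygonal
   path. *)
Definition poly_at (s : seq point) (i : nat) (u : R) : point :=
  (1 - u) *: s`_i + u *: s`_i.+1.

Definition poly_param (s : seq point) (i : nat) (u : R) : Prop :=
  (i.+1 < size s)%N /\ 0 <= u <= 1.

Definition cross (a b : point) : R :=
  a 0 0 * b 0 ord_max - a 0 ord_max * b 0 0.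

(* The directions a, b, c are met in this cyclic order when turning
   counterclockwise.  The counterclockwise angles from a to b, from b to c and
   from c to a, taken in ]0, 2 pi[, add up to 2 pi in this case and to 4 pi
   when the cyclic order is the opposite one.  In the first case at least two
   of them are in ]0, pi[, in the second case at most one is. *)
Definition ccw (a b c : point) : bool :=
  [|| (0 < cross a b) && (0 < cross b c),
      (0 < cross b c) && (0 < cross c a) |
      (0 < cross c a) && (0 < cross a b)].

(* A polygonal embedding of the graph in the plane.  Every half-edge h is drawn
   as the polygonal path that joins the image of its vertex to a point
   [mid (edge_of h)] in the interior of the edge, with intermediate
   breakpoints [bends h]. *)
Section Drawing.
Variables (pos : V -> point) (mid : E -> point) (bends : H -> seq point).

Definition half_path (h : H) : seq point :=
  pos (origin h) :: rcons (bends h) (mid (edge_of h)).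

Definition direction (h : H) : point := (half_path h)`_1 - (half_path h)`_0.

Definition simple_paths : Prop :=
  forall (h : H) (i j : nat) (u v : R),
    poly_param (half_path h) i u -> poly_param (half_path h) j v ->
    poly_at (half_path h) i u = poly_at (half_path h) j v ->
    i%:R + u = j%:R + v.

Definition disjoint_paths : Prop :=
  forall (h k : H) (i j : nat) (u v : R), h != k ->
    poly_param (half_path h) i u -> poly_param (half_path k) j v ->
    poly_at (half_path h) i u = poly_at (half_path k) j v ->
    (origin h = origin k /\ poly_at (half_path h) i u = pos (origin h)) \/
    (edge_of h = edge_of k /\ poly_at (half_path h) i u = mid (edge_of h)).

(* All the cyclic orders are induced by the same orientation of the plane. *)
Definition oriented_paths : Prop :=
  (forall h : H,
     ccw (direction h) (direction (vnext h)) (direction (vnext (vnext h)))) \/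
  (forall h : H,
     ccw (direction (vnext (vnext h))) (direction (vnext h)) (direction h)).

End Drawing.

Definition planar : Prop :=
  exists (pos : V -> point) (mid : E -> point) (bends : H -> seq point),
    [/\ simple_paths pos mid bends,
        disjoint_paths pos mid bends &
        oriented_paths pos mid bends].

End Planarity.

(* A dart is an edge traversed in one of its two directions; it is named by the
   half-edge h through which it starts, so that it ends by crossing [mate h]
   towards the vertex.  As every dart is used at most once in total, a
   collection of closed edge-paths, up to cyclic reparametrizations, is the
   same thing as the map sending every dart in use to the one that follows it,
   and the other darts to [None]: the components are the cycles of this map. *)
Definition is_curve (g : {ffun H -> option H}) : bool :=
  [forall h, if g h is Some k then
     [&& origin k == origin (mate h), k != mate h, g k != None &
         [forall h', (g h' == Some k) ==> (h' == h)]]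
   else true].
Definition curve := {g : {ffun H -> option H} | is_curve g}.

(* To count crossings, gamma is perturbed by letting every passage keep to the
   right (the clockwise side, as seen from the vertex when leaving it): the two
   passages over an edge, which have opposite directions, do not cross along
   the edge.  Around a vertex, the possible ends of passages come in the cyclic
   order given by [next_end], where [(h, true)] stands for the outgoing passage
   over h and [(h, false)] for the incoming one. *)
Definition next_end (p : H * bool) : H * bool :=
  if p.2 then (p.1, false) else (vnext p.1, true).

(* The chords p q and r s of the disc around a vertex cross (once) when exactly
   one of r and s lies on the arc from p to q. *)
Definition chords_cross (p q r s : H * bool) : bool :=
  (findex next_end p r < findex next_end p q)%N
    != (findex next_end p s < findex next_end p q)%N.

Definition turns_cross (g : curve) (h k : H) : bool :=
  if (val g h, val g k) is (Some h', Some k') then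
    (origin (mate h) == origin (mate k)) &&
    chords_cross (mate h, false) (h', true) (mate k, false) (k', true)
  else false.

(* The condition on ranks selects one ordering of each pair of turns. *)
Definition crossings (g : curve) : nat :=
  #|[set p : H * H |
      (enum_rank p.1 < enum_rank p.2)%N && turns_cross g p.1 p.2]|.

(* Number of times that the curve turns through a given angle. *)
Definition turns (g : curve) (a : angle) : nat :=
  #|[set h : H | if val g h is Some k then [set mate h; k] == val a else false]|.

(* The factor of a dart h is the product of t h for the passage over h, away
   from the vertex, and (t (mate h))^-1 for the passage over [mate h]. *)
Definition curve_trace (K : fieldType) (t : H -> K) (g : curve) : K :=
  \prod_(h | val g h != None) (t h * (t (mate h))^-1).

Definition admissible (c : E -> nat) : bool :=
  [forall h : H,
     let i := c (edge_of h) in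
     let j := c (edge_of (vnext h)) in
     let k := c (edge_of (vnext (vnext h))) in
     ~~ odd (i + j + k) && (i <= j + k)%N].

(* (c_i + c_j - c_k) / 2, an exact quotient of a nonnegative number when c is
   admissible; the second sum has the half-edge k as its only index. *)
Definition angle_color (c : E -> nat) (a : angle) : nat :=
  ((\sum_(h in val a) c (edge_of h)
    - \sum_(k | (k \notin val a) && [exists h in val a, origin h == origin k])
        c (edge_of k))./2)%N.

Definition compatible_order (lt : rel H) : Prop :=
  [/\ irreflexive lt, transitive lt,
      forall h k, h != k -> lt h k || lt k h,
      forall h k l, origin h = origin k -> lt h l -> lt l k ->
        origin l = origin h &
      forall h k l, origin h = origin k -> origin k = origin l ->
        lt h k -> lt k l -> vnext h = k /\ vnext k = l].

Definition SL2 (K : fieldType) := {m : 'M[K]_2 | \det m == 1}.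

Definition diagonal (K : fieldType) (x : K) : 'M[K]_2 :=
  \matrix_(i, j) (if i == j then if i == ord0 then x else x^-1 else 0).

Section Evaluation.
Variables (K : fieldType) (lt : rel H) (psi : H -> SL2 K).
Local Notation poly2 := {mpoly K[#|H| + #|H|]}.

Definition z_idx (h : H) : 'I_(#|H| + #|H|) := lshift #|H| (enum_rank h).
Definition w_idx (h : H) : 'I_(#|H| + #|H|) := rshift #|H| (enum_rank h).

(* The two coordinates of psi_h^-1 (z_h, w_h). *)
Definition z_sub (h : H) : poly2 :=
  let m := invmx (val (psi h)) in
  m ord0 ord0 *: 'X_(z_idx h) + m ord0 ord_max *: 'X_(w_idx h).
Definition w_sub (h : H) : poly2 :=
  let m := invmx (val (psi h)) in
  m ord_max ord0 *: 'X_(z_idx h) + m ord_max ord_max *: 'X_(w_idx h).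

(* The polynomial of a vertex, after the substitution, where h1 is the least
   half-edge at this vertex. *)
Definition vertex_poly (c : E -> nat) (h1 : H) : poly2 :=
  let h2 := vnext h1 in
  let h3 := vnext h2 in
  let c1 := c (edge_of h1) in
  let c2 := c (edge_of h2) in
  let c3 := c (edge_of h3) in
  (z_sub h2 * w_sub h1 - z_sub h1 * w_sub h2) ^+ ((c1 + c2 - c3)./2)%N *
  (z_sub h3 * w_sub h2 - z_sub h2 * w_sub h3) ^+ ((c2 + c3 - c1)./2)%N *
  (z_sub h3 * w_sub h1 - z_sub h1 * w_sub h3) ^+ ((c1 + c3 - c2)./2)%N.

Definition vertex_product (c : E -> nat) : poly2 :=
  \prod_(h | lt h (vnext h) && lt (vnext h) (vnext (vnext h))) vertex_poly c h.

(* The operator of an edge, where e1 is the lesser of its two halves. *)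
Definition edge_operator (e1 : H) (p : poly2) : poly2 :=
  let e2 := mate e1 in
  p^`M(w_idx e2)^`M(z_idx e1) - p^`M(w_idx e1)^`M(z_idx e2).

Definition edge_action (c : E -> nat) (e1 : H) (p : poly2) : poly2 :=
  let n := c (edge_of e1) in
  ((n`!)%:R ^+ 2)^-1 *: iter n (edge_operator e1) p.

(* Edges are enumerated by their lesser halves, and unordered pairs of crossing
   edges by pairs (e1, e1') with e1 < e1' < e2 < e2'. *)
Definition crossing_exponent (c : E -> nat) : nat :=
  (\sum_(p : H * H | [&& lt p.1 p.2, lt p.2 (mate p.1)
                       & lt (mate p.1) (mate p.2)])
     c (edge_of p.1) * c (edge_of p.2))%N.

(* For each half-edge h, [vertex_product c] is homogeneous of degree
   c (edge_of h) in the variables z_h, w_h, so that the result of the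
   differentiations is a constant polynomial. *)
Definition evaluation (c : E -> nat) : K :=
  (-1) ^+ crossing_exponent c *
  (foldr (edge_action c) (vertex_product c)
     [seq h <- enum H | lt h (mate h)])@_0%MM.

End Evaluation.

(* The ring K[[X_a, a an angle]]: a series is the family of its coefficients,
   indexed by the exponents of monomials. *)
Definition exponent := {ffun angle -> nat}.
Definition series (K : fieldType) := exponent -> K.

Definition total_degree (m : exponent) : nat := (\sum_a m a)%N.

Definition series_one (K : fieldType) : series K :=
  fun m => (m == [ffun => 0%N])%:R.

(* The exponents n below m are the functions from angles to
   'I_(total_degree m).+1 satisfying the condition. *)
Definition series_mul (K : fieldType) (f g : series K) : series K :=
  fun m =>
    \sum_(n : {ffun angle -> 'I_(total_degree m).+1}
           | [forall a, (n a <= m a)%N])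
      f [ffun a => n a : nat] * g [ffun a => (m a - n a)%N].

Lemma star_neq (h : H) :
  [/\ h != vnext h, h != vnext (vnext h) & vnext h != vnext (vnext h)].
Proof.
split; first by rewrite eq_sym vnext_neq.
  by rewrite -{1}(vnextK3 h) vnext_neq.
by rewrite eq_sym vnext_neq.
Qed.

Lemma star_cases (h k : H) : origin k = origin h ->
  k \in [:: h; vnext h; vnext (vnext h)].
Proof.
move=> ok; have [n1 n2 n3] := star_neq h.
pose s := [set h; vnext h; vnext (vnext h)].
have s3 : #|s| = 3.
  rewrite /s -setUA cardsU1 cards2 !inE negb_or n1 n2 n3 //.
have ss : s = [set x | origin x == origin h].
  apply/eqP; rewrite eqEcard card_star s3 leqnn andbT.
  apply/subsetP=> x; rewrite !inE -orbA.
  by case/or3P=> /eqP->; rewrite ?origin_vnext.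
have : k \in s by rewrite ss inE ok.
by rewrite !inE -orbA.
Qed.

Lemma pair_angle (h k : H) : h != k -> origin h = origin k ->
  is_angle [set h; k].
Proof.
move=> hk ohk; rewrite /is_angle cards2 hk /=.
apply/forall_inP=> x; rewrite !inE => /orP[]/eqP->;
  apply/forall_inP=> y; rewrite !inE => /orP[]/eqP->; by rewrite ?ohk.
Qed.

Lemma angle_colorE (c : E -> nat) (a : angle) (h k l : H) :
    val a = [set h; k] -> uniq [:: h; k; l] -> origin k = origin h ->
    origin l = origin h ->
  angle_color c a = ((c (edge_of h) + c (edge_of k) - c (edge_of l))./2)%N.
Proof.
move=> aE; rewrite /= !inE negb_or andbT -andbA => /and3P[hk hl kl] ok ol.
rewrite /angle_color aE big_setU1 ?inE //= big_set1; congr ((_ - _)./2)%N.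
rewrite (eq_bigl (pred1 l)) ?big_pred1_eq // => x /=.
rewrite !inE negb_or; apply/idP/eqP=> [/andP[/andP[xh xk] /exists_inP[y]]|->].
  have sE : [set z | origin z == origin h] = l |: [set h; k].
    apply/esym/eqP; rewrite eqEcard card_star cardsU1 cards2 hk !inE.
    rewrite negb_or eq_sym hl eq_sym kl /= andbT; apply/subsetP=> z.
    by rewrite !inE => /or3P[]/eqP->; rewrite ?ok ?ol.
  rewrite !inE => yhk /eqP yx.
  have : x \in [set z | origin z == origin h].
    by rewrite inE -yx; case/orP: yhk => /eqP->; rewrite ?ok.
  by rewrite sE !inE (negbTE xh) (negbTE xk) !orbF => /eqP.
rewrite eq_sym hl eq_sym kl /=; apply/exists_inP; exists h; first by rewrite !inE eqxx.
by rewrite ol.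
Qed.

Lemma color_le_degree (c : E -> nat) (e : E) :
  admissible c -> (c e <= total_degree [ffun a => angle_color c a])%N.
Proof.
move=> /forallP cP.
have [h <-] : exists h : H, edge_of h = e.
  have /card_gt0P[h] : (0 < #|[set h : H | edge_of h == e]|)%N.
    by rewrite card_ends.
  by rewrite inE => /eqP; exists h.
have [n1 n2 n3] := star_neq h.
have a1P : is_angle [set h; vnext h] by rewrite pair_angle ?origin_vnext.
have a2P : is_angle [set h; vnext (vnext h)].
  by rewrite pair_angle ?origin_vnext.
pose a1 : angle := Sub _ a1P; pose a2 : angle := Sub _ a2P.
have a12 : a2 != a1.
  apply/eqP=> /(congr1 val) /= /setP /(_ (vnext h)).
  by rewrite !inE eqxx orbT (negbTE n3) eq_sym (negbTE n1).
rewrite /total_degree (bigD1 a1) //= (bigD1 a2) //= !ffunE.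
rewrite (@angle_colorE c a1 h (vnext h) (vnext (vnext h))) ?origin_vnext //=;
  last by rewrite !inE negb_or n1 n2 n3.
rewrite (@angle_colorE c a2 h (vnext (vnext h)) (vnext h)) ?origin_vnext //=;
  last by rewrite !inE negb_or n1 n2 eq_sym n3.
rewrite addnA; apply: leq_trans (leq_addr _ _).
have := cP h; have := cP (vnext h); have := cP (vnext (vnext h)).
rewrite /= vnextK3.
set x := c _; set y := c (edge_of (vnext h)); set z := c _ => {cP}.
move=> /andP[_ zxy] /andP[_ yzx] /andP[o xyz].
lia.
Qed.

Definition Z_term (K : fieldType) (lt : rel H) (psi : H -> SL2 K)
    (c : E -> nat) : K :=
  evaluation lt psi c *
  ((\prod_e (c e)`!)%:R / (\prod_a (angle_color c a)`!)%:R).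

(* The coefficient of X^m collects the admissible colorings c with X^c = X^m.
   Restricting the sum to colors at most the degree of m excludes none of
   them, by [color_le_degree] below. *)
Definition Z_series (K : fieldType) (lt : rel H) (psi : H -> SL2 K) : series K :=
  fun m =>
    \sum_(c : {ffun E -> 'I_(total_degree m).+1}
           | admissible (fun e => c e)
             && ([ffun a => angle_color (fun e => c e) a] == m))
      Z_term lt psi (fun e => c e).

Definition curve_series (K : fieldType) (t : H -> K) : series K :=
  fun m =>
    \sum_(g : curve | [ffun a => turns g a] == m)
      (-1) ^+ crossings g * curve_trace t g.

End Graph.

(* Main.v *)
From HB Require Import structures.
Require Import Defs.
From mathcomp Require Import all_boot all_order all_fingroup all_algebra.
From mathcomp Require Import reals complex.
From mathcomp Require boolp.
From mathcomp Require Import mpoly zify ring lra.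

Set Implicit Arguments.
Unset Strict Implicit.
Unset Printing Implicit Defensive.

Import Order.TTheory GRing.Theory Num.Theory.
Local Open Scope ring_scope.

(** The series of the graph and the series of its curves are the two sides of
    MacMahon's master theorem, for a matrix indexed by the darts (the edges
    with a direction) whose entry (h, k) describes the turn from h to k.

    As the holonomy is diagonal, the form of an angle is a sum of two
    monomials.  An edge operator pairs, at the two halves of its edge, letters
    z with letters w, hence it chooses a direction for every strand of the
    edge.  The evaluation of a coloring thus becomes a sum over the
    multiplicities a of the darts ([Z_seriesE]), and its term is, up to signs,
    a coefficient of the state polynomial, which counts the ways to join the
    strands at the vertices.  By [state_coeff] this coefficient is also the
    coefficient of z^a in the product over the darts h of the powers
    L_h^(a_h), where the linear form L_h = sum_k A_hk z_k runs over the turns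
    that follow h, and the monomials X in the entries A_hk record the angles.
    The master theorem says that the sum of these coefficients over all a is
    the inverse of det(1 - A).  The expansion of this determinant is indexed by
    the permutations of sets of darts that follow turns, and these are exactly
    the curves ([sum_curves]).

    The signs do not fit into this scheme at once: the sign of a multiplicity a
    is given by a crossing exponent, which is quadratic in a.  Therefore the
    master theorem is used as a recursion ([macmahon], [state_weight_sum]): for
    every b other than 0, the sum over the curves g contained in b of the weight
    of g times the term of b - g vanishes.  This remains true with the quadratic
    signs if the crossing exponent is additive for the decomposition of b into g
    and b - g ([odd_crossing_exponentD]).  The two parts are cycles modulo 2,
    and the defect of additivity is the number of crossings of these cycles near
    the vertices plus the number of their common edges.  In the plane it is even
    ([planar_parity]): displace the drawing by a small generic vector; a cycle
    crosses the displaced copy of another cycle an even number of times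
    ([sum_meets]), and the crossings created by the displacement can be computed
    at each vertex from the cyclic order alone ([star_parity]).

    It remains to compare the sign of a curve in the determinant, which is the
    signature of a permutation, with its number of crossings.  Draw the
    half-edges on a line, the darts of the curve as chords on one side and the
    turns on the other side.  Counting the crossings of this diagram with the
    inversions of the permutation ([rotation_parity]) gives the relation between
    the signature, the crossings of the curve and the crossing exponent of its
    edges ([curve_sign_parity]). *)

(** * Parity of a permutation as a count of inversions *)

Section PairSums.
Variable T : finType.
Implicit Types (r : rel T) (s : {perm T}).

(** The role of a tournament is to select one ordering of each pair of
    distinct points; the sum of a symmetric function over these pairs does not
    depend on it, by [pair_sum_order]. *)
Definition tournament r :=
  irreflexive r /\ forall x y, x != y -> r y x = ~~ r x y.

Lemma pair_sum_order (W : nmodType) r r' (f : T -> T -> W) :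
    tournament r -> tournament r' -> (forall x y, f x y = f y x) ->
  \sum_(p | r p.1 p.2) f p.1 p.2 = \sum_(p | r' p.1 p.2) f p.1 p.2.
Proof.
move=> [r_irr rV] [r'_irr r'V] fC.
rewrite (bigID (fun p : T * T => r' p.1 p.2)) [RHS](bigID (fun p => r p.1 p.2)).
congr (_ + _); first by apply: eq_bigl => p; rewrite andbC.
have swapK : involutive (fun p : T * T => (p.2, p.1)) by case.
rewrite (reindex_inj (inv_inj swapK)); apply: eq_big => -[x y] //=.
by case: (altP (x =P y)) => [->|xy]; rewrite ?r_irr ?r'_irr // rV // r'V // negbK andbC.
Qed.

Lemma pair_sum_perm (W : nmodType) r (f : T -> T -> W) s :
    tournament r -> (forall x y, f x y = f y x) ->
  \sum_(p | r p.1 p.2) f (s p.1) (s p.2) = \sum_(p | r p.1 p.2) f p.1 p.2.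
Proof.
move=> r_tour fC; pose r' := [rel x y | r (s^-1%g x) (s^-1%g y)].
have r'_tour : tournament r'.
  case: r_tour => r_irr rV; split=> [x|x y xy] /=; first exact: r_irr.
  by rewrite rV // (inj_eq perm_inj).
rewrite (pair_sum_order r_tour r'_tour fC).
have sK : bijective (fun p : T * T => (s p.1, s p.2)).
  by exists (fun p => (s^-1%g p.1, s^-1%g p.2)) => -[x y] /=; rewrite ?permK ?permKV.
rewrite [RHS](reindex _ (onW_bij _ sK)) /=; apply: eq_bigl => p.
by rewrite /= !permK.
Qed.

(** Sums of booleans are taken in the field with two elements, so that they
    are parities of counts. The summand tells whether s reverses the pair
    p. *)
Definition inversion_parity r s : bool :=
  \sum_(p | r p.1 p.2) (r p.1 p.2 + r (s p.1) (s p.2)).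

Lemma reversal_sym r s x y : tournament r ->
  (r x y + r (s x) (s y) : bool) = r y x + r (s y) (s x).
Proof.
move=> [r_irr rV]; have [->//|xy] := altP (x =P y).
by rewrite (rV x y) // (rV (s x) (s y)) ?(inj_eq perm_inj) //; case: (r x y); case: (r (s x) _).
Qed.

Lemma inversion_parityM r s s' : tournament r ->
  inversion_parity r (s * s')%g = inversion_parity r s + inversion_parity r s'.
Proof.
move=> rt; rewrite /inversion_parity.
pose f x y : bool := r x y + r (s' x) (s' y).
have fC x y : f x y = f y x by exact: reversal_sym.
rewrite -[X in _ = _ + X]/(\sum_(p | r p.1 p.2) f p.1 p.2) -(pair_sum_perm s rt fC).
rewrite -big_split; apply: eq_bigr => p _ /=; rewrite /f !permM.
by case: (r p.1 _); case: (r (s p.1) _); case: (r (s' _) _).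
Qed.

(** Whether s reverses a pair depends on the order, but the difference between
    two orders has the form f p + f (s p), where f tells whether they disagree
    on a pair. The sum of these over all pairs vanishes because s permutes the
    pairs. *)
Lemma inversion_parity_order r r' s : tournament r -> tournament r' ->
  inversion_parity r s = inversion_parity r' s.
Proof.
move=> rt r't; rewrite /inversion_parity.
rewrite (pair_sum_order (f := fun x y => r x y + r (s x) (s y) : bool) rt r't);
  last by move=> x y; exact: reversal_sym.
apply/eqP; rewrite -subr_eq0 -sumrB; apply/eqP.
pose f x y : bool := r x y + r' x y.
have fC x y : f x y = f y x.
  have [->//|xy] := altP (x =P y); rewrite /f (rt.2 x y) // (r't.2 x y) //.
  by case: (r x y); case: (r' x y).
transitivity (\sum_(p | r' p.1 p.2) (f p.1 p.2 + f (s p.1) (s p.2))).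
  by apply: eq_bigr => p _; rewrite /f; case: (r p.1 _); case: (r (s _) _); case: (r' p.1 _);
    case: (r' (s _) _).
by rewrite big_split (pair_sum_perm s r't fC) /=; case: (\sum_(_ | _) _).
Qed.

(** In an order where x and y come first and next to each other, the
    transposition reverses only the pair (x, y). *)
Lemma inversion_parity_tperm r x y : tournament r -> x != y ->
  inversion_parity r (tperm x y) = 1.
Proof.
move=> rt xy.
pose w z : nat := if z == x then 0 else if z == y then 1 else (enum_rank z).+2.
have w_inj : injective w.
  move=> a b; rewrite /w; do !case: eqP => [->|] //.
  by move=> _ _ _ _ [/ord_inj/enum_rank_inj].
pose r' := [rel a b | (w a < w b)%N].
have r't : tournament r'.
  split=> [a|a b ab] /=; first exact: ltnn.
  by rewrite -leqNgt ltn_neqAle (inj_eq w_inj) eq_sym ab.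
rewrite (inversion_parity_order _ rt r't) /inversion_parity.
rewrite (bigD1 (x, y)) /=; last by rewrite /w !eqxx eq_sym (negbTE xy).
rewrite big1 ?addr0 => [|[a b] /= /andP[ab nab]].
  by rewrite tpermL tpermR /w !eqxx eq_sym (negbTE xy).
move: ab nab; rewrite /= xpair_eqE => ab nab; rewrite ab.
suff -> : (w (tperm x y a) < w (tperm x y b))%N by [].
move: ab nab; rewrite /w.
have yx : (y == x) = false by rewrite eq_sym (negbTE xy).
by case: tpermP => [->|->|/eqP/negbTE ax /eqP/negbTE ay];
  case: tpermP => [->|->|/eqP/negbTE bx /eqP/negbTE by'];
  rewrite ?eqxx ?yx ?ax ?ay ?bx ?by' ?eqxx ?(negbTE xy).
Qed.

(** The parity of inversions is a morphism with value 1 at the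
    transpositions. *)
Lemma odd_perm_inversions r s : tournament r ->
  inversion_parity r s = odd_perm s.
Proof.
move=> rt; have [ts -> dts] := prod_tpermP s.
elim: ts dts => [_|[x y] ts IHts /= /andP[xy dts]].
  rewrite big_nil odd_perm1 /inversion_parity big1 // => p _.
  by rewrite !perm1; case: (r p.1 _).
rewrite big_cons inversion_parityM // inversion_parity_tperm // IHts //.
by rewrite odd_permM odd_tperm xy.
Qed.

(** For y outside S, the pairs formed by y and the points x of S contribute
    the sum of r x y + r (s x) y, which vanishes because s permutes S; and s
    reverses no pair outside S. *)
Lemma odd_perm_inversions_on r s (S : {set T}) : tournament r -> perm_on S s ->
  (odd_perm s : bool) =
  \sum_(p | r p.1 p.2 && ((p.1 \in S) && (p.2 \in S)))
     (r p.1 p.2 + r (s p.1) (s p.2)).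
Proof.
move=> rt sS; rewrite -(odd_perm_inversions _ rt) /inversion_parity.
pose g x y : bool := r x y + r (s x) (s y).
rewrite (bigID (fun p : T * T => (p.1 \in S) && (p.2 \in S))) /=.
suff -> : \sum_(p | r p.1 p.2 && ~~ ((p.1 \in S) && (p.2 \in S))) g p.1 p.2 = 0.
  by rewrite addr0.
pose h x y := (~~ ((x \in S) && (y \in S)))%:R * g x y.
have hC x y : h x y = h y x by rewrite /h /g andbC reversal_sym.
pose r' := [rel x y | if (x \in S) == (y \in S) then r x y else x \in S].
have r't : tournament r'.
  split=> [x|x y xy] /=; first by rewrite eqxx rt.1.
  have := rt.2 x y xy; rewrite eq_sym.
  by case: (x \in S); case: (y \in S).
transitivity (\sum_(p | r p.1 p.2) h p.1 p.2).
  rewrite big_mkcondr; apply: eq_bigr => p _; rewrite /h.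
  by case: (~~ _); rewrite ?mul1r ?mul0r.
rewrite (pair_sum_order rt r't hC).
transitivity (\sum_(y | y \notin S) \sum_(x in S) g x y).
  rewrite pair_big_dep /= big_mkcond [RHS]big_mkcond /=.
  rewrite (reindex_inj (inv_inj (_ : involutive (fun p : T * T => (p.2, p.1))))) /=;
    last by case.
  apply: eq_bigr => -[y x] _ /=; rewrite /h.
  case: (boolP (x \in S)) => xS; case: (boolP (y \in S)) => yS;
    rewrite /= ?mul1r ?mul0r ?if_same //.
  by rewrite /g !(out_perm sS) //; case: (r x y).
apply: big1 => y yS; rewrite /g big_split /= (out_perm sS yS).
rewrite [X in _ + X](_ : _ = \sum_(x in S) r x y); first by case: (\sum_(_ in _) _).
rewrite [RHS](reindex_inj (@perm_inj _ s)) /=; apply: eq_bigl => x.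
by rewrite (perm_closed _ sS).
Qed.
End PairSums.

(** * Stars and edges *)

Section GraphBasics.
Variable G : trivalent_graph.
Local Notation H := (half_edge G).
Local Notation E := (edge G).
Implicit Types (h k : H) (e : E).

Lemma mate_spec h : (edge_of (mate h) == edge_of h) && (mate h != h).
Proof.
rewrite /mate; case: pickP => [k //|no_mate].
have h_in : h \in [set k | edge_of k == edge_of h] by rewrite inE.
have : (0 < #|[set k | edge_of k == edge_of h] :\ h|)%N.
  by have := card_ends (edge_of h); rewrite (cardsD1 h) h_in add1n => -[->].
by case/card_gt0P=> k; rewrite !inE andbC no_mate.
Qed.

Lemma edge_mate h : edge_of (mate h) = edge_of h.
Proof. by case/andP: (mate_spec h) => /eqP. Qed.

Lemma mate_neq h : mate h != h.
Proof. by case/andP: (mate_spec h). Qed.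

Lemma ends_cases h k : edge_of k = edge_of h -> (k == h) || (k == mate h).
Proof.
move=> kh; have : [set h; mate h] == [set k | edge_of k == edge_of h].
  rewrite eqEcard card_ends cards2 eq_sym mate_neq leqnn andbT.
  by apply/subsetP=> x; rewrite !inE => /orP[]/eqP->; rewrite ?edge_mate.
by move/eqP/setP/(_ k); rewrite !inE kh eqxx.
Qed.

Lemma mateK : involutive (@mate G).
Proof.
move=> h; have := @ends_cases (mate h) h; rewrite edge_mate => /(_ erefl).
by rewrite eq_sym (negbTE (mate_neq h)) => /eqP.
Qed.

Lemma mate_inj : injective (@mate G).
Proof. exact: inv_inj mateK. Qed.

Lemma sum_ends (W : nmodType) h (g : H -> W) :
  \sum_(k | edge_of k == edge_of h) g k = g h + g (mate h).
Proof.
rewrite (bigD1 h) //= (bigD1 (mate h)) /=; last by rewrite edge_mate eqxx mate_neq.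
rewrite big1 ?addr0 // => k /andP[/andP[/eqP/ends_cases]].
by case: eqP => //= _; case: eqP.
Qed.

Lemma sum_star (W : nmodType) h (g : H -> W) :
  \sum_(k | origin k == origin h) g k = g h + g (vnext h) + g (vnext (vnext h)).
Proof.
have [n1 n2 n3] := star_neq h.
rewrite (bigD1 h) //= (bigD1 (vnext h)) /=; last first.
  by rewrite origin_vnext eqxx eq_sym n1.
rewrite (bigD1 (vnext (vnext h))) /=; last first.
  by rewrite !origin_vnext eqxx eq_sym n2 eq_sym n3.
rewrite big1 ?addr0 ?addrA // => k /andP[/andP[/andP[/eqP/star_cases]]].
by rewrite !inE => /or3P[]/eqP->; rewrite !eqxx.
Qed.

Lemma vnext_inj : injective (@vnext G).
Proof. by apply: (can_inj (g := fun h => vnext (vnext h))) => h; rewrite vnextK3. Qed.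

Section Order.
Variables (lt : rel H) (lt_compatible : compatible_order lt).

Lemma lt_irr : irreflexive lt. Proof. by case: lt_compatible. Qed.
Lemma lt_trans' : transitive lt. Proof. by case: lt_compatible. Qed.

Lemma lt_tournament : tournament lt.
Proof.
case: lt_compatible => irr tr tot _ _; split=> // h k hk.
apply/idP/idP=> [kh|/negbTE hkF].
  by apply/negP=> /(tr _ _ _ kh); rewrite irr.
by have := tot h k hk; rewrite hkF.
Qed.

Lemma ltV h k : h != k -> lt k h = ~~ lt h k.
Proof. exact: lt_tournament.2. Qed.

Definition vmin h := lt h (vnext h) && lt (vnext h) (vnext (vnext h)).

(** The linear order induces the cyclic order at the vertex, so that exactly
    one of the three steps from a half-edge to the next one goes down. *)
Lemma star_order h :
  let x := lt h (vnext h) in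
  let y := lt (vnext h) (vnext (vnext h)) in
  let z := lt (vnext (vnext h)) h in
  [|| [&& x, y & ~~ z], [&& ~~ x, y & z] | [&& x, ~~ y & z]].
Proof.
have [n1 n2 n3] := star_neq h; have n2' := n2; rewrite eq_sym in n2'.
case: lt_compatible => irr tr _ _ cyc /=.
have cyc' a b c : origin a = origin b -> origin b = origin c ->
    lt a b -> lt b c -> vnext a != b -> False.
  by move=> ab bc lab lbc /eqP[]; case: (cyc a b c).
have := cyc' (vnext (vnext h)) (vnext h) h.
have := cyc' (vnext h) h (vnext (vnext h)).
have := cyc' h (vnext (vnext h)) (vnext h).
rewrite !vnextK3 !origin_vnext.
rewrite (ltV n1) (ltV n3) (ltV n2') n1 n2' n3.
have t1 := @tr (vnext h) h (vnext (vnext h)).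
have t2 := @tr (vnext h) (vnext (vnext h)) h.
rewrite (ltV n2') in t1; rewrite (ltV n1) (ltV n3) in t2.
move: t1 t2.
case: (lt h _); case: (lt (vnext h) _); case: (lt (vnext (vnext h)) h) => //= t1 t2 A B C;
  by [case: (notF (t1 isT isT)) | case: (notF (t2 isT isT)) | case: (A erefl erefl isT isT isT)
     | case: (B erefl erefl isT isT isT) | case: (C erefl erefl isT isT isT)].
Qed.

Lemma big_vertices (W : Type) (idx : W) (op : Monoid.com_law idx) (g : H -> W) :
  \big[op/idx]_h g h =
  \big[op/idx]_(h | vmin h) op (op (g h) (g (vnext h))) (g (vnext (vnext h))).
Proof.
rewrite !big_split /= [X in _ = op (op _ X) _](reindex_inj (inj_comp vnext_inj vnext_inj)) /=.
rewrite [X in _ = op _ X](reindex_inj vnext_inj) /=.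
under [X in _ = op (op _ X) _]eq_bigr do rewrite vnextK3.
under [X in _ = op _ X]eq_bigr do rewrite vnextK3.
rewrite (big_mkcond (fun h => vmin h)) (big_mkcond (fun h => vmin (vnext h))).
rewrite (big_mkcond (fun h => vmin (vnext (vnext h)))) -!big_split.
apply: eq_bigr => h _ /=; have := star_order h; rewrite /vmin !vnextK3 /=.
by case: (lt h _); case: (lt (vnext h) _); case: (lt (vnext (vnext h)) h);
  rewrite //= ?Monoid.mulm1 ?Monoid.mul1m.
Qed.

Lemma sum_vertices (W : nmodType) (g : H -> W) :
  \sum_h g h = \sum_(h | vmin h) (g h + g (vnext h) + g (vnext (vnext h))).
Proof. exact: big_vertices. Qed.

Lemma big_edges (W : Type) (idx : W) (op : Monoid.com_law idx) (g : H -> W) :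
  \big[op/idx]_h g h = \big[op/idx]_(h | lt h (mate h)) op (g h) (g (mate h)).
Proof.
rewrite big_split /= [X in _ = op _ X](reindex_inj mate_inj) /=.
under [X in _ = op _ X]eq_bigr do rewrite mateK.
rewrite (big_mkcond (fun h => lt h (mate h))) (big_mkcond (fun h => lt (mate h) _)).
rewrite -big_split; apply: eq_bigr => h _ /=.
by rewrite mateK (ltV (mate_neq h)); case: (lt _ h); rewrite ?Monoid.mulm1 ?Monoid.mul1m.
Qed.

Lemma sum_edges (W : nmodType) (g : H -> W) :
  \sum_h g h = \sum_(h | lt h (mate h)) (g h + g (mate h)).
Proof. exact: big_edges. Qed.

Lemma big_edge_halves (W : Type) (idx : W) (op : Monoid.com_law idx) (f : E -> W) :
  \big[op/idx]_(h | lt h (mate h)) f (edge_of h) = \big[op/idx]_e f e.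
Proof.
rewrite (partition_big (@edge_of G) predT) //=; apply: eq_bigr => e _.
have [h he] : exists h, edge_of h = e.
  have /card_gt0P[h] : (0 < #|[set h | edge_of h == e]|)%N by rewrite card_ends.
  by rewrite inE => /eqP; exists h.
wlog hm : h he / lt h (mate h) => [wlog_h|].
  have [|nhm] := boolP (lt h (mate h)); first exact: wlog_h.
  by apply: (wlog_h (mate h)); rewrite ?edge_mate // mateK (ltV (mate_neq h)) // in nhm *;
     rewrite negbK in nhm.
rewrite (big_pred1 h) ?he // => k /=; apply/andP/eqP => [[km /eqP ke]|->]; last by rewrite he eqxx.
have := @ends_cases h k; rewrite ke he => /(_ erefl) /orP[/eqP//|/eqP kE].
by move: km hm; rewrite kE mateK (ltV (mate_neq h)) => ->.
Qed.

End Order.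
End GraphBasics.

(** * Intersections of segments modulo 2 *)

Section Parity.
Variable R : realFieldType.
(** The segments pq and rs cross when r, s lie on different sides of pq and p,
    q on different sides of rs. The parity of this event is a sum of four
    terms, one for each end point, which tell whether this end point lies
    above the other segment. In the variables of the lemma op, oq, or, os are
    the orientations of the end points with respect to the other segment, and
    a, b, c, d are the differences of abscissas p - r, p - s, q - r, q - s.
    The equations are the relations between these quantities, and every
    combination of signs that they allow satisfies the identity. *)
Lemma sign_parity (op oq or os a b c d : R) :
    op + or = oq + os -> a - b = c - d ->
    op * (c - a) - or * b + os * a = 0 ->
    [&& op != 0, oq != 0, or != 0 & os != 0] ->
    [&& a != 0, b != 0, c != 0 & d != 0] ->
  ((0 < or) + (0 < os)) * ((0 < op) + (0 < oq)) =
  ((0 < a) + (0 < b)) * ((0 < op) + (0 < b)) +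
  ((0 < c) + (0 < d)) * ((0 < oq) + (0 < d)) +
  ((a < 0) + (c < 0)) * ((0 < or) + (c < 0)) +
  ((b < 0) + (d < 0)) * ((0 < os) + (d < 0)) +
  ((0 < a) + (0 < b) + (0 < c) + (0 < d)) :> bool.
Proof.
move=> e1 e2 e3.
(* The dependence stated by the last equation is taken at p; these are the ones
   at r and at s. *)
have Er : op * c - oq * a + or * (a - b) = 0.
  by have -> : oq = op + or - os by [rewrite e1 addrK]; rewrite -[RHS]e3; ring.
have Es : op * d - oq * b + os * (a - b) = 0.
  have -> : oq = op + or - os by rewrite e1 addrK.
  by have -> : d = c - a + b by [lra]; rewrite -[RHS]e3; ring.
move=> /and4P[p0 q0 r0 s0] /and4P[a0 b0 c0 d0].
case: (ltrgtP 0 op) p0 => [hp|hp|//] _.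
all: case: (ltrgtP 0 oq) q0 => [hq|hq|//] _.
all: case: (ltrgtP 0 or) r0 => [hr|hr|//] _.
all: case: (ltrgtP 0 os) s0 => [hs|hs|//] _.
all: case: (ltrgtP 0 a) a0 => [ha|ha|//] _.
all: case: (ltrgtP 0 b) b0 => [hb|hb|//] _.
all: case: (ltrgtP 0 c) c0 => [hc|hc|//] _.
all: case: (ltrgtP 0 d) d0 => [hd|hd|//] _.
all: try by [].
all: exfalso; try nra.
all: clear e1 e2 e3; case: (lerP a b) => ab; nra.
Qed.
End Parity.

Section PlaneGeometry.
Variable R : realFieldType.
Local Notation point := 'rV[R]_2.
Implicit Types (p q r s a b d f eps : point) (A B x y : R).

Definition cross2 a b := a 0 0 * b 0 ord_max - a 0 ord_max * b 0 0.
Definition orient p q r := cross2 (q - p) (r - p).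

(** Whether p lies in the vertical strip of rs and above rs. The last summand
    corrects the orientation when rs is directed to the left. *)
Definition above p r s : bool :=
  ((r 0 0 < p 0 0) + (s 0 0 < p 0 0)) * ((0 < orient r s p) + (s 0 0 < p 0 0)).

(** The sum over the pairs of segments of two closed polygons telescopes,
    since each summand on the right depends on one end point of one of the two
    segments. *)
Lemma segment_parity p q r s :
    [&& orient r s p != 0, orient r s q != 0, orient p q r != 0
      & orient p q s != 0] ->
    [&& p 0 0 != r 0 0, p 0 0 != s 0 0, q 0 0 != r 0 0 & q 0 0 != s 0 0] ->
  ((0 < orient p q r) + (0 < orient p q s)) *
  ((0 < orient r s p) + (0 < orient r s q)) =
  (above p r s + (r 0 0 < p 0 0) + (s 0 0 < p 0 0)) +
  (above q r s + (r 0 0 < q 0 0) + (s 0 0 < q 0 0)) +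
  (above r p q + above s p q) :> bool.
Proof.
move=> o0 x0.
have e1 : orient r s p + orient p q r = orient r s q + orient p q s.
  by rewrite /orient /cross2 !mxE; ring.
have e2 : orient r s p * (q 0 0 - r 0 0 - (p 0 0 - r 0 0)) -
    orient p q r * (p 0 0 - s 0 0) + orient p q s * (p 0 0 - r 0 0) = 0.
  by rewrite /orient /cross2 !mxE; ring.
rewrite /above; move: (orient _ _ _) (orient _ _ _) (orient _ _ _) (orient _ _ _) o0 e1 e2.
move=> or os op oq o0 e1 e2.
have e3 : p 0 0 - r 0 0 - (p 0 0 - s 0 0) = q 0 0 - r 0 0 - (q 0 0 - s 0 0) by ring.
have := sign_parity e1 e3 e2 o0; rewrite !subr_eq0 !subr_gt0 !subr_lt0 => -> //; ring.
Qed.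

(** Whether A + del * B > 0 for all small del > 0. *)
Definition lexpos A B := (0 < A) || (A == 0) && (0 < B).

Lemma small_shift (l : seq (R * R)) : all (fun u => u.2 != 0) l ->
  exists2 del : R, 0 < del & forall u, u \in l ->
    (u.1 + del * u.2 != 0) /\ (0 < u.1 + del * u.2) = lexpos u.1 u.2.
Proof.
suff: all (fun u => u.2 != 0) l -> exists2 d0 : R, 0 < d0 &
    forall del : R, 0 < del <= d0 -> forall u, u \in l ->
    (u.1 + del * u.2 != 0) /\ (0 < u.1 + del * u.2) = lexpos u.1 u.2.
  move=> H /H[d d0 dP]; exists d => // u; apply: dP; by rewrite d0 lexx.
elim: l => [_|[A B] l IHl /= /andP[B0 /IHl[d1 d1_gt0 d1P]]].
  by exists 1; rewrite ?ltr01.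
suff [d2 d2_gt0 d2P] : exists2 d0 : R, 0 < d0 & forall del : R, 0 < del <= d0 ->
    (A + del * B != 0) /\ (0 < A + del * B) = lexpos A B.
  exists (Num.min d1 d2) => [|del]; first by rewrite lt_min d1_gt0.
  rewrite le_min => /and3P[del0 del1 del2] u; rewrite inE => /orP[/eqP->|ul].
    by apply: d2P; rewrite del0.
  by apply: d1P; rewrite ?del0.
rewrite /lexpos; have [->|A0] := eqVneq A 0.
  exists 1 => [|del /andP[del0 _]]; first exact: ltr01.
  rewrite add0r ltxx /=; split; last exact: pmulr_rgt0.
  by rewrite mulf_eq0 negb_or gt_eqF.
exists (`|A| / (2 * `|B|)) => [|del /andP[del0 delA]].
  by rewrite divr_gt0 ?mulr_gt0 ?normr_gt0.
have {delA} delA : `|del * B| * 2 <= `|A|.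
  rewrite normrM (gtr0_norm del0) -mulrA [`|B| * 2]mulrC -ler_pdivlMr //.
  by rewrite mulr_gt0 ?normr_gt0.
move: (del * B) delA => C CA; rewrite /= orbF.
move: A0; rewrite neq_lt => /orP[A0|A0].
- have : A + C < 0 by rewrite (ltr0_norm A0) in CA; have := ler_norm C; lra.
  by move=> h; rewrite lt_eqF // ltNge (ltW h) ltNge (ltW A0).
- have : 0 < A + C by rewrite (gtr0_norm A0) in CA; have := ler_norm (- C); rewrite normrN; lra.
  by move=> h; rewrite gt_eqF // h A0.
Qed.

Lemma ord2_cases (j : 'I_2) : j = 0 \/ j = ord_max.
Proof. by case: j => [[|[|//]] ?]; [left|right]; apply: val_inj. Qed.

(** A direction that is not vertical and steeper than all the others is
    parallel to none of them. *)
Lemma generic_direction (l : seq point) : all (fun d => d != 0) l ->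
  exists2 eps : point, eps 0 0 = 1 & forall d, d \in l -> cross2 d eps != 0.
Proof.
move=> l0.
have [y yP] : exists y, forall d, d \in l -> `|d 0 ord_max / d 0 0| < y.
  elim: l {l0} => [|d l [y yP]]; first by exists 0.
  exists (Num.max (`|d 0 ord_max / d 0 0| + 1) y) => d'.
  rewrite inE lt_max => /orP[/eqP->|/yP->]; last by rewrite orbT.
  by rewrite ltrDl ltr01.
exists (\row_(j < 2) (if j == 0 then 1 else y)) => [|d dl]; first by rewrite mxE.
rewrite /cross2 !mxE /= mulr1; have := allP l0 d dl; have [d0 dn0|d0 _] := eqVneq (d 0 0) 0.
  rewrite d0 mul0r sub0r oppr_eq0; apply: contraNneq dn0 => d1.
  apply/eqP/rowP=> j; rewrite mxE.
  by case: (ord2_cases j) => ->.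
apply: contraTneq (yP d dl) => /eqP; rewrite subr_eq0 => /eqP <-.
by rewrite mulrC mulKf // -leNgt ler_norm.
Qed.

(** Whether pq crosses the copy of rs displaced by del * eps, for all small
    del > 0: the sides of the end points are read off the expansions of the
    orientations to first order in del. *)
Definition meets_shifted p q r s eps : bool :=
  (lexpos (orient p q r) (cross2 (q - p) eps) +
   lexpos (orient p q s) (cross2 (q - p) eps)) *
  (lexpos (orient r s p) (- cross2 (s - r) eps) +
   lexpos (orient r s q) (- cross2 (s - r) eps)).

(** Whether eps points to the left of d. *)
Definition leftward eps d : bool := 0 < cross2 d eps.

Lemma lexpos0 B : lexpos 0 B = (0 < B).
Proof. by rewrite /lexpos ltxx eqxx. Qed.

Lemma meets_shifted_self p q eps : meets_shifted p q p q eps = 0.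
Proof.
have opp : orient p q p = 0 by rewrite /orient /cross2 !mxE; ring.
have oqq : orient p q q = 0 by rewrite /orient /cross2 !mxE; ring.
by rewrite /meets_shifted opp oqq; case: (lexpos _ _).
Qed.

(** Rays d and f from a common point. If f is on the left of d, the displaced
    copy of f crosses d when the displacement points to the right of both. *)
Lemma meets_shifted_start p d f eps :
    cross2 d eps != 0 -> cross2 f eps != 0 ->
  meets_shifted p (p + d) p (p + f) eps =
  if cross2 d f == 0 then false
  else if 0 < cross2 d f then ~~ leftward eps d && ~~ leftward eps f
  else leftward eps d && leftward eps f.
Proof.
move=> d0 f0; rewrite /meets_shifted.
have -> : orient p (p + d) p = 0 by rewrite /orient /cross2 !mxE; ring.
have -> : orient p (p + f) p = 0 by rewrite /orient /cross2 !mxE; ring.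
have -> : orient p (p + d) (p + f) = cross2 d f by rewrite /orient /cross2 !mxE; ring.
have -> : orient p (p + f) (p + d) = - cross2 d f by rewrite /orient /cross2 !mxE; ring.
have -> : p + d - p = d by rewrite addrC addKr.
have -> : p + f - p = f by rewrite addrC addKr.
rewrite !lexpos0 /lexpos /leftward !oppr_gt0 oppr_eq0.
move: d0 f0.
by case: (ltrgtP 0 (cross2 d f)); case: (ltrgtP 0 (cross2 d eps));
  case: (ltrgtP 0 (cross2 f eps)).
Qed.

(** The last segments of the two halves of an edge, arriving at the middle
    point. If they are parallel they come from opposite sides, which is what
    the last hypothesis says. *)
Lemma meets_shifted_end p d f eps :
    cross2 d eps != 0 -> cross2 f eps != 0 ->
    (cross2 d f = 0 -> leftward eps f = ~~ leftward eps d) ->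
  meets_shifted (p - d) p (p - f) p eps + meets_shifted (p - f) p (p - d) p eps
  = 1 + leftward eps d + leftward eps f :> bool.
Proof.
move=> d0 f0; rewrite /meets_shifted.
have -> : orient (p - d) p p = 0 by rewrite /orient /cross2 !mxE; ring.
have -> : orient (p - f) p p = 0 by rewrite /orient /cross2 !mxE; ring.
have -> : orient (p - d) p (p - f) = - cross2 d f by rewrite /orient /cross2 !mxE; ring.
have -> : orient (p - f) p (p - d) = cross2 d f by rewrite /orient /cross2 !mxE; ring.
have -> : p - (p - d) = d by rewrite opprB addrC subrK.
have -> : p - (p - f) = f by rewrite opprB addrC subrK.
rewrite !lexpos0 /lexpos /leftward !oppr_gt0 oppr_eq0.
move: d0 f0.
by case: (ltrgtP 0 (cross2 d f)) => k; case: (ltrgtP 0 (cross2 d eps));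
  case: (ltrgtP 0 (cross2 f eps)) => // _ _ _ _; rewrite -?k => // /(_ erefl).
Qed.

(** Consecutive segments of a path. If they are parallel the path goes
    straight on, which is what the last hypothesis says. *)
Lemma meets_shifted_bend p d f eps :
    cross2 d eps != 0 -> cross2 f eps != 0 ->
    (cross2 d f = 0 -> leftward eps f = leftward eps d) ->
  meets_shifted (p - d) p p (p + f) eps + meets_shifted p (p + f) (p - d) p eps
  = leftward eps d + leftward eps f :> bool.
Proof.
move=> d0 f0; rewrite /meets_shifted.
have -> : orient (p - d) p p = 0 by rewrite /orient /cross2 !mxE; ring.
have -> : orient p (p + f) p = 0 by rewrite /orient /cross2 !mxE; ring.
have -> : orient (p - d) p (p + f) = cross2 d f by rewrite /orient /cross2 !mxE; ring.
have -> : orient p (p + f) (p - d) = cross2 d f by rewrite /orient /cross2 !mxE; ring.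
have -> : p - (p - d) = d by rewrite opprB addrC subrK.
have -> : p + f - p = f by rewrite addrC addKr.
rewrite !lexpos0 /lexpos /leftward !oppr_gt0.
move: d0 f0.
by case: (ltrgtP 0 (cross2 d f)) => k; case: (ltrgtP 0 (cross2 d eps));
  case: (ltrgtP 0 (cross2 f eps)) => // _ _ _ _; rewrite -?k => // /(_ erefl).
Qed.

Lemma lexpos_opp A A' B : lexpos A B != lexpos A' B ->
  A != A' /\ 0 <= A / (A - A') <= 1.
Proof.
move=> neq; have AA' : A != A' by apply: contra neq => /eqP->.
split=> //; move: neq; rewrite /lexpos.
have [A0|A0|A0] := ltrgtP 0 A; have [A'0|A'0|A'0] := ltrgtP 0 A' => //= _.
all: try by rewrite -A0 -A'0 eqxx in AA'.
all: have [AAA|AAA] : 0 < A - A' \/ A - A' < 0 by [left; lra | right; lra].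
all: try (by rewrite (ler_pdivlMr _ _ AAA) (ler_pdivrMr _ _ AAA); apply/andP; split; lra).
all: by rewrite (ler_ndivlMr _ _ AAA) (ler_ndivrMr _ _ AAA); apply/andP; split; lra.
Qed.

(** For a small displacement, segments cross only if they already have a
    common point, so that the crossings of a drawing with its copy sit at its
    joints. *)
Lemma meets_shifted_common_point p q r s eps : meets_shifted p q r s eps ->
  exists u v, [/\ 0 <= u <= 1, 0 <= v <= 1 &
    (1 - u) *: p + u *: q = (1 - v) *: r + v *: s].
Proof.
rewrite /meets_shifted => h.
have [h1 h2] : lexpos (orient p q r) (cross2 (q - p) eps) !=
               lexpos (orient p q s) (cross2 (q - p) eps) /\
               lexpos (orient r s p) (- cross2 (s - r) eps) !=
               lexpos (orient r s q) (- cross2 (s - r) eps).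
  by move: h; do 4!case: (lexpos _ _).
have [n1 u1] := lexpos_opp h1; have [n2 u2] := lexpos_opp h2.
exists (orient r s p / (orient r s p - orient r s q)).
exists (orient p q r / (orient p q r - orient p q s)); split=> //.
have e : orient p q r - orient p q s = - (orient r s p - orient r s q).
  by rewrite /orient /cross2 !mxE; ring.
rewrite -subr_eq0 in n2; rewrite e.
apply/rowP=> j; rewrite !mxE.
apply: (mulIf n2); apply/eqP; rewrite -subr_eq0; apply/eqP.
have D : orient r s p - orient r s q != 0 by [].
transitivity ((orient r s p - orient r s q - orient r s p) * p 0 j + orient r s p * q 0 j
  - ((orient r s p - orient r s q + orient p q r) * r 0 j - orient p q r * s 0 j)).
  by field.
rewrite /orient /cross2 !mxE.
by case: (ord2_cases j) => ->; ring.
Qed.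

(** In a drawing, the interior points u d and v f of two segments that start
    from the same point are different, which excludes parallel segments in the
    same direction. *)
Lemma parallel_cases d f : d != 0 -> f != 0 -> cross2 d f = 0 ->
  exists u v : R, [/\ 0 < u < 1, 0 < v < 1 & u *: d = v *: f \/ u *: d = - (v *: f)].
Proof.
move=> d0 f0 df.
have [lam lam0 fE] : exists2 lam, lam != 0 & f = lam *: d.
  have [j dj] : exists j, d 0 j != 0.
    apply/existsP; apply: contraNT d0; rewrite negb_exists => /forallP dz.
    by apply/eqP/rowP=> j; have := dz j; rewrite negbK mxE => /eqP.
  have fE : f = (f 0 j / d 0 j) *: d.
    apply/rowP=> k; rewrite !mxE; apply: (mulIf dj); rewrite mulrAC divfK //.
    move: df; rewrite /cross2 => /eqP; rewrite subr_eq0 => /eqP df.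
    by case: (ord2_cases j) (ord2_cases k) => -> [] ->; lra.
  exists (f 0 j / d 0 j) => //; apply: contraNneq f0 => l0.
  by rewrite fE l0 scale0r.
pose m := `|lam| + 1.
have lam_gt0 : 0 < `|lam| by rewrite normr_gt0.
have m0 : 0 < m by rewrite addr_gt0.
exists (`|lam| / m), (1 / m); split.
- by rewrite divr_gt0 // ltr_pdivrMr // mul1r ltrDl ltr01.
- by rewrite divr_gt0 // ltr_pdivrMr // mul1r ltrDr.
rewrite fE scalerA; move: lam0; rewrite neq_lt => /orP[l|l].
  by right; rewrite (ltr0_norm l) mul1r mulrC -scaleNr mulrN.
by left; rewrite (gtr0_norm l) mul1r mulrC.
Qed.

Lemma leftward_scale eps d f (u v : R) : 0 < u -> 0 < v -> u *: d = v *: f ->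
  leftward eps d = leftward eps f.
Proof.
move=> u0 v0 e; rewrite /leftward -(pmulr_rgt0 _ u0) -[RHS](pmulr_rgt0 _ v0).
have scale x w : x * cross2 w eps = cross2 (x *: w) eps by rewrite /cross2 !mxE; ring.
by rewrite !scale e.
Qed.

Lemma leftward_opp eps d : cross2 d eps != 0 -> leftward eps (- d) = ~~ leftward eps d.
Proof.
rewrite /leftward (_ : cross2 (- d) eps = - cross2 d eps); last first.
  by rewrite /cross2 !mxE; ring.
by rewrite oppr_gt0 neq_lt -leNgt le_eqVlt; case: (ltrgtP 0 (cross2 d eps)).
Qed.

(** The value in [meets_shifted_start], with x = cross2 d f and with a and b
    the sides of eps with respect to d and f. *)
Definition ray_crossing x (a b : bool) : bool :=
  if x == 0 then false else if 0 < x then ~~ a && ~~ b else a && b.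

(** Three rays in counterclockwise order carry two colorings with even sums.
    The crossings of the rays with the displaced rays, each ray being counted
    with its own copy according to the side of the displacement, form an
    expression that depends on the cyclic order only, and not on the
    directions of the rays or of the displacement. The linear relation between
    t1, t2, t3 holds for any three vectors of the plane; it excludes the
    combinations of signs for which the identity fails. *)
Lemma star_parity (x12 x23 x31 t1 t2 t3 : R) (c1 c2 c3 e1 e2 e3 : bool) :
    [&& t1 != 0, t2 != 0 & t3 != 0] ->
    [|| (0 < x12) && (0 < x23), (0 < x23) && (0 < x31) | (0 < x31) && (0 < x12)] ->
    x23 * t1 + x31 * t2 + x12 * t3 = 0 ->
    [/\ x12 = 0 -> (0 < t2) = ~~ (0 < t1), x23 = 0 -> (0 < t3) = ~~ (0 < t2)
      & x31 = 0 -> (0 < t1) = ~~ (0 < t3)] ->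
    c1 + c2 + c3 = 0 :> bool -> e1 + e2 + e3 = 0 :> bool ->
  c1 * (e2 * ray_crossing x12 (0 < t1) (0 < t2) +
        e3 * ray_crossing (- x31) (0 < t1) (0 < t3)) +
  c2 * (e3 * ray_crossing x23 (0 < t2) (0 < t3) +
        e1 * ray_crossing (- x12) (0 < t2) (0 < t1)) +
  c3 * (e1 * ray_crossing x31 (0 < t3) (0 < t1) +
        e2 * ray_crossing (- x23) (0 < t3) (0 < t2)) +
  (c1 * e1 * (0 < t1) + c2 * e2 * (0 < t2) + c3 * e3 * (0 < t3))
  = c1 * e2 + c1 * e3 + c2 * e3 :> bool.
Proof.
move=> /and3P[n1 n2 n3] ccw0 lin [o12 o23 o31] c0 e0.
suff : [&& (x12 != 0) || ((0 < t2) == ~~ (0 < t1)), (x23 != 0) || ((0 < t3) == ~~ (0 < t2)),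
           (x31 != 0) || ((0 < t1) == ~~ (0 < t3))
         & [|| (0 < x12) && (0 < x23) && (0 < x31) && ~~ (((0 < t1) == (0 < t2)) && ((0 < t2) == (0 < t3))),
              [&& ~~ (0 < x12), 0 < x23, 0 < x31 & ((0 < t1) == (0 < t2)) ==> ((0 < t3) == (0 < t2))],
              [&& ~~ (0 < x23), 0 < x31, 0 < x12 & ((0 < t2) == (0 < t3)) ==> ((0 < t3) == (0 < t1))]
            | [&& ~~ (0 < x31), 0 < x12, 0 < x23 & ((0 < t3) == (0 < t1)) ==> ((0 < t1) == (0 < t2))]]].
  rewrite /ray_crossing !oppr_gt0 !oppr_eq0.
  case: (ltrgtP 0 x12); case: (ltrgtP 0 x23); case: (ltrgtP 0 x31) => _ _ _ //=;
   case: (0 < t1); case: (0 < t2); case: (0 < t3) => //= _; move: c0 e0;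
   case: c1; case: c2; case: c3 => //=; case: e1; case: e2; case: e3 => //=.
apply/and4P; split.
- by have [/o12->|] := eqVneq x12 0; rewrite ?eqxx.
- by have [/o23->|] := eqVneq x23 0; rewrite ?eqxx.
- by have [/o31->|] := eqVneq x31 0; rewrite ?eqxx.
case: (ltrgtP 0 x12) ccw0 o12 o31 o23 => h12; case: (ltrgtP 0 x23) => h23; case: (ltrgtP 0 x31) => h31 //= _ o12 o31 o23.
all: case: (ltrgtP 0 t1) n1 o12 o31 => [k1|k1|//] _ o12 o31.
all: case: (ltrgtP 0 t2) n2 o12 o23 => [k2|k2|//] _ o12 o23.
all: case: (ltrgtP 0 t3) n3 o31 o23 => [k3|k3|//] _ o31 o23 //=.
all: clear o12 o23 o31; exfalso; nra.
Qed.
End PlaneGeometry.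

(** * A drawing and its displaced copy *)

Section ParitySums.

Lemma telescope_parity (f : nat -> bool) n :
  \sum_(i < n) (f i + f i.+1) = f 0%N + f n.
Proof.
elim: n => [|n IHn]; first by rewrite big_ord0; case: (f _).
by rewrite big_ord_recr /= IHn; case: (f 0%N); case: (f n); case: (f n.+1).
Qed.

Lemma near_diagonal_sum (f : nat -> nat -> bool) m :
    (forall i j, (i <= m)%N -> (j <= m)%N -> f i j -> (j == i.+1) || (i == j.+1)) ->
  \sum_(i < m.+1) \sum_(j < m.+1) f i j = \sum_(i < m) (f i i.+1 + f i.+1 i).
Proof.
elim: m => [|m IHm] f_near.
  rewrite big_ord_recr !big_ord0 /= big_ord_recr big_ord0 /=.
  by have := f_near 0%N 0%N isT isT; case: (f _ _) => // /(_ isT).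
have f_far i j : (i <= m.+1)%N -> (j <= m.+1)%N -> (j != i.+1) && (i != j.+1) -> f i j = 0.
  move=> im jm; have := f_near i j im jm; case: (f i j) => // /(_ isT).
  by case: (_ == _); case: (_ == _).
have fdiag i : (i <= m.+1)%N -> f i i = 0 by move=> im; apply: f_far => //; lia.
rewrite big_ord_recr /=.
under eq_bigr => i _ do rewrite big_ord_recr /=.
rewrite big_split /= IHm => [|i j im jm]; last by apply: f_near; lia.
rewrite [X in _ + _ + X]big_ord_recr /= fdiag // addr0.
rewrite [X in _ + X + _]big_ord_recr /= [X in _ + (X + _) + _]big1 ?add0r; last first.
  by move=> i _; apply: f_far; have := ltn_ord i; lia.
rewrite [X in _ + _ + X]big_ord_recr /= [X in _ + _ + (X + _)]big1 ?add0r; last first.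
  by move=> i _; apply: f_far; have := ltn_ord i; lia.
by rewrite [RHS]big_ord_recr /= addrA.
Qed.

End ParitySums.

Section Drawing.
Variables (R : realType) (G : trivalent_graph).
Local Notation V := (vertex G).
Local Notation H := (half_edge G).
Local Notation E := (edge G).
Local Notation point := 'rV[R]_2.
Variables (pos : V -> point) (mid : E -> point) (bends : H -> seq point).
Hypothesis paths_simple : simple_paths pos mid bends.
Hypothesis paths_disjoint : disjoint_paths pos mid bends.
Implicit Types (h k : H) (i j : nat) (u v : R).

Definition joint h i : point := (half_path pos mid bends h)`_i.
Definition last_seg h := size (bends h).
Definition seg_dir h i := joint h i.+1 - joint h i.

Lemma joint0 h : joint h 0 = pos (origin h).
Proof. by []. Qed.

Lemma joint_last h : joint h (last_seg h).+1 = mid (edge_of h).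
Proof. by rewrite /joint /half_path /= nth_rcons ltnn eqxx. Qed.

Lemma joint_end h u : joint h (last_seg h) + (1 - u) *: seg_dir h (last_seg h) =
  mid (edge_of h) - u *: seg_dir h (last_seg h).
Proof. by rewrite scalerBl scale1r addrA; congr (_ - _); rewrite addrC subrK joint_last. Qed.

Lemma seg_param h i u : (i <= last_seg h)%N -> 0 <= u <= 1 ->
  poly_param (half_path pos mid bends h) i u.
Proof. by move=> ih u01; split; rewrite //= size_rcons. Qed.

Lemma seg_point h i u :
  poly_at (half_path pos mid bends h) i u = joint h i + u *: seg_dir h i.
Proof.
by rewrite /poly_at /seg_dir /joint scalerBr scalerBl scale1r -addrA [- _ + _]addrC addrA.
Qed.

Lemma same_position h i j u v :
    (i <= last_seg h)%N -> (j <= last_seg h)%N -> 0 <= u <= 1 -> 0 <= v <= 1 ->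
    joint h i + u *: seg_dir h i = joint h j + v *: seg_dir h j ->
  i%:R + u = j%:R + v.
Proof.
move=> ih jh u01 v01 e; apply: (@paths_simple h).
- exact: seg_param.
- exact: seg_param.
- by rewrite !seg_point.
Qed.

Lemma seg_dir_neq0 h i : (i <= last_seg h)%N -> seg_dir h i != 0.
Proof.
move=> ih; apply/eqP=> d0.
have := @same_position h i i 0 1 ih ih; rewrite !d0 !scaler0 !lexx !ler01.
by move=> /(_ isT isT erefl) /addrI /eqP; rewrite eq_sym oner_eq0.
Qed.

Lemma common_position h k i j u v : h != k ->
    (i <= last_seg h)%N -> (j <= last_seg k)%N -> 0 <= u <= 1 -> 0 <= v <= 1 ->
    joint h i + u *: seg_dir h i = joint k j + v *: seg_dir k j ->
  (origin h = origin k /\ i%:R + u = 0 /\ j%:R + v = 0) \/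
  (k = mate h /\ i%:R + u = (last_seg h).+1%:R /\ j%:R + v = (last_seg k).+1%:R).
Proof.
move=> hk ih jk u01 v01 e.
have at0 l : joint l 0 + 0 *: seg_dir l 0 = pos (origin l) by rewrite scale0r addr0.
have at1 l : joint l (last_seg l) + 1 *: seg_dir l (last_seg l) = mid (edge_of l).
  by rewrite scale1r addrC subrK joint_last.
have oo : 0 <= (0 : R) <= 1 by rewrite lexx ler01.
have ii : 0 <= (1 : R) <= 1 by rewrite lexx ler01.
have := paths_disjoint hk (seg_param ih u01) (seg_param jk v01).
rewrite !seg_point => /(_ e) [[ohk eP]|[ehk eP]].
  left; split=> //; split.
    by rewrite (@same_position h i 0 u 0) ?addr0 // eP at0.
  by rewrite (@same_position k j 0 v 0) ?addr0 // -e eP at0 ohk.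
right; split.
  by apply/esym/eqP; have := @ends_cases G h k (esym ehk); rewrite eq_sym (negbTE hk) /= eq_sym.
split.
  by rewrite (@same_position h i (last_seg h) u 1) // ?eP ?at1 // -natr1.
by rewrite (@same_position k j (last_seg k) v 1) // -?e ?eP ?at1 ?ehk // -natr1.
Qed.

Definition meet eps h i k j : bool :=
  meets_shifted (joint h i) (joint h i.+1) (joint k j) (joint k j.+1) eps.

Lemma meet_point eps h i k j : meet eps h i k j ->
  exists u v, [/\ 0 <= u <= 1, 0 <= v <= 1 &
    joint h i + u *: seg_dir h i = joint k j + v *: seg_dir k j].
Proof.
move=> /meets_shifted_common_point[u [v [u01 v01 e]]]; exists u, v; split=> //.
by rewrite -!seg_point.
Qed.

(** Only neighbouring segments of a simple path have a common point. *)
Lemma meet_near eps h i j : (i <= last_seg h)%N -> (j <= last_seg h)%N ->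
  meet eps h i h j -> (j == i.+1) || (i == j.+1).
Proof.
move=> ih jh m; have ij : i != j.
  by apply: contraTneq m => ->; rewrite /meet meets_shifted_self.
case/meet_point: m => u [v [/andP[u0 u1] /andP[v0 v1] /same_position]].
rewrite u0 u1 v0 v1 => /(_ ih jh isT isT) e.
have: (j <= i.+1)%N by rewrite -(ler_nat R) -natr1; lra.
have: (i <= j.+1)%N by rewrite -(ler_nat R) -natr1; lra.
lia.
Qed.

Lemma meet_far eps h k i j : h != k -> (i <= last_seg h)%N -> (j <= last_seg k)%N ->
  meet eps h i k j ->
  (origin h == origin k) && (i == 0) && (j == 0) ||
  (k == mate h) && (i == last_seg h) && (j == last_seg k).
Proof.
move=> hk ih jk /meet_point[u [v [u01 v01 /(common_position hk ih jk u01 v01)]]].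
move: u01 v01 => /andP[u0 u1] /andP[v0 v1] [[-> [e1 e2]]|[kE [e1 e2]]].
  rewrite eqxx; have: (i <= 0)%N by rewrite -(ler_nat R); lra.
  by have: (j <= 0)%N by [rewrite -(ler_nat R); lra]; rewrite !leqn0 => -> ->.
rewrite -kE eqxx orbC ![_ == last_seg _]eqn_leq ih jk /=.
rewrite -natr1 in e1; rewrite -natr1 in e2.
have -> : (last_seg h <= i)%N by rewrite -(ler_nat R); lra.
by have -> : (last_seg k <= j)%N by rewrite -(ler_nat R); lra.
Qed.

(** If the path turned back, the two segments would overlap near their common
    end. *)
Lemma bend_turn eps h i : (i < last_seg h)%N ->
    cross2 (seg_dir h i.+1) eps != 0 ->
    cross2 (seg_dir h i) (seg_dir h i.+1) = 0 ->
  leftward eps (seg_dir h i.+1) = leftward eps (seg_dir h i).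
Proof.
move=> ih f0 /parallel_cases[||u [v [/andP[u0 u1] /andP[v0 v1] [e|e]]]].
- by apply: seg_dir_neq0; apply: ltnW.
- exact: seg_dir_neq0.
- by rewrite (leftward_scale _ u0 v0 e).
have := @same_position h i i.+1 (1 - u) v (ltnW ih) ih.
rewrite scalerBl scale1r e opprK addrA [joint h i + _]addrC subrK -natr1.
have -> : 0 <= 1 - u <= 1 by apply/andP; split; lra.
have -> : 0 <= v <= 1 by apply/andP; split; lra.
by move=> /(_ isT isT erefl); lra.
Qed.

(** If the parallel segments came from the same side, the two halves would
    overlap near the middle of the edge. *)
Lemma mid_turn eps h (d := seg_dir h (last_seg h))
    (f := seg_dir (mate h) (last_seg (mate h))) :
    cross2 d eps != 0 -> cross2 f eps != 0 -> cross2 d f = 0 ->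
  leftward eps f = ~~ leftward eps d.
Proof.
move=> d0 f0 /parallel_cases[||u [v [/andP[u0 u1] /andP[v0 v1] [e|e]]]].
- exact: seg_dir_neq0.
- exact: seg_dir_neq0.
- have hk : h != mate h by rewrite eq_sym mate_neq.
  have := @common_position h (mate h) (last_seg h) (last_seg (mate h)) (1 - u) (1 - v) hk.
  rewrite !joint_end -/d -/f e edge_mate !leqnn -!natr1.
  have -> : 0 <= 1 - u <= 1 by apply/andP; split; lra.
  have -> : 0 <= 1 - v <= 1 by apply/andP; split; lra.
  have := ler0n R (last_seg h).
  by move=> l0 /(_ isT isT isT isT erefl) [[_ []]|[_ []]]; lra.
rewrite -scalerN in e; rewrite (leftward_scale _ u0 v0 e) leftward_opp //.
by rewrite negbK.
Qed.

(** If the parallel segments left in the same direction, the two paths would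
    overlap near the vertex. *)
Lemma star_turn eps h k (d := seg_dir h 0) (f := seg_dir k 0) :
    h != k -> origin h = origin k ->
    cross2 d eps != 0 -> cross2 f eps != 0 -> cross2 d f = 0 ->
  leftward eps f = ~~ leftward eps d.
Proof.
move=> hk ohk d0 f0 /parallel_cases[||u [v [/andP[u0 u1] /andP[v0 v1] [e|e]]]].
- exact: seg_dir_neq0.
- exact: seg_dir_neq0.
- have := @common_position h k 0 0 u v hk isT isT.
  rewrite -/d -/f e !joint0 ohk.
  have -> : 0 <= u <= 1 by apply/andP; split; lra.
  have -> : 0 <= v <= 1 by apply/andP; split; lra.
  have := ler0n R (last_seg h); rewrite -natr1.
  by move=> l0 /(_ isT isT erefl) [[_ []]|[_ []]]; lra.
rewrite -scalerN in e; rewrite (leftward_scale _ u0 v0 e) leftward_opp //.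
by rewrite negbK.
Qed.

Section Generic.
Variables (eps : point) (shift : R).

Definition segs : seq (H * nat) := [seq (h, i) | h <- enum H, i <- iota 0 (last_seg h).+1].
Definition joints : seq point := [seq joint h i | h <- enum H, i <- iota 0 (last_seg h).+2].

(** For one displacement shift * eps, the count [meets_shifted] is the
    right-hand side of [segment_parity], in which every end point has its own
    contribution. *)
Definition general_position : Prop := forall h i k j,
  (i <= last_seg h)%N -> (j <= last_seg k)%N ->
  let p := joint h i in let q := joint h i.+1 in
  let r := joint k j in let s := joint k j.+1 in
  meets_shifted p q r s eps =
  (above p (r + shift *: eps) (s + shift *: eps) + ((r + shift *: eps) 0 0 < p 0 0)
     + ((s + shift *: eps) 0 0 < p 0 0)) +
  (above q (r + shift *: eps) (s + shift *: eps) + ((r + shift *: eps) 0 0 < q 0 0)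
     + ((s + shift *: eps) 0 0 < q 0 0)) +
  (above (r + shift *: eps) p q + above (s + shift *: eps) p q).
End Generic.

(** Finitely many conditions: eps is parallel to no segment, and shift is so
    small that the orientations and the differences of abscissas that are not
    zero keep their signs. *)
Lemma general_position_exists : exists eps shift,
  (forall h i, (i <= last_seg h)%N -> cross2 (seg_dir h i) eps != 0) /\
  general_position eps shift.
Proof.
pose dirs := [seq seg_dir hi.1 hi.2 | hi <- segs].
have segP h i : (i <= last_seg h)%N -> (h, i) \in segs.
  by move=> ih; apply/allpairsPdep; exists h, i; rewrite mem_enum mem_iota /= add0n ltnS.
have jointP h i : (i <= (last_seg h).+1)%N -> joint h i \in joints.
  by move=> ih; apply/allpairsPdep; exists h, i; rewrite mem_enum mem_iota /= add0n ltnS.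
have dirs0 : all (fun d => d != 0) dirs.
  apply/allP=> d /mapP[[h i] /allpairsPdep[h' [i' [_]]]].
  rewrite mem_iota add0n ltnS => ih [-> ->] ->; exact: seg_dir_neq0.
have [eps eps1 epsP] := generic_direction dirs0.
have dirP h i : (i <= last_seg h)%N -> cross2 (seg_dir h i) eps != 0.
  by move=> /segP hi; apply: epsP; apply/mapP; exists (h, i).
pose ups := [seq (orient (joint hi.1 hi.2) (joint hi.1 hi.2.+1) z,
                  cross2 (seg_dir hi.1 hi.2) eps) | hi <- segs, z <- joints].
pose downs := [seq (orient (joint hi.1 hi.2) (joint hi.1 hi.2.+1) z,
                  - cross2 (seg_dir hi.1 hi.2) eps) | hi <- segs, z <- joints].
pose gaps := [seq ((z : point) 0 0 - (y : point) 0 0, - 1 : R) | z <- joints, y <- joints].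
have nz : all (fun w : R * R => w.2 != 0) (ups ++ downs ++ gaps).
  rewrite !all_cat; apply/and3P; split; apply/allP=> x /allpairsPdep[a [b [ain bin ->]]] /=.
  - by case/allpairsPdep: ain => h [i [_]]; rewrite mem_iota add0n ltnS => ih ->; exact: dirP.
  - by case/allpairsPdep: ain => h [i [_]]; rewrite mem_iota add0n ltnS => ih ->;
      rewrite oppr_eq0; exact: dirP.
  - by rewrite oppr_eq0 oner_eq0.
have [shift shift0 shiftP] := small_shift nz.
exists eps, shift; split=> // h i k j ih jk p q r s.
have upP h' i' z : (i' <= last_seg h')%N -> z \in joints ->
    let A := orient (joint h' i') (joint h' i'.+1) z in
    let B := cross2 (seg_dir h' i') eps in
    (A + shift * B != 0) /\ (0 < A + shift * B) = lexpos A B.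
  move=> ih' zin; apply: (shiftP (_, _)); rewrite mem_cat; apply/orP; left.
  by apply/allpairsP; exists ((h', i'), z); rewrite segP.
have downP h' i' z : (i' <= last_seg h')%N -> z \in joints ->
    let A := orient (joint h' i') (joint h' i'.+1) z in
    let B := - cross2 (seg_dir h' i') eps in
    (A + shift * B != 0) /\ (0 < A + shift * B) = lexpos A B.
  move=> ih' zin; apply: (shiftP (_, _)); rewrite !mem_cat; apply/or3P; apply: Or32.
  by apply/allpairsP; exists ((h', i'), z); rewrite segP.
have gapP z y : z \in joints -> y \in joints -> z 0 0 != (y + shift *: eps) 0 0.
  move=> zin yin; have [] := shiftP (z 0 0 - y 0 0, - 1); last first.
    by move=> + _; rewrite !mxE eps1 mulr1 mulrN1 -addrA -opprD subr_eq0.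
  rewrite !mem_cat; apply/or3P; apply: Or33.
  by apply/allpairsP; exists (z, y).
have [pin qin] : p \in joints /\ q \in joints by split; apply: jointP; lia.
have [rin sin] : r \in joints /\ s \in joints by split; apply: jointP; lia.
have move_up x : orient p q (x + shift *: eps) = orient p q x + shift * cross2 (q - p) eps.
  by rewrite /orient /cross2 !mxE; ring.
have move_down x : orient (r + shift *: eps) (s + shift *: eps) x =
    orient r s x + shift * (- cross2 (s - r) eps).
  by rewrite /orient /cross2 !mxE; ring.
rewrite -segment_parity; last by rewrite !gapP.
  rewrite !move_up !move_down.
  have [_ ->] := upP h i r ih rin; have [_ ->] := upP h i s ih sin.
  by have [_ ->] := downP k j p jk pin; have [_ ->] := downP k j q jk qin.
rewrite !move_up !move_down.
have [-> _] := upP h i r ih rin; have [-> _] := upP h i s ih sin.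
by have [-> _] := downP k j p jk pin; have [-> _] := downP k j q jk qin.
Qed.

End Drawing.

(** * Pairs of cycles of a plane graph *)

(** The second hypothesis keeps the positions (0, 0) and (m, n) distinct when
    both contribute. *)
Lemma two_point_sum (f : nat -> nat -> bool) m n (A B : bool) :
    (forall i j, (i <= m)%N -> (j <= n)%N -> f i j ->
       A && (i == 0%N) && (j == 0%N) || B && (i == m) && (j == n)) ->
    ~~ [&& A, B, m == 0%N & n == 0%N] ->
  \sum_(i < m.+1) \sum_(j < n.+1) f i j = A * f 0%N 0%N + B * f m n.
Proof.
move=> supp excl.
have single b i0 j0 : (i0 <= m)%N -> (j0 <= n)%N ->
    \sum_(i < m.+1) \sum_(j < n.+1) (b && (i == i0 :> nat) && (j == j0 :> nat)) * f i j
    = b * f i0 j0.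
  move=> i0m j0n; rewrite (bigD1 (Ordinal (i0m : i0 < m.+1)%N)) //=.
  rewrite (bigD1 (Ordinal (j0n : j0 < n.+1)%N)) //= !eqxx !andbT.
  rewrite big1 ?addr0 => [|j jj0]; last by rewrite [_ == j0](negbTE jj0) andbF mul0r.
  rewrite big1 ?addr0 // => i ii0; apply: big1 => j _.
  by rewrite [_ == i0](negbTE ii0) andbF mul0r.
rewrite -(single A) // -(single B) // -big_split; apply: eq_bigr => i _.
rewrite -big_split; apply: eq_bigr => j _ /=.
have := supp i j (ltn_ord i) (ltn_ord j).
have : ~~ ((A && (i == 0%N :> nat) && (j == 0%N :> nat)) && (B && (i == m :> nat) && (j == n :> nat))).
  apply: contra excl => /andP[/andP[/andP[-> /eqP<-] /eqP<-] /andP[/andP[-> im] jn]].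
  by rewrite eq_sym im eq_sym jn.
case: (f i j); last by rewrite !mulr0.
by case: (A && (i == _ :> nat) && _); case: (B && (i == _ :> nat) && _) => // _ /(_ isT).
Qed.

Section Intersection.
Variables (R : realType) (G : trivalent_graph).
Local Notation V := (vertex G).
Local Notation H := (half_edge G).
Local Notation E := (edge G).
Local Notation point := 'rV[R]_2.
Variables (lt : rel H) (lt_compatible : compatible_order lt).

(** The edges of color 1 form a cycle modulo 2. *)
Definition even_at_vertices (c : E -> bool) : Prop :=
  forall v, \sum_(h : H | origin h == v) c (edge_of h) = 0.

Lemma even_star c h : even_at_vertices c ->
  c (edge_of h) + c (edge_of (vnext h)) + c (edge_of (vnext (vnext h))) = 0.
Proof. by move=> /(_ (origin h)); rewrite sum_star. Qed.

Section InDrawing.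
Variables (pos : V -> point) (mid : E -> point) (bends : H -> seq point).
Hypothesis paths_simple : simple_paths pos mid bends.
Hypothesis paths_disjoint : disjoint_paths pos mid bends.
Variables (c c' : E -> bool).
Hypothesis c_even : even_at_vertices c.
Hypothesis c'_even : even_at_vertices c'.
Local Notation joint := (joint pos mid bends).
Local Notation last_seg := (last_seg bends).
Local Notation seg_dir := (seg_dir pos mid bends).
Local Notation meet := (meet pos mid bends).

(** Bends and middle points are counted twice, and a vertex as many times as d
    has edges there, which is even. *)
Lemma sum_joint_parity (d : E -> bool) (f : point -> bool) : even_at_vertices d ->
  \sum_h \sum_(i < (last_seg h).+1)
    d (edge_of h) * (f (joint h i) + f (joint h i.+1)) = 0.
Proof.
move=> d_even; transitivity (\sum_h d (edge_of h) * (f (pos (origin h)) + f (mid (edge_of h)))).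
  apply: eq_bigr => h _; rewrite -mulr_sumr.
  by rewrite (telescope_parity (fun i => f (joint h i))) joint0 joint_last.
under eq_bigr => h _ do rewrite mulrDr.
rewrite big_split /= (partition_big (@origin G) predT) //= big1 ?add0r => [|v _]; last first.
  transitivity ((\sum_(h : H | origin h == v) d (edge_of h)) * f (pos v)).
    by rewrite mulr_suml; apply: eq_bigr => h /eqP->.
  by rewrite d_even mul0r.
rewrite (sum_edges lt_compatible) big1 // => h _; rewrite edge_mate.
by case: (_ * _).
Qed.

Variables (eps : point) (shift : R).
Hypothesis eps_generic : forall h i, (i <= last_seg h)%N -> cross2 (seg_dir h i) eps != 0.
Hypothesis generic : general_position pos mid bends eps shift.

Local Notation meets h k :=
  (\sum_(i < (last_seg h).+1) \sum_(j < (last_seg k).+1) meet eps h i k j).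

(** A cycle and the displaced copy of another one cross an even number of
    times: by general position a crossing is a sum of contributions of single
    end points, and each of them is counted an even number of times. *)
Lemma sum_meets : \sum_h \sum_k c (edge_of h) * c' (edge_of k) * meets h k = 0.
Proof.
pose mv (x : point) := x + shift *: eps.
pose f k j p := above p (mv (joint k j)) (mv (joint k j.+1)) +
  ((mv (joint k j)) 0 0 < p 0 0) + ((mv (joint k j.+1)) 0 0 < p 0 0) : bool.
pose g h i r := above (mv r) (joint h i) (joint h i.+1).
transitivity (\sum_h \sum_k c (edge_of h) * c' (edge_of k) *
   \sum_(i < (last_seg h).+1) \sum_(j < (last_seg k).+1)
     ((f k j (joint h i) + f k j (joint h i.+1)) +
      (g h i (joint k j) + g h i (joint k j.+1)))).
  apply: eq_bigr => h _; apply: eq_bigr => k _; congr (_ * _).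
  apply: eq_bigr => i _; apply: eq_bigr => j _.
  exact: (generic (ltn_ord i) (ltn_ord j)).
transitivity (
  \sum_k \sum_(j < (last_seg k).+1) c' (edge_of k) *
    (\sum_h \sum_(i < (last_seg h).+1)
        c (edge_of h) * (f k j (joint h i) + f k j (joint h i.+1))) +
  \sum_h \sum_(i < (last_seg h).+1) c (edge_of h) *
    (\sum_k \sum_(j < (last_seg k).+1)
        c' (edge_of k) * (g h i (joint k j) + g h i (joint k j.+1)))).
  rewrite [X in X + _](_ : _ = \sum_h \sum_k c (edge_of h) * c' (edge_of k) *
     \sum_(i < (last_seg h).+1) \sum_(j < (last_seg k).+1)
     (f k j (joint h i) + f k j (joint h i.+1))); last first.
    rewrite [RHS]exchange_big /=; apply: eq_bigr => k _.
    under [RHS]eq_bigr => h _ do rewrite exchange_big mulr_sumr /=.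
    rewrite [RHS]exchange_big /=; apply: eq_bigr => j _.
    rewrite mulr_sumr; apply: eq_bigr => h _; rewrite !mulr_sumr.
    by apply: eq_bigr => i _; rewrite mulrA [c' _ * _]mulrC.
  rewrite [X in _ + X](_ : _ = \sum_h \sum_k c (edge_of h) * c' (edge_of k) *
     \sum_(i < (last_seg h).+1) \sum_(j < (last_seg k).+1)
     (g h i (joint k j) + g h i (joint k j.+1))); last first.
    apply: eq_bigr => h _; under [RHS]eq_bigr => k _ do rewrite mulr_sumr /=.
    rewrite [RHS]exchange_big /=; apply: eq_bigr => i _.
    rewrite mulr_sumr; apply: eq_bigr => k _; rewrite !mulr_sumr.
    by apply: eq_bigr => j _; rewrite mulrA.
  rewrite -big_split; apply: eq_bigr => h _; rewrite -big_split; apply: eq_bigr => k _ /=.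
  rewrite -mulrDr -big_split; congr (_ * _); apply: eq_bigr => i _.
  by rewrite -big_split.
rewrite big1 ?add0r => [|k _]; last first.
  by rewrite big1 // => j _; rewrite sum_joint_parity ?mulr0.
by rewrite big1 // => h _; rewrite big1 // => i _; rewrite sum_joint_parity ?mulr0.
Qed.

Local Notation left_at h i := (leftward eps (seg_dir h i)).

(** A path crosses its own copy at the bends where the displacement changes
    sides; the parity of the changes is determined by the two ends. *)
Lemma meets_same h : meets h h = left_at h 0 + left_at h (last_seg h).
Proof.
rewrite (near_diagonal_sum (f := fun i j => meet eps h i h j)); last first.
  by move=> i j; apply: (meet_near paths_simple).
rewrite -(telescope_parity (fun i => left_at h i)); apply: eq_bigr => i _ /=.
rewrite -(@meets_shifted_bend _ (joint h i.+1)); first last.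
- by apply: (bend_turn paths_simple) => //; apply: eps_generic.
- exact: eps_generic.
- by apply/eps_generic/ltnW.
by rewrite /meet /seg_dir !subKr [joint h i.+1 + _]addrC subrK.
Qed.

Definition star_crossing h k : bool :=
  ray_crossing (cross2 (seg_dir h 0) (seg_dir k 0)) (left_at h 0) (left_at k 0).

Definition mid_crossing h : bool :=
  meet eps h (last_seg h) (mate h) (last_seg (mate h)).

Lemma star_crossing_meet h k : origin h = origin k -> meet eps h 0 k 0 = star_crossing h k.
Proof.
move=> ohk; have := @meets_shifted_start _ (pos (origin h)) (seg_dir h 0) (seg_dir k 0) eps.
have -> : pos (origin h) + seg_dir h 0 = joint h 1 by rewrite addrC subrK.
have -> : pos (origin h) + seg_dir k 0 = joint k 1 by rewrite ohk addrC subrK.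
by rewrite /meet !joint0 -ohk => -> //; exact: eps_generic.
Qed.

(** Two half-edges have common points only at their vertex and at the middle
    of their edge. *)
Lemma meets_distinct h k : h != k ->
  meets h k = (origin h == origin k) * star_crossing h k + (k == mate h) * mid_crossing h.
Proof.
move=> hk; have far i j := meet_far paths_simple paths_disjoint (eps := eps) (i := i) (j := j) hk.
have both : ~~ [&& origin h == origin k, k == mate h, last_seg h == 0%N & last_seg k == 0%N].
  apply/negP=> /and4P[/eqP ohk /eqP kh /eqP h0 /eqP k0].
  have e : joint h 0 + 2^-1 *: seg_dir h 0 = joint k 0 + 2^-1 *: seg_dir k 0.
    have h1 : joint h 1 = mid (edge_of h) by rewrite -(joint_last pos mid bends) h0.
    have k1 : joint k 1 = mid (edge_of k) by rewrite -(joint_last pos mid bends) k0.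
    by rewrite /seg_dir h1 k1 !joint0 ohk kh edge_mate.
  have := common_position paths_simple paths_disjoint hk _ _ _ _ e.
  rewrite h0 k0 /= => /(_ isT isT).
  have -> : 0 <= (2^-1 : R) <= 1 by apply/andP; split; lra.
  by move=> /(_ isT isT) [[_ []]|[_ []]]; lra.
rewrite (two_point_sum (f := fun i j => meet eps h i k j) far); last first.
  by move: both; case: (origin h == _); case: (k == _).
congr (_ + _).
  by have [ohk|] := eqVneq (origin h) (origin k); rewrite ?mul0r ?star_crossing_meet.
by have [->|] := eqVneq k (mate h); rewrite ?mul0r.
Qed.

Lemma mid_crossings h :
  mid_crossing h + mid_crossing (mate h) =
  1 + left_at h (last_seg h) + left_at (mate h) (last_seg (mate h)) :> bool.
Proof.
rewrite -(@meets_shifted_end _ (mid (edge_of h))); first last.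
- by apply: (mid_turn paths_simple paths_disjoint); exact: eps_generic.
- exact: eps_generic.
- exact: eps_generic.
by rewrite /mid_crossing /meet mateK /seg_dir !joint_last edge_mate !subKr.
Qed.

(** The crossings of an edge with its copy are determined by the sides of the
    displacement at its two ends, up to one unit that comes from the middle
    point, by [mid_crossings]; so the total of [sum_meets] is carried by the
    vertices and by this unit. *)
Lemma intersection_at_vertices :
  \sum_h (c (edge_of h) * c' (edge_of h) * left_at h 0 +
    \sum_(k | (k != h) && (origin k == origin h))
       c (edge_of h) * c' (edge_of k) * star_crossing h k) =
  \sum_(h | lt h (mate h)) c (edge_of h) * c' (edge_of h).
Proof.
have := sum_meets.
under eq_bigr => h _.
  rewrite (bigD1 h) //= meets_same.
  under eq_bigr => k kh.
    rewrite meets_distinct 1?eq_sym // mulrDr; over.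
  rewrite big_split /= [X in _ + (_ + X)](bigD1 (mate h)) ?mate_neq //=.
  rewrite [X in _ + (_ + (_ + X))]big1; last first.
    by move=> k /andP[_ /negbTE->]; rewrite mul0r mulr0.
  rewrite addr0 eqxx mul1r edge_mate mulrDr.
  rewrite [X in _ + (X + _)](_ : _ = \sum_(k | (k != h) && (origin k == origin h))
       c (edge_of h) * c' (edge_of k) * star_crossing h k); last first.
    rewrite [RHS]big_mkcondr; apply: eq_bigr => k _ /=; rewrite [origin k == _]eq_sym.
    by case: (_ == _); rewrite ?mul1r ?mul0r ?mulr0.
  rewrite addrACA -mulrDr; over.
rewrite big_split /= => /eqP; rewrite addr_eq0 => /eqP eq1.
transitivity (\sum_h c (edge_of h) * c' (edge_of h) * (left_at h (last_seg h) + mid_crossing h)).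
  by rewrite eq1; case: (\sum_i _).
rewrite (sum_edges lt_compatible); apply: eq_bigr => h _; rewrite edge_mate -mulrDr.
rewrite addrACA mid_crossings.
by case: (c _ * _); case: (leftward _ _); case: (leftward _ _).
Qed.
End InDrawing.

Lemma sum_star_others (W : nmodType) h (g : H -> W) :
  \sum_(k | (k != h) && (origin k == origin h)) g k = g (vnext h) + g (vnext (vnext h)).
Proof.
have [n1 n2 n3] := star_neq h.
rewrite (bigD1 (vnext h)) /=; last by rewrite origin_vnext eqxx eq_sym n1.
rewrite (bigD1 (vnext (vnext h))) /=; last first.
  by rewrite !origin_vnext eqxx eq_sym n2 eq_sym n3.
rewrite big1 ?addr0 // => k /andP[/andP[/andP[kh /eqP/star_cases]]].
by rewrite !inE (negbTE kh) /= => /orP[]/eqP->; rewrite eqxx.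
Qed.

(** By [star_parity] the crossings near a vertex are determined by the cyclic
    order, hence can be written with the linear order of the half-edges. When
    the cyclic orders are clockwise, the value at a vertex changes by the sum
    of c c' over its star; these changes add up to zero, as each edge is
    counted at its two ends. *)
Lemma planar_parity (c c' : E -> bool) :
    planar G R -> even_at_vertices c -> even_at_vertices c' ->
  \sum_h \sum_(k | (origin k == origin h) && lt h k) c (edge_of h) * c' (edge_of k) +
  \sum_(h | lt h (mate h)) c (edge_of h) * c' (edge_of h) = 0 :> bool.
Proof.
move=> [pos [mid [bends [simple disjoint orient]]]] c_even c'_even.
have [eps [shift [eps_generic generic]]] := general_position_exists simple.
rewrite -(intersection_at_vertices simple disjoint c_even c'_even eps_generic generic).
pose d h := seg_dir pos mid bends h 0.
pose t h := cross2 (d h) eps.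
pose rc h k := ray_crossing (cross2 (d h) (d k)) (0 < t h) (0 < t k).
have t0 h : t h != 0 by apply: eps_generic.
have turn h k : h != k -> origin h = origin k -> cross2 (d h) (d k) = 0 ->
    (0 < t k) = ~~ (0 < t h).
  by move=> hk ohk; apply: (star_turn simple disjoint) => //; apply: eps_generic.
have crossV x y : cross2 x y = - cross2 y x :> R by rewrite /cross2; ring.
have lin h1 h2 h3 : cross2 (d h2) (d h3) * t h1 + cross2 (d h3) (d h1) * t h2 +
    cross2 (d h1) (d h2) * t h3 = 0.
  by rewrite /t /cross2; ring.
pose C h := c (edge_of h); pose C' h := c' (edge_of h).
have star h : vmin lt h ->
  [/\ \sum_(k | (origin k == origin h) && lt h k) C h * C' k
      = C h * C' (vnext h) + C h * C' (vnext (vnext h)),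
     \sum_(k | (origin k == origin (vnext h)) && lt (vnext h) k) C (vnext h) * C' k
      = C (vnext h) * C' (vnext (vnext h)) &
     \sum_(k | (origin k == origin (vnext (vnext h))) && lt (vnext (vnext h)) k)
        C (vnext (vnext h)) * C' k = 0].
  move=> vm; have l31 : lt (vnext (vnext h)) h = false.
    have := star_order lt_compatible h; case/andP: vm => /= -> ->.
    by case: (lt _ h).
  have [n1 n2 n3] := star_neq h; have irr := lt_irr lt_compatible.
  case/andP: vm => l12 l23.
  have l13 : lt h (vnext (vnext h)) by rewrite (ltV lt_compatible) 1?eq_sym // l31.
  by rewrite !big_mkcondr !sum_star !vnextK3 !irr l12 l23 l13 l31
     (ltV lt_compatible n1) (ltV lt_compatible n3) l12 l23 /= !add0r ?addr0.
rewrite (sum_vertices lt_compatible) [X in _ + X](sum_vertices lt_compatible).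
rewrite -big_split /=.
(* The boolean b tells whether the cyclic orders are clockwise. *)
suff [b bP] : exists b : bool, forall h, vmin lt h ->
    C h * C' (vnext h) + C h * C' (vnext (vnext h)) + C (vnext h) * C' (vnext (vnext h)) +
    (C h * (C' (vnext h) * rc h (vnext h) + C' (vnext (vnext h)) * rc h (vnext (vnext h))) +
     C (vnext h) * (C' (vnext (vnext h)) * rc (vnext h) (vnext (vnext h)) + C' h * rc (vnext h) h) +
     C (vnext (vnext h)) * (C' h * rc (vnext (vnext h)) h +
        C' (vnext h) * rc (vnext (vnext h)) (vnext h)) +
     (C h * C' h * (0 < t h) + C (vnext h) * C' (vnext h) * (0 < t (vnext h)) +
      C (vnext (vnext h)) * C' (vnext (vnext h)) * (0 < t (vnext (vnext h))))) =
    b * (C h * C' h + C (vnext h) * C' (vnext h) + C (vnext (vnext h)) * C' (vnext (vnext h))).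
  transitivity (\sum_(h | vmin lt h) b * (C h * C' h + C (vnext h) * C' (vnext h) +
      C (vnext (vnext h)) * C' (vnext (vnext h)))).
    apply: eq_bigr => h vh; rewrite -bP //; have [-> -> ->] := star h vh.
    rewrite addr0; congr (_ + _); rewrite !sum_star_others !vnextK3.
    rewrite /C /C' /rc /t /d /star_crossing /leftward; ring.
  rewrite -mulr_sumr -(sum_vertices lt_compatible (fun h => C h * C' h)) (sum_edges lt_compatible) big1 ?mulr0 // => h _.
  by rewrite /C /C' edge_mate; case: (_ * _).
have t3 h k l : [&& t h != 0, t k != 0 & t l != 0] by rewrite !t0.
have C0 h : C h + C (vnext h) + C (vnext (vnext h)) = 0 by apply: even_star.
have C'0 h : C' h + C' (vnext h) + C' (vnext (vnext h)) = 0 by apply: even_star.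
have key h1 h2 h3 : [/\ h1 != h2, h2 != h3 & h3 != h1] ->
    origin h1 = origin h2 -> origin h2 = origin h3 -> ccw (d h1) (d h2) (d h3) ->
    C h1 + C h2 + C h3 = 0 -> C' h1 + C' h2 + C' h3 = 0 ->
    C h1 * (C' h2 * rc h1 h2 + C' h3 * rc h1 h3) + C h2 * (C' h3 * rc h2 h3 + C' h1 * rc h2 h1) +
    C h3 * (C' h1 * rc h3 h1 + C' h2 * rc h3 h2) +
    (C h1 * C' h1 * (0 < t h1) + C h2 * C' h2 * (0 < t h2) + C h3 * C' h3 * (0 < t h3))
    = C h1 * C' h2 + C h1 * C' h3 + C h2 * C' h3.
  move=> [h12 h23 h31] o12 o23 ccw_star c0 c'0.
  rewrite /rc (crossV (d h1) (d h3)) (crossV (d h2) (d h1)) (crossV (d h3) (d h2)).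
  apply: (star_parity (t3 _ _ _) ccw_star (lin _ _ _) _ c0 c'0).
  by split; apply: turn; rewrite // -o23.
case: orient => ccw_star; [exists false | exists true] => h vh; have [n1 n2 n3] := star_neq h.
  rewrite mul0r (key h (vnext h) (vnext (vnext h)) _ _ _ (ccw_star h) (C0 h) (C'0 h)) ?origin_vnext //.
    by do 3!case: (_ * _).
  by rewrite n1 n3 eq_sym n2.
have c0 : C (vnext (vnext h)) + C (vnext h) + C h = 0 by rewrite -(C0 h); ring.
have c'0 : C' (vnext (vnext h)) + C' (vnext h) + C' h = 0 by rewrite -(C'0 h); ring.
have sp := key (vnext (vnext h)) (vnext h) h _ _ _ (ccw_star h) c0 c'0.
rewrite mul1r [X in _ + X = _](_ : _ = C (vnext (vnext h)) * C' (vnext h) +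
    C (vnext (vnext h)) * C' h + C (vnext h) * C' h); last first.
  rewrite -sp ?origin_vnext //; first by ring.
  by rewrite n2 eq_sym n3 eq_sym n1.
move: c0 c'0; case: (C (vnext (vnext h))); case: (C (vnext h)); case: (C h) => //=;
  by case: (C' (vnext (vnext h))); case: (C' (vnext h)); case: (C' h).
Qed.
End Intersection.

(** * Crossing exponents and the count of Whitney *)

Section CrossingParity.
Variable G : trivalent_graph.
Local Notation V := (vertex G).
Local Notation H := (half_edge G).
Local Notation E := (edge G).
Implicit Types (h k x y : H).
Variables (lt : rel H) (lt_compatible : compatible_order lt).

Lemma odd_sum (I : finType) (P : pred I) (F : I -> nat) :
  odd (\sum_(i | P i) F i)%N = \sum_(i | P i) odd (F i) :> bool.
Proof. exact: (big_morph odd oddD). Qed.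

Lemma addbb_eq0 (b : bool) : b + b = 0.
Proof. by case: b. Qed.

Lemma lt_asym h k : lt h k -> lt k h = false.
Proof.
move=> hk; apply/negP=> kh; have := lt_trans' lt_compatible hk kh.
by rewrite lt_irr.
Qed.

(** The half-edges at a vertex are consecutive, so that all of them compare in
    the same way with a half-edge at another vertex. *)
Lemma lt_originr h k l : origin l = origin k -> origin h != origin k -> lt h l = lt h k.
Proof.
move=> lk hk; case: lt_compatible => _ _ _ blocks _.
have nhl x : origin x = origin k -> h != x.
  by move=> xk; apply: contraNneq hk => ->; rewrite xk.
apply/idP/idP=> hl; apply/negPn/negP => nl; rewrite -(ltV lt_compatible) ?nhl // in nl.
  by rewrite (blocks k l h) // eqxx in hk.
by rewrite (blocks l k h) // lk eqxx in hk.
Qed.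

Lemma lt_originl h k l : origin l = origin h -> origin h != origin k -> lt l k = lt h k.
Proof.
move=> lh hk; have kh : origin k != origin h by rewrite eq_sym.
have nk x : origin x = origin h -> k != x.
  by move=> xk; apply: contraNneq kh => ->; rewrite xk.
by rewrite (ltV lt_compatible (nk l lh)) (ltV lt_compatible (nk h erefl)) (lt_originr lh kh).
Qed.

Definition crossing_pair x y := [&& lt x y, lt y (mate x) & lt (mate x) (mate y)].

Lemma odd_crossing_exponent (c : E -> nat) :
  odd (crossing_exponent lt c) =
  \sum_(p | crossing_pair p.1 p.2) odd (c (edge_of p.1)) * odd (c (edge_of p.2)) :> bool.
Proof.
by rewrite /crossing_exponent odd_sum; apply: eq_bigr => p _; rewrite oddM.
Qed.

Lemma ends_crossing x y : lt x (mate x) -> lt y (mate y) ->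
  lt x y + lt x (mate y) + lt (mate x) y + lt (mate x) (mate y) =
  crossing_pair x y + crossing_pair y x + (x == y) :> bool.
Proof.
move=> xx yy; have irr := lt_irr lt_compatible.
have tr a b c : lt a b -> lt b c -> lt a c := @lt_trans' _ _ lt_compatible b a c.
have [->|xy] := eqVneq x y.
  by rewrite /crossing_pair irr yy (lt_asym yy) irr.
have xmy : x != mate y.
  by apply/eqP=> e; move: xx; rewrite e mateK lt_asym.
have mxy : mate x != y by rewrite -(inj_eq (@mate_inj G)) mateK.
have mxmy : mate x != mate y by rewrite (inj_eq (@mate_inj G)).
rewrite /crossing_pair (ltV lt_compatible mxy) (ltV lt_compatible xy) (ltV lt_compatible mxmy).
have := tr x y (mate y); have := tr x (mate x) y; have := tr (mate x) y (mate y).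
have := tr x (mate x) (mate y); rewrite xx yy.
case: (lt x y); case: (lt x (mate y)); case: (lt (mate x) y); case: (lt (mate x) (mate y)) => //=;
  by move=> t1 t2 t3 t4; first [by have := t1 isT isT | by have := t2 isT isT
    | by have := t3 isT isT | by have := t4 isT isT].
Qed.

(** The sum of a(h) b(k) over the pairs h < k of half-edges is computed in two
    ways. Gathered by edges, it is the polarization of the crossing exponent,
    up to a diagonal term. *)
Lemma sum_lt_edges (a b : E -> bool) :
  \sum_h \sum_k lt h k * (a (edge_of h) * b (edge_of k)) =
  \sum_(p | crossing_pair p.1 p.2) (a (edge_of p.1) * b (edge_of p.2)
      + a (edge_of p.2) * b (edge_of p.1)) +
  \sum_(h | lt h (mate h)) a (edge_of h) * b (edge_of h).
Proof.
pose ab x y := a (edge_of x) * b (edge_of y).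
transitivity (\sum_(x | lt x (mate x)) \sum_(y | lt y (mate y))
    (crossing_pair x y + crossing_pair y x + (x == y)) * ab x y).
  rewrite (sum_edges lt_compatible); apply: eq_bigr => x xx.
  rewrite !(sum_edges lt_compatible (fun k => _ * _)) -big_split; apply: eq_bigr => y yy /=.
  rewrite -ends_crossing // !edge_mate -/(ab x y).
  by case: (ab x y); case: (lt _ _); case: (lt _ _); case: (lt _ _); case: (lt _ _).
rewrite big_split /=.
have pairE (f : H -> H -> bool) : \sum_(p | crossing_pair p.1 p.2) f p.1 p.2 =
    \sum_(x | lt x (mate x)) \sum_(y | lt y (mate y)) crossing_pair x y * f x y.
  rewrite pair_big /= big_mkcond [RHS]big_mkcond; apply: eq_bigr => -[x y] _ /=.
  case: ifP => [/and3P[xy yx mm]|_]; last by rewrite mul0r if_same.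
  by rewrite (lt_trans' lt_compatible xy yx) (lt_trans' lt_compatible yx mm) mul1r.
have e1 := pairE ab; have e2 := pairE (fun x y => ab y x).
rewrite /ab /= in e1 e2; rewrite {}e1 {}e2 [X in _ + X + _]exchange_big /= -!big_split /=; apply: eq_bigr => x xx.
rewrite -big_split /= -[X in _ + X](_ : \sum_(y | lt y (mate y)) (x == y) * ab x y = _).
  by rewrite -big_split; apply: eq_bigr => y _ /=; rewrite !mulrDl.
rewrite (bigD1 x) //= eqxx mul1r big1 ?addr0 // => y /andP[_ yx].
by rewrite eq_sym (negbTE yx) mul0r.
Qed.

(** Gathered by vertices, the sum over h < k reduces to the pairs at the same
    vertex: the half-edges at another vertex all compare in the same way with
    h, and b sums to zero over them. *)
Lemma sum_lt_vertices (a b : E -> bool) : even_at_vertices b ->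
  \sum_h \sum_k lt h k * (a (edge_of h) * b (edge_of k)) =
  \sum_h \sum_(k | (origin k == origin h) && lt h k) a (edge_of h) * b (edge_of k).
Proof.
move=> b_even; apply: eq_bigr => h _.
rewrite (bigID (fun k => origin k == origin h)) /= [X in _ + X](_ : _ = 0) ?addr0.
  rewrite big_mkcondr; apply: eq_bigr => k _.
  by case: (lt h k); rewrite ?mul1r ?mul0r.
rewrite (partition_big (@origin G) (fun v => v != origin h)) //=; apply: big1 => v vh.
have [k0 /eqP k0v|no_k] := pickP [pred k | origin k == v]; last first.
  by rewrite big_pred0 // => k; have := no_k k; rewrite /= => ->; rewrite andbF.
transitivity (\sum_(k : H | origin k == v) lt h k0 * a (edge_of h) * b (edge_of k)).
  apply: eq_big => [k|k /andP[_ /eqP kv]].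
    by apply: andb_idl => /eqP->.
  rewrite mulrA; congr (_ * _ * _).
  by apply: lt_originr; rewrite ?kv k0v // eq_sym.
by rewrite -mulr_sumr b_even mulr0.
Qed.

(** The crossing exponent is a quadratic form modulo 2. It is additive on the
    cycles of a plane graph because its polarization is the number of
    crossings of two cycles. *)
Lemma odd_crossing_exponentD (R : realType) (c c' : E -> nat) :
    planar G R -> even_at_vertices (fun e => odd (c e)) ->
    even_at_vertices (fun e => odd (c' e)) ->
  odd (crossing_exponent lt (fun e => c e + c' e)%N) =
  odd (crossing_exponent lt c) + odd (crossing_exponent lt c') :> bool.
Proof.
move=> G_planar c_even c'_even.
have := planar_parity lt_compatible G_planar c_even c'_even.
rewrite -(sum_lt_vertices (fun e => odd (c e)) c'_even).
rewrite (sum_lt_edges (fun e => odd (c e)) (fun e => odd (c' e))) -addrA.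
rewrite addbb_eq0 addr0.
rewrite !odd_crossing_exponent => pol.
rewrite -[RHS]addr0 -[X in _ = _ + X]pol -!big_split; apply: eq_bigr => p _ /=; rewrite !oddD.
by case: (odd _); case: (odd _); case: (odd _); case: (odd _).
Qed.

Section Curve.
Variables (S : {set H}) (s : {perm H}).
Hypothesis s_on : perm_on S s.
Hypothesis s_turn : forall h, h \in S -> origin (s h) = origin (mate h) /\ s h != mate h.

(** The ends of passages along the line of the half-edges: every half-edge is
    doubled, with the outgoing end first, as in [next_end]. *)
Definition end_lt (p q : H * bool) : bool :=
  lt p.1 q.1 || (p.1 == q.1) && (p.2 && ~~ q.2).

Lemma end_ltV p q : p != q -> end_lt q p = ~~ end_lt p q.
Proof.
case: p q => [h b] [k b']; rewrite /end_lt /= => pq.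
have [hk|hk] := eqVneq h k; last by rewrite !orbF -(ltV lt_compatible) // orbF.
by move: pq; rewrite hk lt_irr //=; case: b; case: b'; rewrite ?eqxx.
Qed.

Definition leave h : H * bool := (h, true).
Definition arrive h : H * bool := (mate h, false).

(** For four distinct ends, whether the chords pq and rt cross when they are
    drawn on the same side of the line. *)
Definition interlace p q r t : bool := end_lt p r + end_lt p t + end_lt q r + end_lt q t.

Lemma interlaceC p q r t : [&& p != r, p != t, q != r & q != t] ->
  interlace p q r t = interlace r t p q.
Proof.
case/and4P=> pr pt qr qt; rewrite /interlace (end_ltV pr) (end_ltV pt) (end_ltV qr) (end_ltV qt).
by case: (end_lt p r); case: (end_lt p t); case: (end_lt q r); case: (end_lt q t).
Qed.

(** A curve has a diagram in which the darts are chords on one side of the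
    line of ends and the turns are chords on the other side. *)
Definition dart_crossing h k := interlace (leave h) (arrive h) (leave k) (arrive k).
Definition turn_crossing h k := interlace (arrive h) (leave (s h)) (arrive k) (leave (s k)).

Lemma leave_arrive h k : leave h != arrive k.
Proof. by rewrite /leave /arrive xpair_eqE andbF. Qed.

Lemma arrive_leave h k : arrive h != leave k.
Proof. by rewrite eq_sym leave_arrive. Qed.

Lemma leave_eq h k : (leave h == leave k) = (h == k).
Proof. by rewrite /leave xpair_eqE eqxx andbT. Qed.

Lemma arrive_eq h k : (arrive h == arrive k) = (h == k).
Proof. by rewrite /arrive xpair_eqE eqxx andbT (inj_eq (@mate_inj G)). Qed.

Lemma dart_crossingC h k : dart_crossing h k = dart_crossing k h.
Proof.
have [->//|hk] := eqVneq h k; apply: interlaceC.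
by rewrite leave_eq hk leave_arrive arrive_leave arrive_eq.
Qed.

Lemma turn_crossingC h k : turn_crossing h k = turn_crossing k h.
Proof.
have [->//|hk] := eqVneq h k; apply: interlaceC.
by rewrite arrive_eq hk arrive_leave leave_arrive leave_eq (inj_eq perm_inj) hk.
Qed.

Lemma sum_ordered_pairs (w : H -> H -> bool) (P : pred H) :
  \sum_(p | lt p.1 p.2 && (P p.1 && P p.2)) (w p.1 p.2 + w p.2 p.1) =
  \sum_(h | P h) \sum_(k | P k) w h k + \sum_(h | P h) w h h.
Proof.
rewrite pair_big_dep /= big_split /=.
have swapK : involutive (fun p : H * H => (p.2, p.1)) by case.
rewrite [X in _ + X](reindex_inj (inv_inj swapK)) /=.
rewrite [X in _ = _ + X](_ : _ = \sum_(p : H * H | (P p.1 && P p.2) && (p.1 == p.2)) w p.1 p.2).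
  rewrite big_mkcond [X in _ + X]big_mkcond [X in _ = X + _]big_mkcond [X in _ = _ + X]big_mkcond.
  rewrite -!big_split /=; apply: eq_bigr => -[h k] _ /=; case: (P h); case: (P k); rewrite ?andbF ?andbT //=.
  have [->|hk] := eqVneq h k; first by rewrite lt_irr //; case: (w _ _).
  by rewrite (ltV lt_compatible hk); case: (lt h k); case: (w _ _).
under [RHS]eq_bigl => p do rewrite -andbA.
rewrite -(pair_big_dep P (fun h k => P k && (h == k)) w) /=; apply: eq_bigr => h Ph.
by rewrite (bigD1 h) ?Ph ?eqxx //= big1 ?addr0 // => k /andP[/andP[_ /eqP->]]; rewrite eqxx.
Qed.

(** A form of Whitney's count of the crossings of a closed curve. In the sum
    of the crossings on the two sides of the line, the comparisons of two
    arrivals cancel, those of two departures give the inversions of s, and the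
    mixed ones cancel except for a dart or a turn with itself. *)
Lemma rotation_parity :
  \sum_(p | lt p.1 p.2 && ((p.1 \in S) && (p.2 \in S)))
     (dart_crossing p.1 p.2 + turn_crossing p.1 p.2) =
  odd_perm s + \sum_(h in S) (lt h (mate h) + lt (s h) (mate h)) :> bool.
Proof.
pose w h k : bool := end_lt (leave h) (arrive k) + end_lt (leave (s h)) (arrive k).
transitivity (\sum_(p | lt p.1 p.2 && ((p.1 \in S) && (p.2 \in S)))
    ((lt p.1 p.2 + lt (s p.1) (s p.2)) + (w p.1 p.2 + w p.2 p.1))).
  apply: eq_bigr => -[h k] /= /andP[lhk _]; have hk : h != k by apply: contraTneq lhk => ->; rewrite lt_irr.
  rewrite /dart_crossing /turn_crossing /interlace /w.
  rewrite (end_ltV (leave_arrive k h)) (end_ltV (leave_arrive (s k) h)).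
  have lE x y : end_lt (leave x) (leave y) = lt x y by rewrite /end_lt /= andbF orbF.
  rewrite !lE; case: (end_lt (leave h) (arrive k)); case: (end_lt (leave k) (arrive h));
    case: (end_lt (leave (s h)) (arrive k)); case: (end_lt (leave (s k)) (arrive h));
    by case: (end_lt (arrive h) (arrive k)); case: (lt h k); case: (lt (s h) (s k)).
rewrite big_split -(odd_perm_inversions_on (lt_tournament lt_compatible) s_on) /=.
congr (_ + _); rewrite (sum_ordered_pairs w (mem S)) /=.
rewrite [X in X + _](_ : _ = 0) ?add0r.
  apply: eq_bigr => h /s_turn[_ sm]; rewrite /w /end_lt /= andbT.
  by rewrite eq_sym (negbTE (mate_neq h)) (negbTE sm) !orbF.
under eq_bigr => h _ do rewrite big_split.
rewrite big_split /= [X in _ + X](_ : _ = \sum_(h in S) \sum_(k in S) end_lt (leave h) (arrive k)).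
  exact: addbb_eq0.
rewrite [RHS](reindex_inj (@perm_inj _ s)) /=; apply: eq_bigl => h.
by rewrite (perm_closed _ s_on).
Qed.

Definition edge_multiplicity (e : E) : nat := \sum_(h : H | edge_of h == e) (h \in S).

Lemma edge_multiplicityE h : edge_multiplicity (edge_of h) = ((h \in S) + (mate h \in S))%N.
Proof. exact: sum_ends. Qed.

Lemma dart_crossingE h k : edge_of h != edge_of k ->
  dart_crossing h k = lt h k + lt h (mate k) + lt (mate h) k + lt (mate h) (mate k).
Proof.
move=> hk; rewrite /dart_crossing /interlace /end_lt /= !andbF !orbF andbT.
have -> : (h == mate k) = false by apply: contraNF hk => /eqP->; rewrite edge_mate.
by rewrite orbF.
Qed.

Lemma dart_crossing_mate h : dart_crossing h (mate h) = 0.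
Proof.
rewrite /dart_crossing /interlace /end_lt /= mateK !eqxx /= !andbF !orbF !lt_irr //=.
have hm := mate_neq h; rewrite (ltV lt_compatible hm); by case: (lt _ _).
Qed.

(** The two darts of an edge do not cross, and the darts of two different
    edges cross when the edges do. *)
Lemma sum_dart_crossings :
  \sum_(p | lt p.1 p.2 && ((p.1 \in S) && (p.2 \in S))) dart_crossing p.1 p.2 =
  odd (crossing_exponent lt edge_multiplicity) :> bool.
Proof.
pose lo h := if lt h (mate h) then h else mate h.
have lo_ends h : (lo h == h) || (lo h == mate h) by rewrite /lo; case: ifP; rewrite eqxx ?orbT.
have lo_mate h : lo (mate h) = lo h.
  by rewrite /lo mateK (ltV lt_compatible (mate_neq h)); case: (lt _ h).
have lo_edge h : edge_of (lo h) = edge_of h.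
  by case/orP: (lo_ends h) => /eqP->; rewrite ?edge_mate.
have lo_id h : lt h (mate h) -> lo h = h by rewrite /lo => ->.
pose r h k := if lo h == lo k then lt h k else lt (lo h) (lo k).
have r_tour : tournament r.
  split=> [h|h k hk]; rewrite /r ?eqxx ?lt_irr // eq_sym.
  by case: eqVneq => lhk; rewrite (ltV lt_compatible).
pose f h k : bool := (h \in S) * (k \in S) * dart_crossing h k.
have fC h k : f h k = f k h by rewrite /f dart_crossingC [(h \in S) * _]mulrC.
transitivity (\sum_(p | lt p.1 p.2) f p.1 p.2).
  rewrite big_mkcondr; apply: eq_bigr => p _; rewrite /f.
  by case: (_ \in _); case: (_ \in _); rewrite ?mul1r ?mul0r.
rewrite (pair_sum_order (lt_tournament lt_compatible) r_tour fC).
rewrite odd_crossing_exponent.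
pose m x : bool := odd (edge_multiplicity (edge_of x)).
transitivity (\sum_(x | lt x (mate x)) \sum_(y | lt y (mate y)) crossing_pair x y * (m x * m y)).
  transitivity (\sum_h \sum_k r h k * f h k).
    rewrite pair_big /= big_mkcond; apply: eq_bigr => p _.
    by case: (r _ _); rewrite ?mul1r ?mul0r.
  rewrite (sum_edges lt_compatible); apply: eq_bigr => x xx.
  rewrite !(sum_edges lt_compatible (fun k => _ * f _ _)) -big_split; apply: eq_bigr => y yy /=.
  have mE z : m z = (z \in S) + (mate z \in S) by rewrite /m edge_multiplicityE oddD !oddb.
  rewrite !mE; have [<-|xy] := eqVneq x y.
    have -> : crossing_pair x x = 0 by rewrite /crossing_pair lt_irr.
    have fxm : f x (mate x) = 0 by rewrite /f dart_crossing_mate mulr0.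
    have r0 z : r z z = 0 by rewrite /r eqxx lt_irr.
    by rewrite !r0 [f (mate x) x]fC fxm !mulr0 !mul0r.
  have exy : edge_of x != edge_of y.
    apply: contra xy => /eqP/esym/ends_cases/orP[/eqP->//|/eqP yE].
    by rewrite yE mateK lt_asym in yy.
  have lxy : (lo x == lo y) = false.
    by apply: contraNF exy => /eqP e; rewrite -lo_edge e lo_edge.
  rewrite /r !lo_mate lxy !lo_id // /f !dart_crossingE ?edge_mate // !mateK.
  have <- : lt x y * (lt x y + lt x (mate y) + lt (mate x) y + lt (mate x) (mate y)) =
      crossing_pair x y.
    rewrite ends_crossing // (negbTE xy) /crossing_pair (ltV lt_compatible xy).
    by case: (lt x y) => //=; rewrite ?mul1r ?addr0.
  by ring.
rewrite pair_big /= big_mkcond [RHS]big_mkcond; apply: eq_bigr => -[x y] _ /=.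
case: ifP => [/andP[xx yy]|nxy].
  by case: (crossing_pair _ _); rewrite ?mul1r ?mul0r.
case: ifP => // /and3P[xy yx mm].
by rewrite (lt_trans' lt_compatible xy yx) (lt_trans' lt_compatible yx mm) in nxy.
Qed.

(** A curve leaves a vertex as many times as it arrives there. *)
Lemma even_edge_multiplicity : even_at_vertices (fun e => odd (edge_multiplicity e)).
Proof.
move=> v; under eq_bigr => h _ do rewrite edge_multiplicityE oddD.
rewrite big_split /= [X in _ + X](_ : _ = \sum_(h : H | origin h == v) odd (h \in S)).
  exact: addbb_eq0.
rewrite [LHS](reindex_inj (@mate_inj G)) [RHS](reindex_inj (@perm_inj _ s)) /=.
rewrite big_mkcond [RHS]big_mkcond; apply: eq_bigr => h _ /=.
rewrite mateK (perm_closed _ s_on).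
have [hS|hS] := boolP (h \in S); last by rewrite !if_same.
by have [-> _] := s_turn hS.
Qed.

End Curve.
End CrossingParity.

(** * Crossings of a curve *)

Lemma index_rot (T : eqType) (s : seq T) x y : uniq s -> x \in s -> y \in s ->
  index y (rot (index x s) s) = ((index y s + (size s - index x s)) %% size s)%N.
Proof.
move=> s_uniq xs ys; set i := index x s; set j := index y s.
have i_lt : (i < size s)%N by rewrite index_mem.
have j_lt : (j < size s)%N by rewrite index_mem.
have yE : nth y s j = y by rewrite nth_index.
pose k := if (i <= j)%N then (j - i)%N else (size s - i + j)%N.
have k_lt : (k < size s)%N.
  by rewrite /k; case: (leqP i j) => ij; lia.
have nth_k : nth y (rot i s) k = y.
  rewrite /rot nth_cat size_drop /k; case: (leqP i j) => ij.
    by rewrite ifT; [rewrite nth_drop subnKC | lia].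
  by rewrite ifF; [rewrite addKn nth_take | lia].
rewrite -{1}nth_k index_uniq ?size_rot ?rot_uniq // /k.
case: (leqP i j) => ij; last by rewrite modn_small; lia.
have -> : (j + (size s - i) = j - i + size s)%N by lia.
by rewrite modnDr modn_small; lia.
Qed.

(** Whether two chords of a circle cross can be tested from any starting
    point; the six points are the ends of passages around a vertex. *)
Lemma cyclic_interlace (a b c d : nat) : (a < 6)%N -> (b < 6)%N -> (c < 6)%N -> (d < 6)%N ->
    [&& a != b, a != c, a != d, b != c & b != d] ->
  ((((c + (6 - a)) %% 6 < (b + (6 - a)) %% 6) != ((d + (6 - a)) %% 6 < (b + (6 - a)) %% 6))%N : bool)
  = (a < c)%N + (a < d)%N + (b < c)%N + (b < d)%N.
Proof.
pose test := all (fun a => all (fun b => all (fun c => all (fun d =>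
  [&& a != b, a != c, a != d, b != c & b != d]%N ==>
  ((((c + (6 - a)) %% 6 < (b + (6 - a)) %% 6) != ((d + (6 - a)) %% 6 < (b + (6 - a)) %% 6))
  == (a < c) (+) (a < d) (+) (b < c) (+) (b < d))%N) (iota 0 6)) (iota 0 6)) (iota 0 6)) (iota 0 6).
have : test by vm_compute.
move=> /allP t a6 b6 c6 d6 neq.
have /allP{}t := t a (etrans (mem_iota 0 6 a) a6); have /allP{}t := t b (etrans (mem_iota 0 6 b) b6).
have /allP{}t := t c (etrans (mem_iota 0 6 c) c6); have {t} := t d (etrans (mem_iota 0 6 d) d6).
by move/implyP/(_ neq)/eqP.
Qed.

Section CurveCrossings.
Variable G : trivalent_graph.
Local Notation H := (half_edge G).
Implicit Types (h k x y : H).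
Variables (lt : rel H) (lt_compatible : compatible_order lt).
Local Notation end_lt := (end_lt lt).

Lemma end_lt_trans : transitive end_lt.
Proof.
move=> [k b2] [h b1] [l b3]; rewrite /end_lt /=.
case/orP=> [hk|/andP[/eqP-> /andP[h1 h2]]]; case/orP=> [kl|/andP[/eqP kE /andP[h3 h4]]].
- by rewrite (lt_trans' lt_compatible hk kl).
- by rewrite -kE hk.
- by rewrite kl.
- by rewrite h3 in h2.
Qed.

Definition star_ends h : seq (H * bool) :=
  [:: (h, true); (h, false); (vnext h, true); (vnext h, false);
      (vnext (vnext h), true); (vnext (vnext h), false)].

(** From the least half-edge of a vertex on, the cyclic order of the ends is
    their linear order. *)
Lemma star_ends_sorted h : vmin lt h -> sorted end_lt (star_ends h).
Proof.
by case/andP=> h1 h2; rewrite /= /end_lt /= h1 h2 !eqxx !orbT.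
Qed.

Lemma end_lt_irr : irreflexive end_lt.
Proof. by case=> h b; rewrite /end_lt /= lt_irr // eqxx /=; case: b. Qed.

Lemma star_ends_uniq h : vmin lt h -> uniq (star_ends h).
Proof. by move/star_ends_sorted; apply: sorted_uniq; [exact: end_lt_trans | exact: end_lt_irr]. Qed.

Lemma star_ends_cycle h : fcycle (@next_end G) (star_ends h).
Proof. by rewrite /= /next_end /= vnextK3 !eqxx. Qed.

Lemma end_lt_index h p q : vmin lt h -> p \in star_ends h -> q \in star_ends h ->
  end_lt p q = (index p (star_ends h) < index q (star_ends h))%N.
Proof.
move=> vh pin qin; have lt_idx := sorted_ltn_index end_lt_trans (star_ends_sorted vh).
case: ltngtP => [/(lt_idx _ _ pin qin)//|/(lt_idx _ _ qin pin) qp|].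
  by apply/negP=> pq; have := end_lt_trans pq qp; rewrite end_lt_irr.
by move=> e; rewrite -[p](nth_index p pin) e nth_index // end_lt_irr.
Qed.

Lemma findex_next_end h p q : vmin lt h -> p \in star_ends h -> q \in star_ends h ->
  findex (@next_end G) p q =
  ((index q (star_ends h) + (6 - index p (star_ends h))) %% 6)%N.
Proof.
move=> vh pin qin; rewrite /findex (fingraph.orbitE (star_ends_cycle h) (star_ends_uniq vh) pin).
by rewrite index_rot // star_ends_uniq.
Qed.

Lemma star_ends_mem h k b : origin k = origin h -> (k, b) \in star_ends h.
Proof.
by move/star_cases; rewrite !inE !xpair_eqE; case/or3P=> ->; case: b; rewrite ?orbT.
Qed.

Lemma vmin_exists h : exists2 k, vmin lt k & origin k = origin h.
Proof.
have := star_order lt_compatible h; rewrite /= => /or3P[]/and3P[x y z].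
- by exists h; rewrite /vmin ?x ?y.
- by exists (vnext h); rewrite ?origin_vnext // /vmin y vnextK3 z.
- by exists (vnext (vnext h)); rewrite ?origin_vnext // /vmin vnextK3 z x.
Qed.

Lemma chords_crossE (p q r t : H * bool) :
    origin q.1 = origin p.1 -> origin r.1 = origin p.1 -> origin t.1 = origin p.1 ->
    [&& p != q, p != r, p != t, q != r & q != t] ->
  chords_cross p q r t = interlace lt p q r t.
Proof.
move=> oq or ot neq; have [h vh ho] := vmin_exists p.1.
have mem (x : H * bool) : origin x.1 = origin p.1 -> x \in star_ends h.
  by case: x => k b /= kp; apply: star_ends_mem; rewrite kp ho.
have [pin qin rin tin] := And4 (mem p erefl) (mem q oq) (mem r or) (mem t ot).
rewrite /chords_cross !(findex_next_end vh) // /interlace !(end_lt_index vh) //.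
have six (x : H * bool) : x \in star_ends h -> (index x (star_ends h) < 6)%N by rewrite -index_mem.
apply: cyclic_interlace; rewrite ?six //.
have idx_eq (x y : H * bool) : x \in star_ends h -> y \in star_ends h ->
    (index x (star_ends h) == index y (star_ends h)) = (x == y).
  by move=> xin yin; apply/eqP/eqP => [e|->//]; rewrite -[x](nth_index x xin) e nth_index.
by rewrite !idx_eq.
Qed.

Variables (g : curve G) (S : {set H}) (s : {perm H}).
Hypothesis s_on : perm_on S s.
Hypothesis s_turn : forall h, h \in S -> origin (s h) = origin (mate h) /\ s h != mate h.
Hypothesis gE : forall h, val g h = if h \in S then Some (s h) else None.

Lemma turns_crossE h k : h != k ->
  turns_cross g h k = (h \in S) * (k \in S) * turn_crossing lt s h k.
Proof.
move=> hk; rewrite /turns_cross !gE; case: (boolP (h \in S)) => hS /=; last by rewrite !mul0r.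
case: (boolP (k \in S)) => kS /=; last by rewrite mul0r.
rewrite [X in _ = X](_ : _ = turn_crossing lt s h k); last by case: (turn_crossing _ _ _ _).
have [os ns] := s_turn hS; have [ok nk] := s_turn kS.
have [e|ne] := eqVneq (origin (mate h)) (origin (mate k)).
  apply: chords_crossE; rewrite ?os ?ok //=.
  by rewrite !arrive_leave !leave_arrive arrive_eq leave_eq (inj_eq perm_inj) hk.
have -> : turn_crossing lt s h k = 0; last by [].
have lt_const x y : origin x = origin (mate h) -> origin y = origin (mate k) ->
    lt x y = lt (mate h) (mate k).
  move=> xh yk; rewrite (lt_originr lt_compatible yk) ?xh //.
  exact: (lt_originl lt_compatible).
have end_const (p q : H * bool) : origin p.1 = origin (mate h) -> origin q.1 = origin (mate k) ->
    end_lt p q = lt (mate h) (mate k).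
  move=> ph qk; rewrite /end_lt lt_const //; case: eqP => [e|]; last by rewrite orbF.
  by rewrite -ph e qk eqxx in ne.
by rewrite /turn_crossing /interlace !end_const //; case: (lt _ _).
Qed.

Lemma odd_crossings :
  odd (crossings g) =
  \sum_(p | lt p.1 p.2 && ((p.1 \in S) && (p.2 \in S))) turn_crossing lt s p.1 p.2.
Proof.
rewrite /crossings -sum1_card odd_sum /=.
pose f h k : bool := (h \in S) * (k \in S) * turn_crossing lt s h k.
have fC h k : f h k = f k h by rewrite /f turn_crossingC // [(h \in S) * _]mulrC.
pose r := [rel h k : H | (enum_rank h < enum_rank k)%N].
have r_tour : tournament r.
  split=> [h|h k hk] /=; first exact: ltnn.
  rewrite -leqNgt ltn_neqAle; case: eqP => [/ord_inj/enum_rank_inj e|//].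
  by rewrite e eqxx in hk.
transitivity (\sum_(p | r p.1 p.2) f p.1 p.2).
  rewrite big_mkcond [RHS]big_mkcond; apply: eq_bigr => -[h k] _ /=; rewrite inE /=.
  case: ltnP => //= hk; rewrite turns_crossE -/(f h k); first by case: (f h k).
  by apply: contraTneq hk => ->; rewrite ltnn.
rewrite (pair_sum_order r_tour (lt_tournament lt_compatible) fC) [RHS]big_mkcondr.
by apply: eq_bigr => p _; rewrite /f; case: (_ \in _); case: (_ \in _); rewrite ?mul1r ?mul0r.
Qed.

(** The crossings of the immersion are those of the turns, while the crossing
    exponent of the edges counts those of the darts; [rotation_parity] gives
    the sum of both. *)
Lemma curve_sign_parity :
  odd (crossings g) =
  odd (crossing_exponent lt (edge_multiplicity S)) + odd_perm s +
  \sum_(h in S) (lt h (mate h) + lt (s h) (mate h)) :> bool.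
Proof.
rewrite odd_crossings -(sum_dart_crossings lt_compatible).
rewrite -addrA -(rotation_parity lt_compatible s_on s_turn).
rewrite -big_split; apply: eq_bigr => p _ /=.
by case: (dart_crossing _ _ _); case: (turn_crossing _ _ _ _).
Qed.
End CurveCrossings.

(** * Polynomials and exponents *)

Section Polynomials.
Variables (K : comNzRingType) (n : nat).
Implicit Types (p q : {mpoly K[n]}) (m : 'X_{1..n}).

Lemma mcoeff_monomialM p m' m :
  ('X_[m'] * p)@_m = if (m' <= m)%MM then p@_(m - m') else 0.
Proof.
rewrite mulrC; case: ifPn => le_m; first by rewrite -{1}(submK le_m) addmC mcoeffMX.
apply: memN_msupp_eq0; apply: contra le_m; rewrite (perm_mem (msuppMX _ _)).
by case/mapP=> m1 _ ->; apply: lem_addr.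
Qed.

Lemma mcoeffXM p i m :
  ('X_i * p)@_m = if (0 < m i)%N then p@_(m - U_(i)) else 0.
Proof. by rewrite mcoeff_monomialM lep1mP lt0n. Qed.

Definition homogeneous (f : 'X_{1..n} -> nat) (d : nat) p :=
  forall m, m \in msupp p -> f m = d.

Lemma homogeneous1 f : f 0%MM = 0%N -> homogeneous f 0 1.
Proof. by move=> f0 m; rewrite msupp1 inE => /eqP->. Qed.

Lemma homogeneousM f d e p q : {morph f : m m' / (m + m')%MM >-> (m + m')%N} ->
  homogeneous f d p -> homogeneous f e q -> homogeneous f (d + e) (p * q).
Proof.
move=> fD hp hq m /msuppM_le /allpairsP[[m1 m2] /= [/hp <- /hq <- ->]].
exact: fD.
Qed.

Lemma homogeneousX f d p k : f 0%MM = 0%N -> {morph f : m m' / (m + m')%MM >-> (m + m')%N} ->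
  homogeneous f d p -> homogeneous f (k * d) (p ^+ k).
Proof.
move=> f0 fD hp; elim: k => [|k IHk]; first exact: homogeneous1.
by rewrite exprS mulSn; apply: homogeneousM.
Qed.

Lemma homogeneousZ f d a p : homogeneous f d p -> homogeneous f d (a *: p).
Proof. by move=> hp m /msuppZ_le /hp. Qed.

Lemma homogeneousD f d p q :
  homogeneous f d p -> homogeneous f d q -> homogeneous f d (p + q).
Proof. by move=> hp hq m /msuppD_le; rewrite mem_cat => /orP[/hp|/hq]. Qed.

Lemma homogeneous_prod (I : finType) f (d : I -> nat) (p : I -> {mpoly K[n]}) :
    f 0%MM = 0%N -> {morph f : m m' / (m + m')%MM >-> (m + m')%N} ->
    (forall i, homogeneous f (d i) (p i)) ->
  homogeneous f (\sum_i d i) (\prod_i p i).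
Proof.
move=> f0 fD hp; elim/big_rec2: _ => [|i e q _ hq]; first exact: homogeneous1.
exact: homogeneousM.
Qed.

Lemma mderiv_prod (I : finType) (p : I -> {mpoly K[n]}) x :
  (\prod_i p i)^`M(x) = \sum_i (p i)^`M(x) * \prod_(j | j != i) p j.
Proof.
suff H : forall s : seq I, uniq s -> (\prod_(i <- s) p i)^`M(x) =
    \sum_(i <- s) (p i)^`M(x) * \prod_(j <- s | j != i) p j.
  by rewrite -big_enum H ?enum_uniq // big_enum; apply: eq_bigr => i _; rewrite big_enum_cond.
elim=> [|i s IHs] /=; first by rewrite !big_nil mderivC.
case/andP=> i_s s_uniq; rewrite !big_cons mderivM IHs // eqxx; congr (_ * _ + _).
  by rewrite big_seq [RHS]big_seq_cond; apply: eq_bigl => j; case: eqVneq => [->|]; rewrite ?andbT // (negbTE i_s).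
rewrite mulr_sumr big_seq [RHS]big_seq; apply: eq_bigr => j js.
have ij : i != j by apply: contraNneq i_s => ->.
by rewrite big_cons ij mulrCA.
Qed.
End Polynomials.

Section Exponents.
Variable T : finType.
Implicit Types (a b : {ffun T -> nat}) (S : {set T}).

Definition expo_nat d (a : {ffun T -> 'I_d}) : {ffun T -> nat} := [ffun h => a h : nat].
Definition expo_add a S : {ffun T -> nat} := [ffun h => (a h + (h \in S))%N].
Definition expo_sub a S : {ffun T -> nat} := [ffun h => (a h - (h \in S))%N].

Lemma expo_subK a S : (forall h, h \in S -> (0 < a h)%N) -> expo_add (expo_sub a S) S = a.
Proof.
move=> pos; apply/ffunP=> h; rewrite !ffunE; case: (boolP (h \in S)) => [/pos|]; lia.
Qed.

Lemma expo_addK a S : expo_sub (expo_add a S) S = a.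
Proof. by apply/ffunP=> h; rewrite !ffunE; lia. Qed.

Lemma sum_expo_add (W : nmodType) d S (f : {ffun T -> nat} -> W) :
    (forall a h, (d < a h)%N -> f a = 0) ->
  \sum_(a : {ffun T -> 'I_d.+1}) f (expo_add (expo_nat a) S) =
  \sum_(b : {ffun T -> 'I_d.+1} | [forall h in S, (0 < b h)%N]) f (expo_nat b).
Proof.
move=> f0; rewrite (bigID (fun a : {ffun T -> 'I_d.+1} => [forall h, (a h + (h \in S) < d.+1)%N])) /=.
rewrite [X in _ + X]big1 ?addr0 => [|a]; last first.
  rewrite negb_forall => /existsP[h]; rewrite -leqNgt => ah.
  by apply: (f0 _ h); rewrite !ffunE.
rewrite [RHS](reindex_onto (fun a : {ffun T -> 'I_d.+1} => [ffun h => inord (a h + (h \in S))])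
  (fun b : {ffun T -> 'I_d.+1} => [ffun h => inord (b h - (h \in S))])) /=; last first.
  move=> b /forall_inP pos; apply/ffunP=> h; rewrite !ffunE; apply: val_inj => /=.
  have bh := ltn_ord (b h); case: (boolP (h \in S)) => [/pos|] hS.
    by rewrite !inordK; lia.
  by rewrite !inordK; lia.
apply: eq_big => [a|a /forallP ad]; last first.
  by congr f; apply/ffunP=> h; rewrite !ffunE inordK.
apply/idP/andP => [/forallP ad|[/forall_inP pos /eqP/ffunP e]].
  split; first by apply/forall_inP=> h hS; rewrite ffunE inordK // hS addn1.
  apply/eqP/ffunP=> h; rewrite !ffunE; apply: val_inj; rewrite /= inordK ?inordK ?addnK //.
apply/forallP=> h; have := e h; rewrite !ffunE => /(congr1 val) /=.
have ah := ltn_ord (a h).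
have [|ad] := ltnP (a h + (h \in S)) d.+1; first by [].
have hS : h \in S by move: ad; case: (h \in S); lia.
by move=> _; have := pos h hS; rewrite ffunE /inord val_insubd ifN // -leqNgt.
Qed.
End Exponents.

(** * Coefficients of products of angle forms *)

Section AngleAlgebra.
Variable G : trivalent_graph.
Local Notation V := (vertex G).
Local Notation H := (half_edge G).
Local Notation E := (edge G).
Implicit Types (h j k l : H).
Variable lt : rel H.
Local Notation expo := {ffun H -> nat}.
Implicit Types (a b N : expo).

(** The exponent of the monomial z^b w^a. *)
Definition mu b a : 'X_{1..#|H| + #|H|} :=
  [multinom match split i with inl i1 => b (enum_val i1) | inr i2 => a (enum_val i2) end
     | i < #|H| + #|H|].

Lemma mu_z b a h : mu b a (z_idx h) = b h.
Proof.
have split_z : split (lshift #|H| (enum_rank h)) = inl (enum_rank h) := unsplitK (inl _).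
by rewrite mnmE split_z enum_rankK.
Qed.

Lemma mu_w b a h : mu b a (w_idx h) = a h.
Proof.
have split_w : split (rshift #|H| (enum_rank h)) = inr (enum_rank h) := unsplitK (inr _).
by rewrite mnmE split_w enum_rankK.
Qed.

Lemma idx_ind (P : 'I_(#|H| + #|H|) -> Prop) :
  (forall h, P (z_idx h)) -> (forall h, P (w_idx h)) -> forall i, P i.
Proof.
move=> Pz Pw i; rewrite -(splitK i); case: (split i) => j /=.
  by have := Pz (enum_val j); rewrite /z_idx enum_valK.
by have := Pw (enum_val j); rewrite /w_idx enum_valK.
Qed.

Lemma z_idx_eq h k : (z_idx h == z_idx k) = (h == k).
Proof. by rewrite (inj_eq (@lshift_inj _ _)) (inj_eq enum_rank_inj). Qed.

Lemma w_idx_eq h k : (w_idx h == w_idx k) = (h == k).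
Proof. by rewrite (inj_eq (@rshift_inj _ _)) (inj_eq enum_rank_inj). Qed.

Lemma zw_idx_neq h k : (z_idx h == w_idx k) = false.
Proof. by apply: eq_lrshift. Qed.

Lemma wz_idx_neq h k : (w_idx h == z_idx k) = false.
Proof. by rewrite eq_sym zw_idx_neq. Qed.

Lemma mu_addz b a h : (mu b a + U_(z_idx h))%MM = mu (expo_add b [set h]) a.
Proof.
apply/mnmP; apply: idx_ind => k; rewrite mnmDE mnm1E ?mu_z ?mu_w ?z_idx_eq ?zw_idx_neq ?addn0 //.
by rewrite ffunE inE eq_sym.
Qed.

Lemma mu_addw b a h : (mu b a + U_(w_idx h))%MM = mu b (expo_add a [set h]).
Proof.
apply/mnmP; apply: idx_ind => k; rewrite mnmDE mnm1E ?mu_z ?mu_w ?w_idx_eq ?wz_idx_neq ?addn0 //.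
by rewrite ffunE inE eq_sym.
Qed.

Lemma mu_subz b a h : (mu b a - U_(z_idx h))%MM = mu (expo_sub b [set h]) a.
Proof.
apply/mnmP; apply: idx_ind => k; rewrite mnmBE mnm1E ?mu_z ?mu_w ?z_idx_eq ?zw_idx_neq ?subn0 //.
by rewrite ffunE inE eq_sym.
Qed.

Lemma mu_subw b a h : (mu b a - U_(w_idx h))%MM = mu b (expo_sub a [set h]).
Proof.
apply/mnmP; apply: idx_ind => k; rewrite mnmBE mnm1E ?mu_z ?mu_w ?w_idx_eq ?wz_idx_neq ?subn0 //.
by rewrite ffunE inE eq_sym.
Qed.

Variables (K : numFieldType) (t : H -> K).
Local Notation poly2 := {mpoly K[#|H| + #|H|]}.
Local Notation Z h := ('X_(z_idx h) : poly2).
Local Notation W h := ('X_(w_idx h) : poly2).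

(** The coefficient of w_k z_j in the form of the angle between k and j, after
    the diagonal substitution. *)
Definition turn_weight k j : K := - (-1) ^+ lt k j * (t k / t j).

Definition angle_form h : poly2 :=
  let a := vnext h in let b := vnext (vnext h) in
  turn_weight a b *: (W a * Z b) + turn_weight b a *: (W b * Z a).

(** The product of the vertex polynomials, divided by the factorials of the
    angle colors. The angles are indexed by the half-edges opposite to
    them. *)
Definition state_poly N : poly2 := \prod_h ((N h)`!%:R^-1 *: angle_form h ^+ N h).

(** The terms with z_j in the forms of the two angles at j, where the partner
    w_k of z_j is recorded by z_k, and the angle by the variable w of its
    opposite half-edge. *)
Definition row_form j : poly2 :=
  turn_weight (vnext j) j *: (Z (vnext j) * W (vnext (vnext j))) +
  turn_weight (vnext (vnext j)) j *: (Z (vnext (vnext j)) * W (vnext j)).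

Definition row_product b : poly2 := \prod_j row_form j ^+ b j.

Lemma mderiv_divpow (p : poly2) x n :
  ((n`!%:R^-1 *: p ^+ n)^`M(x)) =
  if n is n'.+1 then p^`M(x) * (n'`!%:R^-1 *: p ^+ n') else 0.
Proof.
case: n => [|n]; first by rewrite expr0 invr1 scale1r mderivC.
rewrite mderivZ.
have -> : (p ^+ n.+1)^`M(x) = n.+1%:R *: (p^`M(x) * p ^+ n).
  elim: n => [|n IHn]; first by rewrite expr1 expr0 mulr1 scale1r.
  rewrite exprS mderivM IHn -scalerAr mulrCA -exprS -[X in X + _]scale1r -scalerDl.
  by rewrite nat1r.
rewrite scalerA factS natrM invfM mulrAC mulVf ?mul1r ?scalerAr //.
by rewrite pnatr_eq0.
Qed.

Lemma mderiv_state_poly N x :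
  (state_poly N)^`M(x) =
  \sum_h (if (0 < N h)%N then (angle_form h)^`M(x) * state_poly (expo_sub N [set h]) else 0).
Proof.
rewrite /state_poly mderiv_prod; apply: eq_bigr => h _; rewrite mderiv_divpow.
case Nh: (N h) => [|n]; first by rewrite mul0r.
rewrite /= -mulrA; congr (_ * _); rewrite [RHS](bigD1 h) //= ffunE inE eqxx Nh subn1.
congr (_ * _); apply: eq_bigr => k kh.
by rewrite ffunE inE (negbTE kh) subn0.
Qed.

Lemma mderivXU (x y : 'I_(#|H| + #|H|)) : ('X_y : poly2)^`M(x) = (x == y)%:R.
Proof.
rewrite mderivX mnm1E [x == y]eq_sym; case: eqP => [->|_]; last by rewrite scale0r.
by rewrite scale1r -[X in 'X_[X - _]]add0m addmK mpolyX0.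
Qed.

Lemma mderiv_angle_form h j :
  (angle_form h)^`M(z_idx j) =
  (if h == vnext j then turn_weight (vnext (vnext j)) j *: W (vnext (vnext j)) else 0) +
  (if h == vnext (vnext j) then turn_weight (vnext j) j *: W (vnext j) else 0).
Proof.
have e1 : (j == vnext (vnext h)) = (h == vnext j).
  by apply/eqP/eqP=> [->|->]; rewrite vnextK3.
have e2 : (j == vnext h) = (h == vnext (vnext j)).
  by apply/eqP/eqP=> [->|->]; rewrite vnextK3.
rewrite /angle_form mderivD !mderivZ !mderivM !mderivXU !zw_idx_neq !z_idx_eq e1 e2 !mul0r !add0r.
congr (_ + _); case: eqP => [->|]; rewrite ?mulr0 ?scaler0 // ?vnextK3 mulr1 //.
Qed.

Lemma mderiv_state_poly_z N j :
  (state_poly N)^`M(z_idx j) =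
  (if (0 < N (vnext j))%N then
    turn_weight (vnext (vnext j)) j *: W (vnext (vnext j)) * state_poly (expo_sub N [set vnext j])
   else 0) +
  (if (0 < N (vnext (vnext j)))%N then
    turn_weight (vnext j) j *: W (vnext j) * state_poly (expo_sub N [set vnext (vnext j)])
   else 0).
Proof.
have [n1 n2 n3] := star_neq j; have n3' : (vnext (vnext j) == vnext j) = false.
  by rewrite eq_sym (negbTE n3).
rewrite mderiv_state_poly (bigD1 (vnext j)) //= (bigD1 (vnext (vnext j))) ?n3' //=.
rewrite big1 ?addr0 => [|h /andP[/negbTE h1 /negbTE h2]]; last first.
  by rewrite mderiv_angle_form h1 h2 addr0 mul0r if_same.
by rewrite !mderiv_angle_form !eqxx (negbTE n3) n3' addr0 add0r.
Qed.

Lemma fact_expo_add b j :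
  (\prod_h (expo_add b [set j] h)`!%:R) = (b j).+1%:R * \prod_h (b h)`!%:R :> K.
Proof.
rewrite (bigD1 j) //= [in RHS](bigD1 j) //= !ffunE inE eqxx addn1 factS natrM -!mulrA.
congr (_ * (_ * _)); apply: eq_bigr => h hj.
by rewrite ffunE inE (negbTE hj) addn0.
Qed.

Lemma state_coeff_rec N a b j :
  \prod_h (expo_add b [set j] h)`!%:R * (state_poly N)@_(mu (expo_add b [set j]) a) =
  (if (0 < a (vnext j))%N && (0 < N (vnext (vnext j)))%N then
     turn_weight (vnext j) j * (\prod_h (b h)`!%:R *
       (state_poly (expo_sub N [set vnext (vnext j)]))@_(mu b (expo_sub a [set vnext j]))) else 0) +
  (if (0 < a (vnext (vnext j)))%N && (0 < N (vnext j))%N then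
     turn_weight (vnext (vnext j)) j * (\prod_h (b h)`!%:R *
       (state_poly (expo_sub N [set vnext j]))@_(mu b (expo_sub a [set vnext (vnext j)]))) else 0).
Proof.
have [n1 n2 n3] := star_neq j.
have coefW c k (p : poly2) : (c *: W k * p)@_(mu b a) =
    if (0 < a k)%N then c * p@_(mu b (expo_sub a [set k])) else 0.
  by rewrite -scalerAl mcoeffZ mcoeffXM mu_w mu_subw; case: ifP; rewrite ?mulr0.
have -> : \prod_h (expo_add b [set j] h)`!%:R * (state_poly N)@_(mu (expo_add b [set j]) a) =
    \prod_h (b h)`!%:R * ((state_poly N)^`M(z_idx j))@_(mu b a).
  rewrite fact_expo_add mcoeff_deriv mu_z mu_addz -[_@_(mu _ _) *+ _]mulr_natl.
  by rewrite [RHS]mulrA [X in X * _]mulrC.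
rewrite mderiv_state_poly_z.
rewrite mcoeffD mulrDr addrC; congr (_ + _).
  case: (0 < N _)%N; rewrite ?andbF ?mcoeff0 ?mulr0 ?andbT // coefW.
  by case: ifP; rewrite ?mulr0 // mulrCA.
case: (0 < N _)%N; rewrite ?andbF ?mcoeff0 ?mulr0 ?andbT // coefW.
by case: ifP; rewrite ?mulr0 // mulrCA.
Qed.

Lemma row_product_add b j :
  row_product (expo_add b [set j]) = row_form j * row_product b.
Proof.
rewrite /row_product (bigD1 j) //= [in RHS](bigD1 j) //= !ffunE inE eqxx addn1 exprS -!mulrA.
congr (_ * (_ * _)); apply: eq_bigr => h hj.
by rewrite ffunE inE (negbTE hj) addn0.
Qed.

Lemma row_coeff_rec N a b j :
  (row_product (expo_add b [set j]))@_(mu a N) =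
  (if (0 < a (vnext j))%N && (0 < N (vnext (vnext j)))%N then
     turn_weight (vnext j) j *
       (row_product b)@_(mu (expo_sub a [set vnext j]) (expo_sub N [set vnext (vnext j)])) else 0) +
  (if (0 < a (vnext (vnext j)))%N && (0 < N (vnext j))%N then
     turn_weight (vnext (vnext j)) j *
       (row_product b)@_(mu (expo_sub a [set vnext (vnext j)]) (expo_sub N [set vnext j])) else 0).
Proof.
rewrite row_product_add /row_form mulrDl mcoeffD.
have coefZW c k h (p : poly2) : (c *: (Z k * W h) * p)@_(mu a N) =
    if (0 < a k)%N && (0 < N h)%N then c * p@_(mu (expo_sub a [set k]) (expo_sub N [set h])) else 0.
  rewrite -scalerAl mcoeffZ -mulrA mcoeffXM mu_z mu_subz mcoeffXM mu_w mu_subw.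
  by case: (0 < a k)%N; case: (0 < N h)%N; rewrite ?mulr0.
by rewrite !coefZW.
Qed.

Lemma homogeneous_angle_form (f : 'X_{1..#|H| + #|H|} -> nat) d h :
    {morph f : m m' / (m + m')%MM >-> (m + m')%N} ->
    (f U_(w_idx (vnext h))%MM + f U_(z_idx (vnext (vnext h)))%MM = d)%N ->
    (f U_(w_idx (vnext (vnext h)))%MM + f U_(z_idx (vnext h))%MM = d)%N ->
  homogeneous f d (angle_form h).
Proof.
move=> fD e1 e2; have homX i : homogeneous f (f U_(i)%MM) ('X_i : poly2).
  by move=> m; rewrite msuppX inE => /eqP->.
apply: homogeneousD; apply: homogeneousZ; [rewrite -e1 | rewrite -e2];
  exact: homogeneousM.
Qed.

Lemma homogeneous_state_poly (f : 'X_{1..#|H| + #|H|} -> nat) (d : H -> nat) N :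
    f 0%MM = 0%N -> {morph f : m m' / (m + m')%MM >-> (m + m')%N} ->
    (forall h, f U_(w_idx (vnext h))%MM + f U_(z_idx (vnext (vnext h)))%MM = d h)%N ->
    (forall h, f U_(w_idx (vnext (vnext h)))%MM + f U_(z_idx (vnext h))%MM = d h)%N ->
  homogeneous f (\sum_h N h * d h) (state_poly N).
Proof.
move=> f0 fD e1 e2; apply: homogeneous_prod => // h.
by apply/homogeneousZ/homogeneousX => //; apply: homogeneous_angle_form.
Qed.

Lemma z_degree_state_poly N : homogeneous (fun m => \sum_h m (z_idx h))%N (\sum_h N h) (state_poly N).
Proof.
have -> : (\sum_h N h = \sum_h N h * 1)%N by apply: eq_bigr => h _; rewrite muln1.
have single k : (\sum_h (U_(z_idx k) : 'X_{1..#|H| + #|H|})%MM (z_idx h) = 1)%N.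
  rewrite (bigD1 k) //= mnm1E eqxx big1 // => h hk.
  by rewrite mnm1E z_idx_eq eq_sym (negbTE hk).
have none k : (\sum_h (U_(w_idx k) : 'X_{1..#|H| + #|H|})%MM (z_idx h) = 0)%N.
  by rewrite big1 // => h _; rewrite mnm1E wz_idx_neq.
apply: homogeneous_state_poly => [|m m'|h|h]; rewrite ?none ?single //.
  by rewrite big1 // => h _; rewrite mnm0E.
by rewrite -big_split; apply: eq_bigr => h _; rewrite mnmDE.
Qed.

Lemma star_degree_state_poly N h :
  homogeneous (fun m => m (z_idx h) + m (w_idx h))%N
    (N (vnext h) + N (vnext (vnext h))) (state_poly N).
Proof.
have [n1 n2 n3] := star_neq h.
have -> : (N (vnext h) + N (vnext (vnext h)) =
    \sum_k N k * ((k == vnext h) + (k == vnext (vnext h))))%N.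
  rewrite (bigD1 (vnext h)) //= (bigD1 (vnext (vnext h))) /=; last by rewrite eq_sym.
  rewrite big1 => [|k /andP[/negbTE-> /negbTE->]]; last by rewrite muln0.
  by rewrite !eqxx (negbTE n3) eq_sym (negbTE n3) addn0 !muln1.
have e1 k : (h == vnext (vnext k)) = (k == vnext h).
  by apply/eqP/eqP=> [->|->]; rewrite vnextK3.
have e2 k : (h == vnext k) = (k == vnext (vnext h)).
  by apply/eqP/eqP=> [->|->]; rewrite vnextK3.
apply: homogeneous_state_poly => [|m m'|k|k].
- by rewrite !mnm0E.
- by rewrite !mnmDE addnACA.
- by rewrite !mnm1E !z_idx_eq !w_idx_eq !zw_idx_neq !wz_idx_neq ![_ == h]eq_sym e1 e2; lia.
- by rewrite !mnm1E !z_idx_eq !w_idx_eq !zw_idx_neq !wz_idx_neq ![_ == h]eq_sym e1 e2; lia.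
Qed.

Lemma expo_positive b h : (0 < b h)%N -> b = expo_add (expo_sub b [set h]) [set h].
Proof. by move=> bh; rewrite expo_subK // => k; rewrite inE => /eqP->. Qed.

Lemma expo_eq0 (a : expo) : (a == [ffun => 0%N]) = [forall h, a h == 0%N].
Proof.
apply/eqP/forallP=> [-> h|a0]; first by rewrite ffunE.
by apply/ffunP=> h; rewrite ffunE; apply/eqP.
Qed.

(** Both sides count with weights the ways to pair b_j letters z_j with a_k
    letters w_k by means of N_h angles of each kind. On the left this is the
    expansion of exp (sum of x_h * angle_form h), with x^N extracted; on the
    right every letter z_j chooses its partner and its angle, and b! accounts
    for the order of equal letters. The induction removes one letter z_j, by a
    derivative on the left and by the factor row_form j on the right. *)
Lemma state_coeff N a b :
  \prod_h (b h)`!%:R * (state_poly N)@_(mu b a) = (row_product b)@_(mu a N).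
Proof.
have [d] := ubnP (\sum_h b h)%N; elim: d N a b => // d IHd N a b b_lt.
have [/existsP[j bj]|] := boolP [exists j, (0 < b j)%N]; last first.
  rewrite negb_exists => /forallP b0.
  have {b_lt}b0 : b = [ffun => 0%N].
    by apply/eqP; rewrite expo_eq0; apply/forallP=> h; have := b0 h; rewrite lt0n negbK.
  have -> : row_product b = 1 by rewrite /row_product big1 // => h _; rewrite b0 ffunE.
  rewrite big1 ?mul1r => [|h _]; last by rewrite b0 ffunE.
  have [N0|N0] := eqVneq N [ffun => 0%N].
    have -> : state_poly N = 1.
      by rewrite /state_poly big1 // => h _; rewrite N0 ffunE invr1 scale1r.
    rewrite !mcoeff1 N0 b0; congr (_%:R); congr nat_of_bool.
    apply/eqP/eqP => /mnmP m0; apply/mnmP; apply: idx_ind => h; rewrite ?mu_z ?mu_w mnm0E ?ffunE //.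
      by have := m0 (w_idx h); rewrite mu_w mnm0E.
    by have := m0 (z_idx h); rewrite mu_z mnm0E.
  rewrite expo_eq0 negb_forall in N0; case/existsP: N0 => h Nh.
  rewrite mcoeff1; case: eqP => [/mnmP/(_ (w_idx h))|_].
    by rewrite mu_w mnm0E => Nh0; rewrite Nh0 in Nh.
  apply: memN_msupp_eq0; apply/negP => /z_degree_state_poly.
  rewrite big1 => [|k _]; last by rewrite mu_z b0 ffunE.
  by move=> /esym/eqP; rewrite (bigD1 h) //= addn_eq0 (negbTE Nh).
have b_sum : (\sum_h b h = (\sum_h expo_sub b [set j] h).+1)%N.
  rewrite (bigD1 j) //= [in RHS](bigD1 j) //= ffunE inE eqxx -addSn subn1 prednK //.
  by congr addn; apply: eq_bigr => h hj; rewrite ffunE inE (negbTE hj) subn0.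
rewrite b_sum ltnS in b_lt.
by rewrite (expo_positive bj) state_coeff_rec row_coeff_rec !IHd.
Qed.

End AngleAlgebra.

(** * The series of a graph as a sum over dart multiplicities *)

Section StateSum.
Variable G : trivalent_graph.
Local Notation V := (vertex G).
Local Notation H := (half_edge G).
Local Notation E := (edge G).
Implicit Types (h j k l : H).
Variables (lt : rel H) (lt_compatible : compatible_order lt).
Local Notation expo := {ffun H -> nat}.
Implicit Types (a b N : expo).
Variables (K : numFieldType) (t : H -> K).
Hypothesis t_neq0 : forall h, t h != 0.
Local Notation poly2 := {mpoly K[#|H| + #|H|]}.
Local Notation Z h := ('X_(z_idx h) : poly2).
Local Notation W h := ('X_(w_idx h) : poly2).

Definition mated a : expo := [ffun h => a (mate h)].

(** The sign of the term of the edge operator that differentiates with respect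
    to w_h and to z at the mate of h. *)
Definition dart_sign h : K := (-1) ^+ lt h (mate h).

Definition kappa a : K := \prod_h (dart_sign h ^+ a h * (a h)`!%:R).

(** When the edge operators are applied until a constant is left, every
    monomial that survives has the same exponent a h at w_h and at z of the
    mate of h. The derivatives then give it the weight [kappa a]. *)
Definition pairing d (p : poly2) : K :=
  \sum_(a : {ffun H -> 'I_d.+1}) kappa (expo_nat a) * p@_(mu (mated (expo_nat a)) (expo_nat a)).

Lemma pairingZ d x p : pairing d (x *: p) = x * pairing d p.
Proof.
by rewrite /pairing mulr_sumr; apply: eq_bigr => a _; rewrite mcoeffZ mulrCA.
Qed.

Lemma mated_add a h : mated (expo_add a [set h]) = expo_add (mated a) [set mate h].
Proof. by apply/ffunP=> k; rewrite !ffunE !inE (can2_eq (@mateK G) (@mateK G)). Qed.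

Lemma dart_sign2 h : dart_sign h * dart_sign h = 1.
Proof. by rewrite /dart_sign -expr2 sqrr_sign. Qed.

Lemma kappa_add a h :
  kappa (expo_add a [set h]) = dart_sign h * (a h).+1%:R * kappa a.
Proof.
rewrite /kappa (bigD1 h) //= [in RHS](bigD1 h) //= !ffunE inE eqxx addn1 factS natrM exprS.
rewrite -!mulrA; congr (_ * _).
rewrite (eq_bigr (fun k => dart_sign k ^+ a k * (a k)`!%:R)) => [|k kh].
  by rewrite mulrCA.
by rewrite ffunE inE (negbTE kh) addn0.
Qed.

Lemma mcoeff_edge_operator (p : poly2) a e1 (e2 := mate e1) :
  (edge_operator e1 p)@_(mu (mated a) a) =
  (a e2).+1%:R ^+ 2 * p@_(mu (mated (expo_add a [set e2])) (expo_add a [set e2])) -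
  (a e1).+1%:R ^+ 2 * p@_(mu (mated (expo_add a [set e1])) (expo_add a [set e1])).
Proof.
rewrite /edge_operator mcoeffB !mcoeff_deriv !mnmDE !mu_z !mnm1E !zw_idx_neq !addn0.
have square x n : x *+ n *+ n = n%:R ^+ 2 * x :> K by rewrite -[LHS]mulr_natl -[x *+ n]mulr_natl mulrA expr2.
have m1 : mated a e1 = a (mate e1) by rewrite ffunE.
have m2 : mated a (mate e1) = a e1 by rewrite ffunE mateK.
by rewrite !mu_w !mu_addz !mu_addw !mated_add /e2 mateK m1 m2 !square.
Qed.

Definition edge_homogeneous (c : E -> nat) (p : poly2) :=
  forall h, homogeneous (fun m => m (z_idx h) + m (w_idx h))%N (c (edge_of h)) p.

Lemma msupp_pairing c d p a : edge_homogeneous c p -> (forall e, c e <= d)%N ->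
  forall h, (d < a h)%N -> p@_(mu (mated a) a) = 0.
Proof.
move=> hp cd h ah; apply: memN_msupp_eq0; apply/negP=> /(hp h).
by rewrite mu_w; have := cd (edge_of h); lia.
Qed.

(** Each of the two terms of the operator lowers the multiplicity of one dart
    and multiplies the weight by this multiplicity; the multiplicities of the
    two darts of an edge add up to its color. *)
Lemma pairing_edge_operator c d p e1 : lt e1 (mate e1) ->
    edge_homogeneous c p -> (forall e, c e <= d)%N ->
  pairing d (edge_operator e1 p) = (c (edge_of e1))%:R * pairing d p.
Proof.
move=> e12 hp cd; pose g b := kappa b * p@_(mu (mated b) b).
have g0 h b k : (d < b k)%N -> (b h)%:R * g b = 0.
  by move=> bk; rewrite /g (msupp_pairing hp cd bk) !mulr0.
have term h : \sum_(a : {ffun H -> 'I_d.+1}) kappa (expo_nat a) *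
    ((expo_nat a h).+1%:R ^+ 2 * p@_(mu (mated (expo_add (expo_nat a) [set h])) (expo_add (expo_nat a) [set h]))) =
    dart_sign h * \sum_(b : {ffun H -> 'I_d.+1}) (expo_nat b h)%:R * g (expo_nat b).
  transitivity (dart_sign h * \sum_(a : {ffun H -> 'I_d.+1})
      (fun b => (b h)%:R * g b) (expo_add (expo_nat a) [set h])).
    rewrite mulr_sumr; apply: eq_bigr => a _.
    rewrite /g kappa_add [in (expo_add _ _ h)%:R]ffunE inE eqxx addn1 expr2.
    rewrite -[LHS]mul1r -(dart_sign2 h); ring.
  rewrite (sum_expo_add _ (f := fun b => (b h)%:R * g b)); last by move=> b k; apply: g0.
  congr (_ * _); rewrite [RHS](bigID (fun b : {ffun H -> 'I_d.+1} => [forall h0 in [set h], (0 < b h0)%N])) /=.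
  rewrite [X in _ = _ + X]big1 ?addr0 // => b; rewrite negb_forall_in => /exists_inP[k].
  by rewrite inE => /eqP->; rewrite -eqn0Ngt ffunE => /eqP->; rewrite mul0r.
rewrite /pairing.
under eq_bigr => a _ do rewrite mcoeff_edge_operator mulrBr.
rewrite sumrB !term {1 2}/dart_sign mateK e12 (ltV lt_compatible) 1?eq_sym ?mate_neq // e12 expr0 expr1.
rewrite mul1r mulN1r opprK -big_split mulr_sumr; apply: eq_bigr => b _ /=.
rewrite -mulrDl /g !mulrA; have [supp|/memN_msupp_eq0->] := boolP (mu (mated (expo_nat b)) (expo_nat b) \in msupp p); last by rewrite !mulr0.
by rewrite -natrD -(hp e1 _ supp) mu_z mu_w [mated _ _]ffunE.
Qed.

Lemma edge_homogeneous_operator c p e1 : edge_homogeneous c p ->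
  edge_homogeneous (fun e => c e - (e == edge_of e1))%N (edge_operator e1 p).
Proof.
move=> hp h m; rewrite mcoeff_msupp /edge_operator mcoeffB !mcoeff_deriv => nz.
have he : (edge_of h == edge_of e1) = (h == e1) || (h == mate e1).
  by apply/eqP/orP => [/ends_cases/orP//|[]/eqP->]; rewrite ?edge_mate.
have ne : (h == e1) && (h == mate e1) = false.
  by case: eqP => [->|]; rewrite //= eq_sym (negbTE (mate_neq _)).
have supp (i j : 'I_(#|H| + #|H|)) : ~~ (p@_(m + U_(i) + U_(j)) == 0) ->
    (m (z_idx h) + (i == z_idx h) + (j == z_idx h) +
     (m (w_idx h) + (i == w_idx h) + (j == w_idx h)) = c (edge_of h))%N.
  by rewrite -mcoeff_msupp => /(hp h); rewrite !mnmDE !mnm1E.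
have : (m (z_idx h) + m (w_idx h) + (edge_of h == edge_of e1) = c (edge_of h))%N.
  have [z1|/supp] := eqVneq (p@_(m + U_(z_idx e1) + U_(w_idx (mate e1)))) 0.
    have [z2|/supp] := eqVneq (p@_(m + U_(z_idx (mate e1)) + U_(w_idx e1))) 0.
      by rewrite z1 z2 !mul0rn subrr eqxx in nz.
    rewrite !z_idx_eq !w_idx_eq !zw_idx_neq !wz_idx_neq ![_ == h]eq_sym he.
    by move: ne; case: (h == e1); case: (h == mate e1) => //=; lia.
  rewrite !z_idx_eq !w_idx_eq !zw_idx_neq !wz_idx_neq ![_ == h]eq_sym he.
  by move: ne; case: (h == e1); case: (h == mate e1) => //=; lia.
by lia.
Qed.

Lemma pairing_iter c d p e1 n : lt e1 (mate e1) ->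
    edge_homogeneous c p -> (forall e, c e <= d)%N ->
  edge_homogeneous (fun e => c e - n * (e == edge_of e1))%N (iter n (edge_operator e1) p) /\
  pairing d (iter n (edge_operator e1) p) = (c (edge_of e1) ^_ n)%:R * pairing d p.
Proof.
move=> e12 hp cd; elim: n => [|n [IHh IHp]] /=.
  by split; [move=> h; rewrite mul0n subn0; exact: hp | rewrite ffactn0 mul1r].
split.
  move=> h m /(edge_homogeneous_operator IHh) ->; rewrite mulSn; lia.
rewrite (pairing_edge_operator e12 IHh) => [|e]; last by have := cd e; lia.
by rewrite IHp eqxx muln1 mulrA -natrM mulnC ffactnSr.
Qed.

Lemma pairing_edge_action c c' d p e1 : lt e1 (mate e1) ->
    edge_homogeneous c' p -> (forall e, c' e <= d)%N -> c' (edge_of e1) = c (edge_of e1) ->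
  edge_homogeneous (fun e => if e == edge_of e1 then 0 else c' e)%N (edge_action c e1 p) /\
  pairing d (edge_action c e1 p) = ((c (edge_of e1))`!)%:R^-1 * pairing d p.
Proof.
move=> e12 hp cd cc'; have [hD pD] := pairing_iter (c (edge_of e1)) e12 hp cd.
have f0 : ((c (edge_of e1))`!)%:R != 0 :> K by rewrite pnatr_eq0 -lt0n fact_gt0.
split.
  move=> h m /msuppZ_le /hD ->; case: eqP => [->|_]; rewrite ?muln1 ?muln0 ?subn0 //.
  by rewrite cc' subnn.
rewrite /edge_action pairingZ pD cc' ffactnn expr2 invfM.
by rewrite -mulrA; congr (_ * _); rewrite mulKf.
Qed.

(** The iterated operator of an edge produces the factorial of its color, so
    that one of the two factorials in the denominator is left. *)
Lemma evaluationE c d p : edge_homogeneous c p -> (forall e, c e <= d)%N ->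
  (foldr (edge_action c) p [seq h <- enum H | lt h (mate h)])@_0%MM =
  (\prod_e (c e)`!%:R)^-1 * pairing d p.
Proof.
move=> hp cd; set s := [seq h <- enum H | _].
have s_lt h : h \in s -> lt h (mate h) by rewrite mem_filter => /andP[].
have s_uniq : uniq s by rewrite filter_uniq // enum_uniq.
have [] : edge_homogeneous (fun e => if e \in map (@edge_of G) s then 0 else c e)%N
      (foldr (edge_action c) p s) /\
    pairing d (foldr (edge_action c) p s) = (\prod_(h <- s) ((c (edge_of h))`!)%:R)^-1 * pairing d p.
  elim: s s_lt s_uniq => [|h s IHs] s_lt /=; first by rewrite big_nil invr1 mul1r.
  case/andP=> hs s_uniq; have {IHs} [] := IHs _ s_uniq.
    by move=> k ks; apply: s_lt; rewrite inE ks orbT.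
  set p' := foldr _ _ _ => hp' pp'.
  have hlt : lt h (mate h) by apply: s_lt; rewrite inE eqxx.
  have h_s : edge_of h \notin map (@edge_of G) s.
    apply/mapP=> -[k ks /esym/ends_cases/orP[/eqP kh|/eqP kh]]; first by rewrite -kh ks in hs.
    have := s_lt k; rewrite inE ks orbT => /(_ isT).
    by rewrite kh mateK (ltV lt_compatible) ?hlt // eq_sym mate_neq.
  have [] := pairing_edge_action (c := c) hlt hp' (d := d).
  - by move=> e; case: ifP => // _.
  - by rewrite (negbTE h_s).
  move=> hp'' pp''; split.
    by move=> k m /hp'' ->; rewrite inE; case: eqP.
  by rewrite pp'' pp' big_cons invfM mulrA.
set q := foldr _ _ _ => hq pq.
have hq0 m : m != 0%MM -> q@_m = 0.
  move=> m0; apply: memN_msupp_eq0; apply: contra m0 => mq; apply/eqP/mnmP.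
  have edge_in h : edge_of h \in map (@edge_of G) s.
    apply/mapP; have [hm|hm] := boolP (lt h (mate h)).
      by exists h; rewrite // mem_filter hm mem_enum.
    exists (mate h); rewrite ?edge_mate // mem_filter mem_enum mateK.
    by rewrite (ltV lt_compatible) ?hm // eq_sym mate_neq.
  by apply: idx_ind => h; have := hq h m mq; rewrite edge_in mnm0E; lia.
transitivity (pairing d q).
  rewrite /pairing (bigD1 [ffun => ord0]) //= big1 ?addr0 => [|a a0].
    have e0 : expo_nat [ffun => @ord0 d] = [ffun => 0%N] :> expo by apply/ffunP=> h; rewrite !ffunE.
    rewrite e0 /kappa big1 ?mul1r => [|h _]; last by rewrite ffunE mulr1.
    by congr (_@_ _); apply/mnmP; apply: idx_ind => h; rewrite mnm0E ?mu_z ?mu_w ?ffunE.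
  rewrite hq0 ?mulr0 //; apply: contra a0 => /eqP/mnmP m0.
  apply/eqP/ffunP=> h; apply: val_inj; have := m0 (w_idx h).
  by rewrite mu_w mnm0E !ffunE.
rewrite pq; congr (_^-1 * _).
rewrite -(big_edge_halves lt_compatible _ (fun e => ((c e)`!)%:R : K)) /s big_filter.
by rewrite big_enum_cond.
Qed.

Lemma opposite_is_angle h : is_angle [set vnext h; vnext (vnext h)].
Proof.
have [_ _ n3] := star_neq h; apply: pair_angle => //; by rewrite !origin_vnext.
Qed.

(** Two half-edges of a star form the angle opposite to the third one, so that
    angles can be indexed by half-edges. *)
Definition opposite_angle h : angle G := Sub [set vnext h; vnext (vnext h)] (opposite_is_angle h).

Lemma opposite_angle_inj : injective opposite_angle.
Proof.
move=> h k /(congr1 val) /= /setP e.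
have [n1 n2 n3] := star_neq h.
have hk : origin h = origin k.
  have := e (vnext h); rewrite !inE eqxx /= => /esym/orP[]/eqP/(congr1 (@origin G));
  by rewrite !origin_vnext.
have := star_cases (esym hk); rewrite !inE => /or3P[/eqP//|/eqP kE|/eqP kE]; move: (e h);
  rewrite !inE kE ?vnextK3 (negbTE n1) (negbTE n2) eqxx ?orbT //.
Qed.

Lemma opposite_angle_surj (a : angle G) : exists h, opposite_angle h == a.
Proof.
case: a => a a_angle; have /andP[/cards2P[h [k [hk aE]]] same] := a_angle.
have ohk : origin h = origin k.
  by move/forall_inP: same => /(_ h); rewrite aE !inE eqxx => /(_ isT)
     /forall_inP/(_ k); rewrite !inE eqxx orbT => /(_ isT)/eqP.
have := star_cases (esym ohk); rewrite !inE => /or3P[/eqP e|/eqP e|/eqP e].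
- by rewrite e eqxx in hk.
- by exists (vnext (vnext h)); apply/eqP/val_inj; rewrite /= vnextK3 aE e.
- by exists (vnext h); apply/eqP/val_inj; rewrite /= vnextK3 aE e setUC.
Qed.

Lemma opposite_angle_bij : bijective opposite_angle.
Proof.
exists (fun a : angle G => xchoose (opposite_angle_surj a)) => [h|a]; last by apply/eqP; apply: (xchooseP (opposite_angle_surj a)).
by apply: opposite_angle_inj; apply/eqP; apply: (xchooseP (opposite_angle_surj (opposite_angle h))).
Qed.

Lemma angle_color_opposite (c : E -> nat) h : angle_color c (opposite_angle h) =
  ((c (edge_of (vnext h)) + c (edge_of (vnext (vnext h))) - c (edge_of h))./2)%N.
Proof.
have [n1 n2 n3] := star_neq h.
apply: angle_colorE; rewrite ?origin_vnext //.
by rewrite /= !inE negb_or n3 eq_sym n1 eq_sym n2.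
Qed.

Variable psi : H -> SL2 K.
Hypothesis psi_diagonal : forall h, val (psi h) = diagonal (t h).

Lemma inv_diagonal (x : K) : x != 0 -> invmx (diagonal x) = @diagonal K x^-1.
Proof.
move=> x0; have e : @diagonal K x *m @diagonal K x^-1 = 1%:M.
  have lift0 : lift ord0 ord0 = ord_max :> 'I_2 by apply: val_inj.
  have m0 : (ord_max == ord0 :> 'I_2) = false by [].
  have zm : (ord0 == ord_max :> 'I_2) = false by [].
  apply/matrixP=> i j; rewrite !mxE big_ord_recl big_ord1 !mxE lift0.
  have [->|->] : j = ord0 \/ j = ord_max := ord2_cases j;
    (have [->|->] : i = ord0 \/ i = ord_max := ord2_cases i);
    rewrite ?eqxx ?m0 ?zm ?mulr0 ?mul0r ?addr0 ?add0r ?mulfV ?mulVf //.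
  by rewrite invr_neq0.
have [u _] := mulmx1_unit e.
by rewrite -[RHS]mul1mx -(mulVmx u) -mulmxA e mulmx1.
Qed.

Lemma z_subE h : z_sub psi h = (t h)^-1 *: Z h.
Proof. by rewrite /z_sub psi_diagonal inv_diagonal // !mxE /= scale0r addr0. Qed.

Lemma w_subE h : w_sub psi h = t h *: W h.
Proof. by rewrite /w_sub psi_diagonal inv_diagonal // !mxE /= invrK scale0r add0r. Qed.

Lemma substituted_form h k : lt h k ->
  z_sub psi k * w_sub psi h - z_sub psi h * w_sub psi k =
  turn_weight lt t h k *: (W h * Z k) + turn_weight lt t k h *: (W k * Z h).
Proof.
move=> hk; rewrite !z_subE !w_subE /turn_weight hk.
rewrite (lt_asym lt_compatible hk) expr0 expr1 opprK mul1r mulN1r scaleNr.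
congr (_ - _); rewrite -scalerAl -scalerAr scalerA [Z _ * W _]mulrC; congr (_ *: _).
  by rewrite mulrC.
by rewrite mulrC.
Qed.

Lemma vertex_productE c : vertex_product lt psi c =
  \prod_h angle_form lt t h ^+ (angle_color c (opposite_angle h)).
Proof.
rewrite (big_vertices lt_compatible) /vertex_product; apply: eq_bigr => h /andP[l12 l23].
have l13 := lt_trans' lt_compatible l12 l23.
have f12 : z_sub psi (vnext h) * w_sub psi h - z_sub psi h * w_sub psi (vnext h) =
    angle_form lt t (vnext (vnext h)) by rewrite substituted_form // /angle_form !vnextK3.
have f23 : z_sub psi (vnext (vnext h)) * w_sub psi (vnext h) -
    z_sub psi (vnext h) * w_sub psi (vnext (vnext h)) = angle_form lt t h.
  by rewrite substituted_form.
have f13 : z_sub psi (vnext (vnext h)) * w_sub psi h -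
    z_sub psi h * w_sub psi (vnext (vnext h)) = angle_form lt t (vnext h).
  by rewrite substituted_form // /angle_form !vnextK3 addrC.
rewrite /vertex_poly f12 f23 f13 !angle_color_opposite !vnextK3.
by rewrite [(c (edge_of (vnext (vnext h))) + c (edge_of h))%N]addnC -mulrA [LHS]mulrC.
Qed.

Definition edge_color a (e : E) : nat := (\sum_(h : H | edge_of h == e) a h)%N.

Lemma edge_colorE a h : edge_color a (edge_of h) = (a h + a (mate h))%N.
Proof. exact: sum_ends. Qed.

Definition color_exponent (m : exponent G) : expo := [ffun h => m (opposite_angle h)].

Lemma color_exponent_inj : injective color_exponent.
Proof.
move=> m m' /ffunP e; apply/ffunP=> a; have /eqP <- := xchooseP (opposite_angle_surj a).
by have := e (xchoose (opposite_angle_surj a)); rewrite !ffunE.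
Qed.

Lemma total_degreeE (m : exponent G) : total_degree m = (\sum_h color_exponent m h)%N.
Proof.
rewrite /total_degree (reindex opposite_angle (onW_bij _ opposite_angle_bij)) /=.
by apply: eq_bigr => h _; rewrite ffunE.
Qed.

Lemma admissible_star (c : E -> nat) : admissible c -> forall h,
  (c (edge_of h) = angle_color c (opposite_angle (vnext h)) + angle_color c (opposite_angle (vnext (vnext h))))%N.
Proof.
move=> /forallP adm h; have := adm h; have := adm (vnext h); have := adm (vnext (vnext h)).
rewrite !angle_color_opposite /= !vnextK3.
move: (c (edge_of h)) (c (edge_of (vnext h))) (c (edge_of (vnext (vnext h)))) => x y z.
move=> /andP[o1 l1] /andP[o2 l2] /andP[o3 l3]; lia.
Qed.

(** Angle colors that give the same color to the two halves of every edge come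
    from an admissible coloring. *)
Lemma admissible_of_star (c : E -> nat) N :
    (forall h, c (edge_of h) = N (vnext h) + N (vnext (vnext h)))%N ->
  admissible c /\ forall h, angle_color c (opposite_angle h) = N h.
Proof.
move=> cN; split=> [|h].
  by apply/forallP=> h /=; rewrite !cN !vnextK3; apply/andP; split; lia.
by rewrite angle_color_opposite !cN !vnextK3; lia.
Qed.

Lemma state_poly_homogeneous c N :
    (forall h, c (edge_of h) = N (vnext h) + N (vnext (vnext h)))%N ->
  edge_homogeneous c (state_poly lt t N).
Proof. by move=> cN h m /star_degree_state_poly ->; rewrite cN. Qed.

Lemma Z_termE c d (m : exponent G) : admissible c ->
    [ffun a => angle_color c a] = m -> (forall e, c e <= d)%N ->
  Z_term lt psi c = (-1) ^+ crossing_exponent lt c * pairing d (state_poly lt t (color_exponent m)).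
Proof.
move=> c_adm cm cd; have mE h : color_exponent m h = angle_color c (opposite_angle h) by rewrite -cm !ffunE.
have state : vertex_product lt psi c =
    (\prod_h (color_exponent m h)`!%:R) *: state_poly lt t (color_exponent m).
  rewrite vertex_productE /state_poly -mul_mpolyC rmorph_prod -big_split.
  apply: eq_bigr => h _ /=; rewrite mul_mpolyC scalerA mE mulfV ?scale1r //.
  by rewrite pnatr_eq0 -lt0n fact_gt0.
have hom : edge_homogeneous c (vertex_product lt psi c).
  rewrite state.
  move=> h k /msuppZ_le; apply: state_poly_homogeneous.
  by move=> {}h; rewrite (admissible_star c_adm) !mE.
rewrite /Z_term /evaluation (evaluationE hom cd) -mulrA -mulrA; congr (_ * _).
have factors0 (I : finType) (f : I -> nat) : \prod_i (f i)`!%:R != 0 :> K.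
  by apply/prodf_neq0 => i _; rewrite pnatr_eq0 -lt0n fact_gt0.
rewrite !natr_prod; set A := \prod_e _; have A0 : A != 0 := factors0 _ c.
rewrite mulrCA mulKf // {A A0}.
rewrite (reindex opposite_angle (onW_bij _ opposite_angle_bij)) /=.
rewrite state pairingZ; under [X in _ / X]eq_bigr => h _ do rewrite -mE.
by rewrite mulrC mulKf // factors0.
Qed.

(** The angle colors determine the coloring, so that at most one coloring
    contributes to the coefficient of X^m, and its evaluation is a sum over
    the multiplicities a of darts. The sum can be taken over all a, since a
    state polynomial has no monomial whose edge colors do not fit m. *)
Lemma Z_seriesE d (m : exponent G) : (total_degree m <= d)%N ->
  Z_series lt psi m = \sum_(a : {ffun H -> 'I_d.+1})
    (-1) ^+ crossing_exponent lt (edge_color (expo_nat a)) *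
    (kappa (expo_nat a) *
     (state_poly lt t (color_exponent m))@_(mu (mated (expo_nat a)) (expo_nat a))).
Proof.
move=> md; set N := color_exponent m.
pose fits a := [forall h, edge_color a (edge_of h) == N (vnext h) + N (vnext (vnext h))]%N.
have term0 a : ~~ fits a -> (state_poly lt t N)@_(mu (mated a) a) = 0.
  move=> nfit; apply: memN_msupp_eq0; apply: contra nfit => supp; apply/forallP=> h.
  by rewrite -(star_degree_state_poly h supp) mu_z mu_w edge_colorE ffunE addnC.
have adm_of a : fits a -> admissible (edge_color a) /\ [ffun x => angle_color (edge_color a) x] = m.
  move=> /forallP fit; have [adm ac] := @admissible_of_star (edge_color a) N (fun h => eqP (fit h)).
  by split=> //; apply: color_exponent_inj; apply/ffunP=> h; rewrite !ffunE ac ffunE.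
have unique (c : E -> nat) a : admissible c -> [ffun x => angle_color c x] = m -> fits a ->
    c =1 edge_color a.
  move=> adm cm /forallP fit e.
  have /card_gt0P[h] : (0 < #|[set h | edge_of h == e]|)%N by rewrite card_ends.
  rewrite inE => /eqP <-; rewrite (eqP (fit h)) (admissible_star adm).
  by rewrite /N -cm !ffunE.
have [/existsP[a0 fit0]|no_fit] := boolP [exists a : {ffun H -> 'I_d.+1}, fits (expo_nat a)]; last first.
  rewrite [RHS]big1 => [|a _]; last first.
    by rewrite term0 ?mulr0 //; apply: contra no_fit => fit; apply/existsP; exists a.
  apply: big1 => c /andP[adm /eqP cm]; case/negP: no_fit.
  have cd e : (c e <= d)%N by apply: leq_trans md; rewrite -ltnS ltn_ord.
  apply/existsP; exists [ffun h => if lt h (mate h) then inord (c (edge_of h)) else ord0].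
  have mo k : m (opposite_angle k) = angle_color (fun e => c e) (opposite_angle k).
    by move/ffunP: cm => /(_ (opposite_angle k)); rewrite ffunE.
  apply/forallP=> h.
  have -> : (N (vnext h) + N (vnext (vnext h)))%N = c (edge_of h).
    by rewrite (admissible_star adm) /N !ffunE !mo.
  rewrite edge_colorE !ffunE mateK edge_mate.
  rewrite (ltV lt_compatible (mate_neq h)); case: (lt (mate h) h) => /=.
    by rewrite inordK // ltnS.
  by rewrite inordK ?addn0 // ltnS.
have [adm0 col0] := adm_of _ fit0; set c0 := edge_color (expo_nat a0) in adm0 col0.
have c0m e : (c0 e <= total_degree m)%N by rewrite -col0; apply: color_le_degree.
pose cc : {ffun E -> 'I_(total_degree m).+1} := [ffun e => inord (c0 e)].
have c0E : (fun e => cc e : nat) = c0.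
  by apply: boolp.funext => e; rewrite ffunE inordK // ltnS.
rewrite /Z_series (big_pred1 cc); last first.
  move=> c /=; apply/andP/eqP=> [[adm /eqP cm]|->].
    apply/ffunP=> e; rewrite ffunE; apply: val_inj; rewrite /= inordK ?ltnS //.
    exact: (unique _ _ adm cm fit0).
  by rewrite c0E adm0 col0.
rewrite c0E (Z_termE adm0 col0 (d := d)) => [|e]; last exact: leq_trans (c0m e) md.
rewrite /pairing mulr_sumr; apply: eq_bigr => a _.
have [fit|nfit] := boolP (fits (expo_nat a)); last by rewrite (term0 _ nfit) !mulr0.
by congr (_ ^+ crossing_exponent _ _ * _); apply: boolp.funext; apply: unique.
Qed.
End StateSum.

(** * The master theorem of MacMahon *)

Section Determinant.
Variables (K : comNzRingType) (T : finType).
Implicit Types (M : T -> T -> K).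

(** The determinant, with rows and columns indexed by a finite type. *)
Definition fdet M := \sum_(s : {perm T}) (-1) ^+ s * \prod_h M h (s h).

Lemma fdet_alternate M k l : k != l -> (forall h, M h k = M h l) -> fdet M = 0.
Proof.
move=> kl Mkl; rewrite /fdet (bigID (@odd_perm T)) /=.
rewrite [X in X + _](reindex_inj (mulIg (tperm k l))) /=.
rewrite [X in X + _](_ : _ = - \sum_(s : {perm T} | ~~ s) (-1) ^+ s * \prod_h M h (s h)) ?addNr //.
rewrite -sumrN; apply: eq_big => s; first by rewrite odd_permM odd_tperm kl addbT.
rewrite odd_permM odd_tperm kl addbT => /negbTE ->.
rewrite expr0 mul1r expr1 mulN1r; congr (- _); apply: eq_bigr => h _.
by rewrite permM; case: tpermP => // ->.
Qed.

(** Adding to column k the other columns of A adds determinants with two equal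
    columns. *)
Lemma fdet_column_sum M k (A : {set T}) : k \in A ->
  fdet M = fdet (fun h l => if l == k then \sum_(l' in A) M h l' else M h l).
Proof.
move=> kA; pose M' k' h l := if l == k then M h k' else M h l.
have -> : fdet (fun h l => if l == k then \sum_(l' in A) M h l' else M h l) =
    \sum_(k' in A) fdet (M' k').
  rewrite /fdet exchange_big /=; apply: eq_bigr => s _.
  rewrite -mulr_sumr; congr (_ * _); pose h := (s^-1)%g k.
  have sh : s h = k by rewrite permKV.
  rewrite (bigD1 h) //= sh eqxx mulr_suml; apply: eq_bigr => k' _.
  rewrite [RHS](bigD1 h) //= {1}/M' sh eqxx; congr (_ * _); apply: eq_bigr => l lh.
  by rewrite /M' -sh (inj_eq perm_inj) (negbTE lh).
rewrite (bigD1 k) //= big1 ?addr0 => [|k' /andP[_ k'k]].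
  by apply: eq_bigr => s _; congr (_ * _); apply: eq_bigr => h _; rewrite /M'; case: eqP => // ->.
by apply: (@fdet_alternate _ k k') => [|h]; rewrite 1?eq_sym // /M' eqxx (negbTE k'k).
Qed.
End Determinant.

Section PrincipalMinors.
Variables (L : comNzRingType) (T : finType).
Implicit Types (S U : {set T}) (s : {perm T}).

Lemma fdet_diagonal_shift (D : T -> L) (B : T -> T -> L) :
  fdet (fun h k => D h *+ (h == k) - B h k) =
  \sum_(S : {set T}) \sum_(s : {perm T} | perm_on S s)
    (-1) ^+ s * ((-1) ^+ #|S| * \prod_(h in S) B h (s h) * \prod_(h in ~: S) D h).
Proof.
rewrite /fdet; transitivity (\sum_(s : {perm T}) \sum_(S : {set T})
    (-1) ^+ s * \prod_h (if h \in S then - B h (s h) else D h *+ (h == s h))).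
  apply: eq_bigr => s _; rewrite -mulr_sumr -bigA_distr; congr (_ * _).
  by apply: eq_bigr => h _; rewrite addrC.
rewrite exchange_big; apply: eq_bigr => S _; rewrite [LHS](bigID (perm_on S)) /=.
rewrite [X in _ + X]big1 ?addr0 => [|s]; last first.
  case/subsetPn=> h; rewrite inE => sh hS.
  by rewrite (bigD1 h) //= (negbTE hS) eq_sym (negbTE sh) mul0r mulr0.
apply: eq_bigr => s s_on; congr (_ * _).
rewrite (bigID (mem S)) /= -prodrN; congr (_ * _).
  by apply: eq_bigr => h ->.
rewrite [RHS](eq_bigl (fun h => h \notin S)) => [|h]; last by rewrite inE.
apply: eq_bigr => h /[dup] hS /negbTE->.
by rewrite (out_perm s_on hS) eqxx.
Qed.

Variables (a : T -> T -> L) (I : L -> Prop) (U : {set T}).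
Hypothesis I0 : I 0.
Hypothesis ID : forall x y, I x -> I y -> I (x + y).
Hypothesis I_out : forall h k x, h \in U -> k \notin U -> I (a h k * x).
Local Notation row h := (\sum_k a h k).

(** A finite form of the master theorem. The sum is the expansion of the
    determinant of the matrix D - A on U, where A = (a h k) and D is the
    diagonal matrix of the row sums of A over all of T. When its columns are
    added together, what is left of a row h in the new column is the sum of
    the a h k with k outside U. The predicate I stands for the ideal generated
    by these entries, or for the kernel of a linear form that vanishes on
    it. *)
Lemma macmahon k0 : k0 \in U ->
  I (\sum_(S : {set T} | S \subset U) \sum_(s : {perm T} | perm_on S s)
      (-1) ^+ s * ((-1) ^+ #|S| * \prod_(h in S) a h (s h) * \prod_(h in U :\: S) row h)).
Proof.
move=> k0U; set P := (X in I X).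
pose D h := if h \in U then row h else 1.
pose B h k := a h k *+ ((h \in U) && (k \in U)).
have -> : P = fdet (fun h k => D h *+ (h == k) - B h k).
  rewrite fdet_diagonal_shift [RHS](bigID (fun S => S \subset U)) /=.
  rewrite [X in _ = _ + X]big1 ?addr0 => [|S /subsetPn[h hS hU]]; last first.
    apply: big1 => s _; rewrite (bigD1 h) //= /B (negbTE hU) mulr0n.
    by rewrite mul0r mulr0 mul0r mulr0.
  apply: eq_bigr => S SU; apply: eq_bigr => s s_on; congr (_ * (_ * _ * _)).
    apply: eq_bigr => h hS; rewrite /B (subsetP SU _ hS) (subsetP SU) ?mulr1n //.
    by rewrite (perm_closed _ s_on).
  rewrite [RHS](bigID (mem U)) /= [X in _ = _ * X]big1 ?mulr1 => [|h /andP[_ /negbTE hU]].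
    apply: eq_big => h; rewrite !inE // => /andP[_ hU].
    by rewrite /D hU.
  by rewrite /D hU.
rewrite (@fdet_column_sum _ _ _ k0 U) // /fdet.
apply: (big_ind I) => // s _; pose h := (s^-1)%g k0; have sh : s h = k0 by rewrite permKV.
rewrite (bigD1 h) //= sh eqxx [X in I X](_ : _ = (\sum_(l in U) (D h *+ (h == l) - B h l)) *
    ((-1) ^+ s * \prod_(i | i != h)
      (if s i == k0 then \sum_(l in U) (D i *+ (i == l) - B i l)
       else D i *+ (i == s i) - B i (s i)))); last by rewrite mulrCA.
move: (_ * \prod_(_ | _) _) => x; have [hU|hU] := boolP (h \in U); last first.
  rewrite big1 ?mul0r // => l lU; rewrite /B (negbTE hU) subr0.
  by case: eqP lU hU => // ->  ->.
rewrite [X in X * x](_ : _ = \sum_(k | k \notin U) a h k); last first.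
  rewrite big_split /= (bigD1 h) //= eqxx big1 => [|l /andP[_ lh]]; last first.
    by rewrite eq_sym (negbTE lh).
  rewrite addr0 /D hU (bigID (mem U)) /= sumrN addrAC.
  rewrite [X in X - _](eq_bigr (fun l => B h l)) ?subrr ?add0r // => l lU.
  by rewrite /B hU lU.
rewrite mulr_suml; apply: (big_ind I) => // k kU; exact: I_out.
Qed.
End PrincipalMinors.

(** * The master theorem for the matrix of turns *)

Section TurnExpansion.
Variable G : trivalent_graph.
Local Notation H := (half_edge G).
Local Notation E := (edge G).
Implicit Types (h j k l : H) (S U : {set H}) (s : {perm H}).
Variable lt : rel H.
Local Notation expo := {ffun H -> nat}.
Implicit Types (a b N : expo).

Definition is_turn h k := (origin k == origin (mate h)) && (k != mate h).

Definition third h k :=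
  if k == vnext (mate h) then vnext (vnext (mate h)) else vnext (mate h).

Lemma is_turnE h k :
  is_turn h k = (k == vnext (mate h)) || (k == vnext (vnext (mate h))).
Proof.
have [n1 n2 n3] := star_neq (mate h); rewrite /is_turn.
apply/andP/idP => [[/eqP ok kh]|/orP[]/eqP->]; last by rewrite !origin_vnext eqxx eq_sym.
  2: by rewrite !origin_vnext eqxx eq_sym.
by have := star_cases ok; rewrite !inE (negbTE kh).
Qed.

Lemma third_eq h k l : is_turn h k -> (third h k == l) = ([set mate h; k] == val (opposite_angle l)).
Proof.
rewrite is_turnE /third; have [n1 n2 n3] := star_neq (mate h) => ht.
have -> : [set mate h; k] = val (opposite_angle (third h k)).
  rewrite /third /=; case/orP: ht => /eqP->; first by rewrite eqxx !vnextK3.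
  by rewrite eq_sym (negbTE n3) !vnextK3 setUC.
by rewrite (inj_eq val_inj) (inj_eq (@opposite_angle_inj G)).
Qed.

Variables (K : numFieldType) (t : H -> K).
Local Notation poly2 := {mpoly K[#|H| + #|H|]}.
Local Notation Z h := ('X_(z_idx h) : poly2).
Local Notation W h := ('X_(w_idx h) : poly2).

Definition dart_weight h k : K := dart_sign lt K h * turn_weight lt t k (mate h).

(** The entry of the matrix for the master theorem: z_k marks the next dart k,
    and the variable w of the third half-edge marks the angle of the turn. *)
Definition dart_form h k : poly2 :=
  if is_turn h k then dart_weight h k *: (Z k * W (third h k)) else 0.

Lemma sum_dart_form h :
  \sum_k dart_form h k = dart_sign lt K h *: row_form lt t (mate h).
Proof.
have [n1 n2 n3] := star_neq (mate h).
rewrite (bigD1 (vnext (mate h))) //= (bigD1 (vnext (vnext (mate h)))) /=; last by rewrite eq_sym.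
rewrite big1 ?addr0 => [|k /andP[/negbTE k1 /negbTE k2]]; last first.
  by rewrite /dart_form is_turnE k1 k2.
rewrite /dart_form !is_turnE !eqxx orbT /= /third eqxx [_ == vnext (mate h)]eq_sym (negbTE n3).
by rewrite /row_form scalerDr !scalerA.
Qed.

Definition dart_product b : poly2 := \prod_h (\sum_k dart_form h k) ^+ b h.

Definition state_weight N a : K :=
  kappa lt K a * (state_poly lt t N)@_(mu (mated a) a).

(** The coefficient of z^b in a product of powers of the row sums, which the
    master theorem is about, is a term of the series of the graph. *)
Lemma dart_productE N b : (dart_product b)@_(mu b N) = state_weight N b.
Proof.
rewrite /dart_product.
under eq_bigr => h _ do rewrite sum_dart_form exprZn.
rewrite scaler_prod mcoeffZ /state_weight /kappa big_split -mulrA; congr (_ * _).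
have -> : \prod_h (b h)`!%:R = \prod_h (mated b h)`!%:R :> K.
  by rewrite (reindex_inj (@mate_inj G)); apply: eq_bigr => h _; rewrite ffunE.
rewrite state_coeff /row_product (reindex_inj (@mate_inj G)); congr (_@_ _).
by apply: eq_bigr => h _; rewrite ffunE mateK.
Qed.

Definition turn_count S s : expo := [ffun k => #|[set h in S | third h (s h) == k]|].

Definition indicator S : expo := [ffun h => h \in S : nat].

Lemma prod_dart_form S s : perm_on S s -> (forall h, h \in S -> is_turn h (s h)) ->
  \prod_(h in S) dart_form h (s h) =
  (\prod_(h in S) dart_weight h (s h)) *: 'X_[mu (indicator S) (turn_count S s)].
Proof.
move=> s_on s_turn; under eq_bigr => h hS do rewrite /dart_form s_turn //.
rewrite scaler_prod; congr (_ *: _) => /=.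
rewrite big_split -!(big_morph _ (@mpolyXD _ K) (mpolyX0 _ _)) /= -mpolyXD.
congr 'X_[_]; apply/mnmP; apply: idx_ind => k.
  rewrite mu_z mnmDE !mnm_sumE ffunE [X in (_ + X)%N]big1 ?addn0 => [|h _]; last first.
    by rewrite mnm1E wz_idx_neq.
  rewrite (eq_bigr (fun h => (s h == k) : nat)) => [|h _]; last by rewrite mnm1E z_idx_eq.
  have [kS|kS] := boolP (k \in S).
    have kS' : (s^-1)%g k \in S by rewrite -(perm_closed _ s_on) permKV.
    rewrite (bigD1 ((s^-1)%g k)) //= permKV eqxx big1 // => h /andP[_ hk].
    by apply/eqP; rewrite eqb0; apply: contra hk => /eqP <-; rewrite permK.
  rewrite big1 // => h hS; apply/eqP; rewrite eqb0; apply: contra kS => /eqP <-.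
  by rewrite (perm_closed _ s_on).
rewrite mu_w mnmDE !mnm_sumE ffunE [X in (X + _)%N]big1 ?add0n => [|h _]; last first.
  by rewrite mnm1E zw_idx_neq.
rewrite -[RHS]sum1_card big_mkcond [RHS]big_mkcond; apply: eq_bigr => h _ /=.
by rewrite !inE mnm1E w_idx_eq; case: (h \in S); case: eqP.
Qed.

Definition count_le a N := [forall h, (a h <= N h)%N].
Definition expo_diff N a : expo := [ffun h => (N h - a h)%N].

(** The master theorem, read at the coefficient of z^b w^N. The entries of the
    matrix that lead out of the support of b contain a variable z_k which does
    not occur in this monomial. The powers of row sums in R complete the minor
    of S to the product of row sums with multiplicities b - S. *)
Lemma state_weight_sum N b (U := [set h | (0 < b h)%N]) : U != set0 ->
  \sum_(S : {set H} | S \subset U)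
  \sum_(s : {perm H} | perm_on S s && [forall h in S, is_turn h (s h)])
    (-1) ^+ s * (-1) ^+ #|S| * (\prod_(h in S) dart_weight h (s h)) *
    (if count_le (turn_count S s) N
     then state_weight (expo_diff N (turn_count S s)) (expo_sub b S) else 0) = 0.
Proof.
case/set0Pn=> h0 h0U; pose R := \prod_(h in U) (\sum_k dart_form h k) ^+ (b h).-1.
pose I (p : poly2) := (R * p)@_(mu b N) = 0.
have I0 : I 0 by rewrite /I mulr0 mcoeff0.
have ID p q : I p -> I q -> I (p + q).
  by rewrite /I mulrDr mcoeffD => -> ->; rewrite addr0.
have I_out h k p : h \in U -> k \notin U -> I (dart_form h k * p).
  rewrite !inE -eqn0Ngt => _ /eqP bk; rewrite /I /dart_form; case: ifP => _; last first.
    by rewrite mul0r mulr0 mcoeff0.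
  rewrite -!scalerAl -scalerAr mcoeffZ.
  have -> : R * (Z k * W (third h k) * p) = Z k * (R * (W (third h k) * p)) by ring.
  by rewrite mcoeffXM mu_z bk ltnn mulr0.
have := macmahon I0 ID I_out h0U; rewrite /I => e; rewrite -[RHS]e {e}.
rewrite mulr_sumr raddf_sum; apply: eq_bigr => S SU.
rewrite mulr_sumr raddf_sum /= [RHS](bigID (fun s => [forall h in S, is_turn h (s h)])) /=.
rewrite [X in _ = _ + X]big1 ?addr0 => [|s /andP[_]]; last first.
  rewrite negb_forall_in => /exists_inP[h hS /negbTE ht].
  by rewrite (bigD1 h) //= /dart_form ht !(mul0r, mulr0) mcoeff0.
apply: eq_bigr => s /andP[s_on /forall_inP s_turn].
rewrite (prod_dart_form s_on s_turn) -!scalerAr -!scalerAl -!scalerAr.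
set w := \prod_(h in S) dart_weight h (s h).
have -> : R * ((-1) ^+ s * ((-1) ^+ #|S| * 'X_[mu (indicator S) (turn_count S s)] *
      \prod_(h in U :\: S) \sum_k dart_form h k)) =
    ((-1) ^+ s * (-1) ^+ #|S|) *: ('X_[mu (indicator S) (turn_count S s)] * dart_product (expo_sub b S)).
  have -> : dart_product (expo_sub b S) = R * \prod_(h in U :\: S) \sum_k dart_form h k.
    rewrite /dart_product /R (bigID (mem U)) /= [X in _ * X]big1 ?mulr1 => [|h]; last first.
      by rewrite inE -eqn0Ngt => /eqP bh; rewrite ffunE bh.
    rewrite big_mkcond [X in _ = _ * X]big_mkcond [X in _ = X * _]big_mkcond -big_split.
    apply: eq_bigr => h _ /=; rewrite !inE ffunE.
    case: (boolP (0 < b h)%N) => bh; last by rewrite andbF mulr1.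
    rewrite andbT; case: (h \in S); rewrite /= ?mulr1 ?subn1 // subn0.
    by rewrite -exprSr prednK.
  rewrite -mul_mpolyC rmorphM !rmorph_sign.
  by rewrite -!mulrA mulrCA; congr (_ * _); rewrite mulrCA; congr (_ * _); rewrite mulrCA.
rewrite !mcoeffZ mcoeff_monomialM.
have -> : (mu (indicator S) (turn_count S s) <= mu b N)%MM = count_le (turn_count S s) N.
  apply/mnm_lepP/forallP => [le h|le].
    by have := le (w_idx h); rewrite !mu_w.
  apply: idx_ind => h; rewrite ?mu_z ?mu_w // ffunE.
  by case: (boolP (h \in S)) => // /(subsetP SU); rewrite inE.
have -> : (mu b N - mu (indicator S) (turn_count S s))%MM =
    mu (expo_sub b S) (expo_diff N (turn_count S s)).
  by apply/mnmP; apply: idx_ind => h; rewrite mnmBE ?mu_z ?mu_w !ffunE.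
by rewrite dart_productE mulrA [w * _]mulrC; case: ifP.
Qed.
End TurnExpansion.

(** * Curves as permutations of darts *)

Section CurvesAsPermutations.
Variable G : trivalent_graph.
Local Notation H := (half_edge G).
Implicit Types (h k : H) (S : {set H}) (s : {perm H}) (g : curve G).

Definition curve_darts g : {set H} := [set h | val g h != None].

(** The partial map of a curve, extended by the identity. *)
Definition successor g h := odflt h (val g h).

Lemma curve_stepP g h k : val g h = Some k ->
  [/\ is_turn h k, k \in curve_darts g & forall h', val g h' = Some k -> h' = h].
Proof.
move=> gh; have /forallP/(_ h) := valP g; rewrite gh => /and4P[ok kh gk /forallP inj].
split; rewrite /is_turn ?ok ?inE // => h' gh'.
by have := inj h'; rewrite gh' eqxx => /eqP.
Qed.

Lemma successor_inj g : injective (successor g).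
Proof.
move=> h h'; rewrite /successor; case gh: (val g h) => [k|]; case gh': (val g h') => [k'|] //= e.
- by have [_ _ inj] := curve_stepP gh'; apply: inj; rewrite gh e.
- by have [_] := curve_stepP gh; rewrite inE e gh'.
- by have [_] := curve_stepP gh'; rewrite inE -e gh.
Qed.

Definition curve_perm g : {perm H} := perm (@successor_inj g).

Lemma curve_permE g h :
  val g h = if h \in curve_darts g then Some (curve_perm g h) else None.
Proof. by rewrite inE permE /successor; case: (val g h). Qed.

Lemma curve_perm_on g : perm_on (curve_darts g) (curve_perm g).
Proof.
by apply/subsetP=> h; rewrite inE permE /successor inE; case: (val g h) => //=; rewrite eqxx.
Qed.

Lemma curve_perm_turn g h : h \in curve_darts g -> is_turn h (curve_perm g h).
Proof. by move=> hg; have := curve_permE g h; rewrite hg => /curve_stepP[]. Qed.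

Definition next_dart S s : {ffun H -> option H} :=
  [ffun h => if h \in S then Some (s h) else None].

Lemma next_dart_curve S s : perm_on S s -> (forall h, h \in S -> is_turn h (s h)) ->
  is_curve (next_dart S s).
Proof.
move=> s_on s_turn; apply/forallP=> h; rewrite ffunE; case: ifP => // hS.
have /andP[-> ->] := s_turn h hS; rewrite ffunE (perm_closed _ s_on) hS /=.
apply/forallP=> h'; rewrite ffunE; case: ifP => // _.
by apply/implyP=> /eqP[/perm_inj->].
Qed.

(** A curve amounts to a set S of darts and to a permutation of S that makes a
    turn at every dart. *)
Lemma sum_curves (W : nmodType) (P : pred {set H}) (F : {set H} -> {perm H} -> W) :
  \sum_(S | P S) \sum_(s | perm_on S s && [forall h in S, is_turn h (s h)]) F S s =
  \sum_(g | P (curve_darts g)) F (curve_darts g) (curve_perm g).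
Proof.
have no_curve : is_curve (next_dart set0 1%g).
  by apply: next_dart_curve => [|h]; rewrite ?perm_on1 ?inE.
pose g0 : curve G := Sub _ no_curve.
rewrite pair_big_dep /= (reindex_onto (fun g => (curve_darts g, curve_perm g))
  (fun p => insubd g0 (next_dart p.1 p.2))) /=; last first.
  move=> [S s] /and3P[_ s_on /forall_inP s_turn].
  have gE : val (insubd g0 (next_dart S s)) = next_dart S s.
    by rewrite insubdK //; apply: next_dart_curve.
  have dE : curve_darts (insubd g0 (next_dart S s)) = S.
    by apply/setP=> h; rewrite inE gE ffunE; case: ifP.
  congr (_, _) => //; apply/permP=> h; rewrite permE /successor gE ffunE.
  by case: (boolP (h \in S)) => //= hS; rewrite (out_perm s_on hS).
apply: eq_bigl => g; rewrite curve_perm_on /=.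
have -> : [forall h in curve_darts g, is_turn h (curve_perm g h)].
  by apply/forall_inP; apply: curve_perm_turn.
have -> : insubd g0 (next_dart (curve_darts g) (curve_perm g)) = g.
  apply: val_inj; rewrite val_insubd.
  have -> : next_dart (curve_darts g) (curve_perm g) = val g.
    by apply/ffunP=> h; rewrite ffunE curve_permE.
  by rewrite (valP g).
by rewrite eqxx !andbT.
Qed.

Lemma turn_count_curve g :
  turn_count (curve_darts g) (curve_perm g) = color_exponent [ffun a => turns g a].
Proof.
apply/ffunP=> k; rewrite !ffunE /turns; congr #|pred_of_set _|; apply/setP=> h; rewrite !inE.
case gh: (val g h) => [l|] //=; have [ht _ _] := curve_stepP gh.
by rewrite permE /successor gh /= (third_eq _ ht).
Qed.

Variables (lt : rel H) (lt_compatible : compatible_order lt).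
Variables (K : numFieldType) (t : H -> K).

Lemma sign_sum (I : finType) (P : pred I) (F : I -> bool) :
  (-1) ^+ (\sum_(i | P i) F i)%R = \prod_(i | P i) (-1) ^+ F i :> K.
Proof.
by apply: (big_morph (fun b : bool => (-1) ^+ b)) => // x y; exact: signr_addb.
Qed.

(** The weight of a curve in the determinant is its weight in the theorem, up
    to the crossing sign of its edges, by [curve_sign_parity]. In the trace,
    the factor t of each dart is moved to the turn that leads to this dart. *)
Lemma curve_weightE g (S := curve_darts g) (s := curve_perm g) :
  (-1) ^+ crossings g * curve_trace t g =
  (-1) ^+ crossing_exponent lt (edge_multiplicity S) *
  ((-1) ^+ s * (-1) ^+ #|S| * \prod_(h in S) dart_weight lt t h (s h)).
Proof.
have s_turn h : h \in S -> origin (s h) = origin (mate h) /\ s h != mate h.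
  by move=> /curve_perm_turn/andP[/eqP].
have -> : curve_trace t g = \prod_(h in S) (t (s h) / t (mate h)).
  rewrite /curve_trace big_split [RHS]big_split /= -/S; congr (_ * _).
    rewrite [LHS](eq_bigl (mem S)) => [|h]; last by rewrite /= inE.
    rewrite [LHS](reindex_inj (@perm_inj _ s)); apply: eq_bigl => h.
    exact: (perm_closed _ (curve_perm_on g)).
  by apply: eq_bigl => h; rewrite inE.
have -> : \prod_(h in S) dart_weight lt t h (s h) =
    (-1) ^+ #|S| * (-1) ^+ (\sum_(h in S) (lt h (mate h) + lt (s h) (mate h)))%R *
    \prod_(h in S) (t (s h) / t (mate h)).
  rewrite sign_sum -prodr_const -!big_split; apply: eq_bigr => h _ /=.
  rewrite /dart_weight /dart_sign /turn_weight signr_addb; ring.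
rewrite -signr_odd (curve_sign_parity lt_compatible (curve_perm_on g) s_turn (curve_permE g)).
by rewrite 2!signr_addb signr_odd -!mulrA signrMK.
Qed.
End CurvesAsPermutations.

(** * Inversion of the series *)

Section Inversion.
Variables (R : realType) (G : trivalent_graph).
Local Notation H := (half_edge G).
Local Notation E := (edge G).
Implicit Types (h k : H) (S : {set H}) (s : {perm H}) (g : curve G).
Variables (lt : rel H) (lt_compatible : compatible_order lt).
Local Notation expo := {ffun H -> nat}.
Implicit Types (a b N : expo).
Variables (K : numFieldType) (t : H -> K).
Hypothesis t_neq0 : forall h, t h != 0.

Definition crossing_sign a : K := (-1) ^+ crossing_exponent lt (edge_color a).

Lemma state_weight_supp N a : state_weight lt t N a != 0 ->
  mu (mated a) a \in msupp (state_poly lt t N).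
Proof.
by apply: contraNT => /memN_msupp_eq0; rewrite /state_weight => ->; rewrite mulr0.
Qed.

Lemma state_weight_bound N a h : (\sum_k N k < a h)%N -> state_weight lt t N a = 0.
Proof.
move=> ah; apply/eqP/negPn/negP => /state_weight_supp /z_degree_state_poly e.
by move: ah; rewrite -e (bigD1 (mate h)) //= mu_z ffunE mateK ltnNge leq_addr.
Qed.

Lemma even_edge_color N a : state_weight lt t N a != 0 ->
  even_at_vertices (fun e => odd (edge_color a e)).
Proof.
move=> /state_weight_supp supp v.
have degree h : edge_color a (edge_of h) = (N (vnext h) + N (vnext (vnext h)))%N.
  by rewrite -(star_degree_state_poly h supp) mu_z mu_w edge_colorE ffunE addnC.
have /card_gt0P[h] : (0 < #|[set h | origin h == v]|)%N by rewrite card_star.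
rewrite inE => /eqP <-; rewrite sum_star !degree !vnextK3 !oddD.
by case: (odd (N h)); case: (odd (N (vnext h))); case: (odd (N (vnext (vnext h)))).
Qed.

(** The multiplicity that is left and the curve that is removed are both
    cycles modulo 2, so that their crossing exponents add up. *)
Lemma crossing_sign_sub N b g (S := curve_darts g) : planar G R ->
    (forall h, h \in S -> (0 < b h)%N) ->
    state_weight lt t N (expo_sub b S) != 0 ->
  crossing_sign (expo_sub b S) * (-1) ^+ crossing_exponent lt (edge_multiplicity S) =
  crossing_sign b.
Proof.
move=> G_planar pos nz.
have mult_even : even_at_vertices (fun e => odd (edge_multiplicity S e)).
  apply: (even_edge_multiplicity (curve_perm_on g)) => h.
  by move=> /curve_perm_turn/andP[/eqP].
rewrite /crossing_sign -signr_odd -[(-1) ^+ crossing_exponent lt (edge_multiplicity S)]signr_odd.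
rewrite -signr_addb [X in (-1) ^+ nat_of_bool X](_ : _ =
    odd (crossing_exponent lt (fun e => edge_color (expo_sub b S) e + edge_multiplicity S e)%N)); last first.
  by symmetry; apply: (odd_crossing_exponentD lt_compatible G_planar (even_edge_color nz) mult_even).
rewrite signr_odd; congr (_ ^+ crossing_exponent _ _); apply: boolp.funext => e.
rewrite /edge_color /edge_multiplicity -big_split; apply: eq_bigr => h _ /=.
by rewrite ffunE; case: (boolP (h \in S)) => [/pos|]; lia.
Qed.

Definition macmahon_term N b S s : K :=
  (-1) ^+ s * (-1) ^+ #|S| * (\prod_(h in S) dart_weight lt t h (s h)) *
  (if count_le (turn_count S s) N
   then state_weight lt t (expo_diff N (turn_count S s)) (expo_sub b S) else 0).

Lemma sum_macmahon_terms N b :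
  \sum_(g | curve_darts g \subset [set h | (0 < b h)%N])
    macmahon_term N b (curve_darts g) (curve_perm g) =
  ((b == [ffun => 0%N]) && (N == [ffun => 0%N]))%:R.
Proof.
rewrite -(sum_curves (fun S => S \subset [set h | (0 < b h)%N]) (macmahon_term N b)).
have supp0 : ([set h | (0 < b h)%N] == set0) = (b == [ffun => 0%N]).
  rewrite expo_eq0; apply/eqP/forallP=> [/setP b0 h|b0].
    by have := b0 h; rewrite !inE lt0n => /negbT; rewrite negbK.
  by apply/setP=> h; rewrite !inE lt0n b0.
have [b0|b_neq0] := eqVneq b [ffun => 0%N]; last by rewrite state_weight_sum ?supp0.
have -> : [set h | (0 < b h)%N] = set0 by apply/eqP; rewrite supp0 b0.
rewrite (big_pred1 set0) => [|S]; last by rewrite /= subset0.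
rewrite (big_pred1 1%g) => [|s]; last first.
  apply/andP/eqP=> [[s_on _]|->]; last first.
    by rewrite perm_on1; split=> //; apply/forall_inP=> h; rewrite inE.
  by apply/permP=> h; rewrite perm1 (out_perm s_on) ?inE.
have turns0 : turn_count set0 (1%g : {perm H}) = [ffun => 0%N].
  apply/ffunP=> h; rewrite !ffunE; apply/eqP; rewrite cards_eq0; apply/eqP/setP=> k.
  by rewrite !inE.
rewrite /macmahon_term odd_perm1 cards0 !expr0 big_set0 !mul1r turns0.
have -> : count_le [ffun => 0%N] N by apply/forallP=> h; rewrite ffunE.
have -> : expo_diff N [ffun => 0%N] = N by apply/ffunP=> h; rewrite !ffunE subn0.
have -> : expo_sub b set0 = b by apply/ffunP=> h; rewrite !ffunE inE subn0.
rewrite -dart_productE /dart_product big1 => [|h _]; last by rewrite b0 ffunE.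
rewrite mcoeff1; congr (nat_of_bool _)%:R; rewrite b0.
apply/eqP/eqP=> [/mnmP N0|->].
  by apply/ffunP=> h; have := N0 (w_idx h); rewrite mu_w mnm0E ffunE.
by apply/mnmP; apply: idx_ind => h; rewrite ?mu_z ?mu_w mnm0E ffunE.
Qed.

Variable psi : H -> SL2 K.
Hypothesis psi_diagonal : forall h, val (psi h) = diagonal (t h).

Definition exponent_sub (m n : exponent G) : exponent G := [ffun a => (m a - n a)%N].

Lemma total_degree_sub (m n : exponent G) :
  (total_degree (exponent_sub m n) <= total_degree m)%N.
Proof. by apply: leq_sum => a _; rewrite ffunE leq_subr. Qed.

Lemma series_mul_curves (f : series G K) (m : exponent G) :
  series_mul f (curve_series t) m =
  \sum_g (-1) ^+ crossings g * curve_trace t g *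
    (if [forall a, (turns g a <= m a)%N] then f (exponent_sub m [ffun a => turns g a]) else 0).
Proof.
rewrite /series_mul /curve_series.
under eq_bigr => n _ do rewrite mulr_sumr.
rewrite (exchange_big_dep predT) //=; apply: eq_bigr => g _.
case: (boolP [forall a, (turns g a <= m a)%N]) => [/forallP le|/forallPn[a]]; last first.
  rewrite -ltnNge mulr0 => lt_a; apply: big1 => n /andP[_ /eqP/ffunP/(_ a)].
  by rewrite !ffunE; lia.
have m_le (a : angle G) : (m a <= total_degree m)%N by rewrite /total_degree (bigD1 a) //= leq_addr.
have diff_lt (a : angle G) : (m a - turns g a < (total_degree m).+1)%N.
  by rewrite ltnS (leq_trans (leq_subr _ _)).
rewrite (big_pred1 [ffun a => Ordinal (diff_lt a)]) => [|n].
  by rewrite mulrC; congr (_ * f _); apply/ffunP=> a; rewrite !ffunE.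
apply/andP/eqP=> [[/forallP nm /eqP/ffunP e]|->].
  apply/ffunP=> a; apply: val_inj; rewrite ffunE /=.
  by have := e a; rewrite !ffunE => ->; rewrite subKn.
split; first by apply/forallP=> a; rewrite ffunE leq_subr.
by apply/eqP/ffunP=> a; rewrite !ffunE /= subKn.
Qed.

(** The product of the two series is a sum over the multiplicities a and the
    curves g, which is grouped by the multiplicity b = a + g of all the darts.
    The crossing signs of a and g combine to that of b, and the terms with the
    same b form the alternating sum of the master theorem, which vanishes
    except for b = 0. *)
Lemma series_inverse : planar G R ->
  series_mul (Z_series lt psi) (curve_series t) =1 @series_one G K.
Proof.
(* The bound exceeds the degree by one because b = a + g may exceed a by one. *)
move=> G_planar m; pose d := (total_degree m).+1; pose N := color_exponent m.
rewrite series_mul_curves.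
transitivity (\sum_g \sum_(b : {ffun H -> 'I_d.+1} |
      curve_darts g \subset [set h | (0 < expo_nat b h)%N])
    crossing_sign (expo_nat b) *
    macmahon_term N (expo_nat b) (curve_darts g) (curve_perm g)).
  apply: eq_bigr => g _; set S := curve_darts g; set n := [ffun a => turns g a].
  have fitsE : count_le (turn_count S (curve_perm g)) N = [forall a, (turns g a <= m a)%N].
    rewrite turn_count_curve; apply/forallP/forallP=> [le a|le h]; last first.
      by have := le (opposite_angle h); rewrite !ffunE.
    by have /eqP <- := xchooseP (opposite_angle_surj a); have := le (xchoose (opposite_angle_surj a)); rewrite !ffunE.
  have diffE : color_exponent (exponent_sub m n) = expo_diff N (turn_count S (curve_perm g)).
    by rewrite turn_count_curve; apply/ffunP=> h; rewrite !ffunE.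
  have N_le : (\sum_h color_exponent (exponent_sub m n) h <= total_degree m)%N.
    by rewrite -total_degreeE total_degree_sub.
  rewrite /macmahon_term fitsE -diffE; case: ifP => _; last first.
    by rewrite mulr0 big1 // => b _; rewrite !mulr0.
  rewrite (Z_seriesE lt_compatible t_neq0 psi_diagonal (d := d)); last first.
    by apply: leq_trans (total_degree_sub _ _) _; rewrite /d.
  pose f b := crossing_sign (expo_sub b S) *
    state_weight lt t (color_exponent (exponent_sub m n)) (expo_sub b S).
  rewrite [X in _ * X](_ : _ = \sum_(a : {ffun H -> 'I_d.+1}) f (expo_add (expo_nat a) S)); last first.
    by apply: eq_bigr => a _; rewrite /f expo_addK.
  rewrite sum_expo_add => [|b h bh]; last first.
    rewrite /f (@state_weight_bound _ _ h) ?mulr0 // ffunE.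
    by apply: leq_ltn_trans N_le _; move: bh; rewrite /d; case: (h \in S); lia.
  rewrite mulr_sumr; apply: eq_big => [b|b /forall_inP pos].
    apply/forall_inP/subsetP=> le h /le; rewrite ?inE ffunE //.
  rewrite /f (curve_weightE lt_compatible) -/S.
  have [->|nz] := eqVneq (state_weight lt t (color_exponent (exponent_sub m n)) (expo_sub (expo_nat b) S)) 0.
    by rewrite !mulr0.
  rewrite -(crossing_sign_sub G_planar _ nz); last by move=> h /pos; rewrite ffunE.
  by rewrite -/S mulrACA [X in X * _]mulrC.
rewrite (exchange_big_dep predT) //=.
under eq_bigr => b _ do rewrite -mulr_sumr sum_macmahon_terms.
have zero0 : expo_nat [ffun => ord0 : 'I_d.+1] = [ffun => 0%N] :> expo.
  by apply/ffunP=> h; rewrite !ffunE.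
rewrite (bigD1 [ffun => ord0]) //= big1 ?addr0 => [|b b0]; last first.
  case: eqP => [e|]; last by rewrite mulr0.
  case/eqP: b0; apply/ffunP=> h; apply: val_inj.
  by have /ffunP/(_ h) := e; rewrite !ffunE.
rewrite zero0 eqxx /crossing_sign /crossing_exponent big1 ?mul1r => [|p _]; last first.
  by rewrite /edge_color big1 // => h _; rewrite ffunE.
rewrite /series_one /N; congr (nat_of_bool _)%:R.
rewrite -(inj_eq (@color_exponent_inj G)); congr (_ == _).
by apply/ffunP=> h; rewrite !ffunE.
Qed.
End Inversion.

Theorem theorem3p1 (R : realType) (G : trivalent_graph)
    (G_connected : graph_connected G) (G_nonempty : (0 < #|vertex G|)%N)
    (G_planar : planar G R)
    (lt : rel (half_edge G)) (lt_compatible : compatible_order lt)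
    (t : half_edge G -> R) (t_neq0 : forall h, t h != 0)
    (psi : half_edge G -> SL2 R[i])
    (psi_diagonal : forall h, val (psi h) = diagonal (t h)%:C%C) :
  series_mul (Z_series lt psi) (curve_series (fun h => (t h)%:C%C))
    =1 @series_one G R[i].
Proof.
apply: (series_inverse lt_compatible _ psi_diagonal G_planar) => h.
by rewrite fmorph_eq0.
Qed.
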